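(* Let $\epsilon\in\mathbb{R}$, $\epsilon\ne 0$. There exists $\delta>0$ such that if $u\in C(\mathbb{R};H^1(\mathbb{R}))$ is a global odd solution of $$iu_t+u_{xx}=|u|^2u+\epsilon|u|^4u,\qquad (t,x)\in\mathbb{R}\times\mathbb{R},$$ which is small in the sense that $\|u(0)\|_{H^1(\mathbb{R})}\le\delta$, then for every bounded interval $I\subset\mathbb{R}$, $$\lim_{t\to\infty}\Big(\|u(t)\|_{L^2(I)}+\|u(t)\|_{L^\infty(I)}\Big)=0.$$
   Context: $u$ is complex-valued and satisfies the equation (in $H^{-1}(\mathbb{R})$) for all $t\in\mathbb{R}$; odd means $u(t,-x)=-u(t,x)$ for all $t,x$. *)

(* Defs.v *)
From HB Require Import structures.
From mathcomp Require Export all_boot all_order all_algebra.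
From mathcomp Require Export complex.
From mathcomp Require Export all_classical all_reals all_analysis.
Set Implicit Arguments.
Unset Strict Implicit.
Unset Printing Implicit Defensive.
Import Order.TTheory GRing.Theory Num.Theory.
Export numFieldNormedType.Exports.

Local Open Scope classical_set_scope.
Local Open Scope ring_scope.

Section NLS.
Context {R : realType}.
Implicit Types (f g : R -> R[i]) (phi : R -> R) (D : set R) (p : \bar R).
(* An element of H^{-1}, given as an antilinear form on H^1: only the values on
   functions satisfying [H1] are meaningful. *)
Implicit Types (U : (R -> R[i]) -> R[i]) (u : R -> R -> R[i]).

Notation leb := (@lebesgue_measure R).

Definition cmod (z : R[i]) : R := ComplexField.Normc.normc z.

Definition cmeasurable f : Prop :=
  measurable_fun setT (fun x => complex.Re (f x)) /\
  measurable_fun setT (fun x => complex.Im (f x)).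

Definition cintegral f : R[i] :=
  Complex (\int[leb]_x complex.Re (f x)) (\int[leb]_x complex.Im (f x)).

(* The L^p(D) norm; [Lnorm leb +oo] is the essential supremum. *)
Definition cLnorm p D f : \bar R :=
  Lnorm leb p ((fun x => (cmod (f x))%:E) \_ D).

(* Elements of L^2 and H^1 are represented by Borel functions defined
   everywhere; the norms and integrals below depend only on a.e. classes. *)
Definition L2 f : Prop := cmeasurable f /\ (cLnorm 2%:E setT f < +oo)%E.

Definition test_function phi : Prop :=
  (forall n x, derivable (derive1n n phi) x 1) /\
  (exists M : R, forall x, M < `|x| -> phi x = 0).

(* Real test functions suffice, by linearity. *)
Definition is_weak_deriv f g : Prop :=
  forall phi, test_function phi ->
    cintegral (fun x => f x * (derive1 phi x)%:C%C) =
    - cintegral (fun x => g x * (phi x)%:C%C).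

Definition H1 f : Prop := L2 f /\ exists g, L2 g /\ is_weak_deriv f g.

(* The weak derivative of an H^1 function is unique a.e.; pick one. *)
Definition weak_deriv f : R -> R[i] :=
  xget (fun=> 0) [set g | L2 g /\ is_weak_deriv f g].

(* Meaningful only when [H1 f]. *)
Definition H1norm f : \bar R :=
  ((cLnorm 2%:E setT f `^ 2 + cLnorm 2%:E setT (weak_deriv f) `^ 2)
     `^ 2^-1)%E.

Definition continuous_H1 u : Prop :=
  (forall t, H1 (u t)) /\
  (forall t, H1norm (fun x => u s x - u t x) @[s --> t] --> 0%E).

Definition Hm1norm U : \bar R :=
  ereal_sup [set (cmod (U v))%:E | v in [set v | H1 v /\ (H1norm v <= 1)%E]].

Definition Hm1 U : Prop :=
  (forall (a : R[i]) v w, H1 v -> H1 w ->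
     U (fun x => a * v x + w x) = conjc a * U v + U w) /\
  (Hm1norm U < +oo)%E.

(* The embedding of L^2 into H^{-1}. *)
Definition toHm1 f : (R -> R[i]) -> R[i] :=
  fun v => cintegral (fun x => f x * conjc (v x)).

(* f_xx as an element of H^{-1}, for f in H^1. *)
Definition dxx f : (R -> R[i]) -> R[i] :=
  fun v => - cintegral (fun x => weak_deriv f x * conjc (weak_deriv v x)).

(* U is the derivative of u at time t, as a norm limit in H^{-1}. *)
Definition is_time_deriv u (t : R) U : Prop :=
  Hm1 U /\
  Hm1norm (fun v => toHm1 (fun x => (h^-1)%:C%C * (u (t + h) x - u t x)) v
                    - U v) @[h --> 0^'] --> 0%E.

Definition nonlinearity (eps : R) f : R -> R[i] :=
  fun x => ((cmod (f x)) ^+ 2)%:C%C * f x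
           + eps%:C%C * ((cmod (f x)) ^+ 4)%:C%C * f x.

Definition solves_NLS (eps : R) u : Prop :=
  forall t, exists ut, is_time_deriv u t ut /\
    forall v, H1 v ->
      'i%C * ut v + dxx (u t) v = toHm1 (nonlinearity eps (u t)) v.

Definition odd_in_space u : Prop := forall t x, u t (- x) = - u t x.

End NLS.

(* Main.v *)
From HB Require Import structures.
Require Import Defs.
From mathcomp Require Import all_boot all_order all_algebra.
From mathcomp Require Import complex.
From mathcomp Require Import all_classical all_reals all_analysis.
From mathcomp Require Import measurable_realfun ess_sup_inf.
From mathcomp Require Import ring lra.
Set Implicit Arguments.
Unset Strict Implicit.
Unset Printing Implicit Defensive.
Import Order.TTheory GRing.Theory Num.Theory.
Import numFieldNormedType.Exports.
Local Open Scope classical_set_scope.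
Local Open Scope ring_scope.

(* Write u = U1 + i U2 and let w = 1/(1+|x|), phi = x w, so phi' = w^2. Mass and
   energy are conserved, so small data stay small in H^1; the embedding of H^1 in
   L^oo then lets the defocusing cubic term absorb the quintic one.
   Oddness is used only through u(t,0) = 0. For the virial functional
     J = int phi (U1 d_x U2 - U2 d_x U1)
   it gives, after adding the integral of the exact derivative of
   - sgn(x) w^3 |u|^2 / 2, the coercivity
     J' >= (1/5) int (w^2 |d_x u|^2 + w^4 |u|^2).
   As J is bounded, the right-hand side is integrable in time. The weighted mass
   int w^4 |u|^2 is controlled by it and so is its time derivative, so it tends
   to 0, and the bound of d_x u in L^2 turns this into local uniform decay.

   The solution is only in H^1, so that J and the energy are differentiated after
   replacing d_x by difference quotients, which are bounded on L^2. The
   absolutely continuous representatives come from the du Bois-Reymond lemma. *)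

(** * Integrals and the L2 inner product *)

Section Integrals.
Context {R : realType}.
Notation mu := (@lebesgue_measure R).
Implicit Types (f g F G : R -> R) (a b c h x y : R).

(** Away from 0, [phi''' = 6 w^4], so the formal virial density [2 w^2 |u_x|^2 - 3 w^4 |u|^2] is
    indefinite and its coercivity is a Hardy-type inequality on each half line. Adding
    [- lambda (sgn(x) w^3 |u|^2)'] before any integration by parts gives, for each component, the
    form [2 X^2 - (2 + 2 lambda) X Y + 3 lambda Y^2] in [X = w u_x], [Y = sgn(x) w^2 u], positive
    definite for [|lambda - 2| < sqrt 3]; [lambda = 1/2] leaves a smallest eigenvalue of about
    0.229, hence the constant 1/5. The nonlinear part is [w^2 |u|^4 (1/2 + 2 eps |u|^2 / 3)],
    nonnegative once [|eps| |u|^2 <= 3/4]. The time derivative of u exists only in H^{-1}. A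
    functional is differentiable along such a flow when its gradient lies in H^1 and its remainder
    is quadratic in the L^2 norm of the increment, since the square of this norm is [o(h)]. The mass
    and the potential energy are of this kind; [J] and the kinetic energy are not, as their
    gradients contain derivatives of u. *)

Lemma ae_mono (P Q : R -> Prop) : (forall x, P x -> Q x) ->
  {ae mu, forall x, P x} -> {ae mu, forall x, Q x}.
Proof.
by move=> PQ; apply: filterS; first exact: (ae_filter_ringOfSetsType mu).
Qed.

Lemma ae_and (P Q : R -> Prop) : {ae mu, forall x, P x} ->
  {ae mu, forall x, Q x} -> {ae mu, forall x, P x /\ Q x}.
Proof.
move=> p q.
by apply: (@filterS2 _ _ (ae_filter_ringOfSetsType mu) _ _ _ _ p q).
Qed.

Definition mf f := measurable_fun [set: R] f.
Definition itg f := mu.-integrable setT (EFin \o f).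
Definition Int f : R := \int[mu]_x f x.

Lemma itg_mf f : itg f -> mf f.
Proof. by move=> /integrableP[/measurable_EFinP]. Qed.

Lemma mfD f g : mf f -> mf g -> mf (f + g).
Proof. exact: measurable_funD. Qed.
Lemma mfB f g : mf f -> mf g -> mf (f - g).
Proof. exact: measurable_funB. Qed.
Lemma mfM f g : mf f -> mf g -> mf (f * g).
Proof. exact: measurable_funM. Qed.
Lemma mfN f : mf f -> mf (- f).
Proof. by move=> mg; exact: measurableT_comp. Qed.
Lemma mfZ c f : mf f -> mf (c *: f).
Proof. by move=> mg; apply: measurable_funM. Qed.
Lemma mfX n f : mf f -> mf (fun x => f x ^+ n).
Proof. exact: measurable_funX. Qed.
Lemma mf_cst c : mf (fun=> c).
Proof. exact: measurable_cst. Qed.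
Lemma mf_abs f : mf f -> mf (fun x => `|f x|).
Proof. by move=> mg; exact: measurableT_comp. Qed.

Lemma mf_cont f : continuous f -> mf f.
Proof. exact: continuous_measurable_fun. Qed.

Lemma itgD f g : itg f -> itg g -> itg (f + g).
Proof. by move=> fi gi; exact: (integrableD measurableT fi gi). Qed.
Lemma itgB f g : itg f -> itg g -> itg (f - g).
Proof. by move=> fi gi; exact: (integrableB measurableT fi gi). Qed.
Lemma itgZ c f : itg f -> itg (c *: f).
Proof. by move=> fi; exact: (integrableZl measurableT c fi). Qed.
Lemma itg_le f g : mf f -> (forall x, `|f x| <= g x) -> itg g -> itg f.
Proof.
move=> mf_ fg gi; apply: (le_integrable measurableT _ _ gi).
  exact/measurable_EFinP.
by move=> x _ /=; rewrite lee_fin (le_trans (fg x))// ler_norm.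
Qed.

Lemma IntD f g : itg f -> itg g -> Int (f + g) = Int f + Int g.
Proof. by move=> fi gi; exact: RintegralD. Qed.
Lemma IntB f g : itg f -> itg g -> Int (f - g) = Int f - Int g.
Proof. by move=> fi gi; exact: RintegralB. Qed.
Lemma IntZ c f : itg f -> Int (c *: f) = c * Int f.
Proof. by move=> fi; exact: RintegralZl. Qed.
Lemma Int_ge0 f : (forall x, 0 <= f x) -> 0 <= Int f.
Proof. by move=> f0; apply: Rintegral_ge0 => x _. Qed.
Lemma le_Int f g : itg f -> itg g -> (forall x, f x <= g x) -> Int f <= Int g.
Proof. by move=> fi gi fg; exact: le_Rintegral. Qed.
Lemma Int0 : Int 0 = 0.
Proof. by rewrite /Int /Rintegral integral0. Qed.
Lemma le_abs_Int f g : itg f -> itg g -> (forall x, `|f x| <= g x) ->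
  `|Int f| <= Int g.
Proof.
move=> fi gi fg; apply: (le_trans (le_normr_Rintegral measurableT fi)).
by apply: le_Rintegral => //; exact: (integrable_norm fi).
Qed.

Lemma EFin_Int f : itg f -> (\int[mu]_x (f x)%:E)%E = (Int f)%:E.
Proof. by move=> fi; rewrite /Int /Rintegral fineK//; exact: integrable_fin_num. Qed.

Lemma Int_ae f g : mf f -> mf g -> {ae mu, forall x, f x = g x} ->
  Int f = Int g.
Proof.
move=> mf_ mg fg; congr fine; apply: ae_eq_integral => //;
  [exact/measurable_EFinP|exact/measurable_EFinP|].
by apply: ae_mono fg => x /= -> _.
Qed.

Lemma itg_ae f g : mf g -> {ae mu, forall x, f x = g x} -> itg f -> itg g.
Proof.
move=> mg fg fi; apply/integrableP; split; first exact/measurable_EFinP.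
move/integrableP : fi => [/measurable_EFinP mf_]; congr (_ < _)%E.
apply: ae_eq_integral => //; [apply/measurable_EFinP; exact: mf_abs..|].
by apply: ae_mono fg => x /= -> _.
Qed.

(** * Invariance of the integral under translations *)

Definition sh h f : R -> R := fun x => f (x + h).

Definition addh h : measurableTypeR R -> measurableTypeR R := fun x => x + h.

Lemma measurable_addh h : measurable_fun setT (addh h).
Proof.
apply: continuous_measurable_fun => x.
by apply: cvgD; [exact: cvg_id|exact: cvg_cst].
Qed.

HB.instance Definition _ h :=
  isMeasurableFun.Build _ _ _ _ (addh h) (measurable_addh h).

Lemma shift_measure h (A : set R) : measurable A ->
  pushforward mu (addh h) A = mu A.
Proof.
move=> mA; apply/esym/lebesgue_measure_unique => //= _ [[a b] _ <-].
rewrite /pushforward (_ : _ @^-1` _ = `]a - h, b - h]%classic); last first.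
  by apply/seteqP; split => x /=; rewrite !in_itv /= /addh ltrBlDr lerBrDr.
rewrite !lebesgue_measure_itv /= !lte_fin ltrD2r -!EFinB.
by case: ifP => // _; congr EFin; ring.
Qed.

Lemma mf_sh h f : mf f -> mf (sh h f).
Proof. by move=> mf_; apply: measurableT_comp => //; exact: measurable_addh. Qed.

Lemma itg_sh h f : itg f -> itg (sh h f).
Proof.
move=> fi; have := itg_mf fi => mf_.
apply/integrableP; split.
  by apply/measurable_EFinP; exact: mf_sh.
move/integrableP : fi => [_]; congr (_ < _)%E.
transitivity (\int[pushforward mu (addh h)]_x `|(f x)%:E|)%E.
  by apply: eq_measure_integral => A mA _; exact/esym/shift_measure.
rewrite ge0_integral_pushforward//.
by apply/measurable_EFinP; exact: mf_abs.
Qed.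

Lemma Int_sh h f : itg f -> Int (sh h f) = Int f.
Proof.
move=> fi; have := itg_mf fi => mf_; congr fine.
transitivity (\int[pushforward mu (addh h)]_x (f x)%:E)%E; last first.
  by apply: eq_measure_integral => A mA _; exact: shift_measure.
rewrite integral_pushforward//; last exact: (itg_sh h fi).
exact/measurable_EFinP.
Qed.

(** * Square-integrable functions and their inner product *)

Definition l2 f := mf f /\ itg (fun x => f x ^+ 2).
Definition ip f g : R := Int (f * g).
Definition nrm f : R := Num.sqrt (ip f f).

Lemma l2_mf f : l2 f -> mf f. Proof. by case. Qed.

Lemma norm_mul_le a b : `|a * b| <= a ^+ 2 + b ^+ 2.
Proof. by rewrite ler_norml; apply/andP; split; nra. Qed.

Lemma l2M f g : l2 f -> l2 g -> itg (f * g).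
Proof.
move=> [mf_ fi] [mg gi]; apply: (@itg_le _ (fun x => f x ^+ 2 + g x ^+ 2)).
- exact: mfM.
- by move=> x; exact: norm_mul_le.
- exact: itgD.
Qed.

Lemma l2_le f g : mf f -> (forall x, `|f x| <= `|g x|) -> l2 g -> l2 f.
Proof.
move=> mf_ fg [mg gi]; split=> //; apply: itg_le gi; first exact: mfX.
by move=> x; rewrite normrX -[leRHS]real_normK ?num_real// lerXn2r ?nnegrE.
Qed.

Lemma l2Z c f : l2 f -> l2 (c *: f).
Proof.
move=> [mf_ fi]; split; first exact: mfZ.
rewrite (_ : (fun x => _) = c ^+ 2 *: (fun x => f x ^+ 2)); first exact: itgZ.
by apply/funext => x; rewrite /= exprMn.
Qed.

Lemma l2N f : l2 f -> l2 (- f).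
Proof. by rewrite -scaleN1r; exact: l2Z. Qed.

Lemma l2D f g : l2 f -> l2 g -> l2 (f + g).
Proof.
move=> [mf_ fi] [mg gi]; split; first exact: mfD.
apply: (@itg_le _ (2 *: (fun x => f x ^+ 2) + 2 *: (fun x => g x ^+ 2))).
- by apply: mfX; exact: mfD.
- move=> x; rewrite ger0_norm ?sqr_ge0//.
  change ((f x + g x) ^+ 2 <= 2 * f x ^+ 2 + 2 * g x ^+ 2).
  by have := sqr_ge0 (f x - g x); nra.
- by apply: itgD; exact: itgZ.
Qed.

Lemma l2B f g : l2 f -> l2 g -> l2 (f - g).
Proof. by move=> fi gi; apply: l2D => //; exact: l2N. Qed.

Lemma l2Mb c p f : mf p -> (forall x, `|p x| <= c) -> l2 f -> l2 (p * f).
Proof.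
move=> mp pc fi; apply: (@l2_le _ (c *: f)); last exact: l2Z.
- by apply: mfM => //; exact: l2_mf.
- move=> x; rewrite normrM [in leRHS]normrM ler_wpM2r//.
  by rewrite (le_trans (pc x))// ler_norm.
Qed.

Lemma l2_sh h f : l2 f -> l2 (sh h f).
Proof. by move=> [mf_ fi]; split; [exact: mf_sh|exact: (itg_sh h fi)]. Qed.

Lemma l2_ae f g : mf g -> {ae mu, forall x, f x = g x} -> l2 f -> l2 g.
Proof.
move=> mg fg [mf_ fi]; split => //; apply: itg_ae fi; first exact: mfX.
by apply: ae_mono fg => x ->.
Qed.

Lemma ipC f g : ip f g = ip g f.
Proof. by rewrite /ip mulrC. Qed.
Lemma ipDl f g k : l2 f -> l2 g -> l2 k -> ip (f + g) k = ip f k + ip g k.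
Proof. by move=> *; rewrite /ip mulrDl IntD//; exact: l2M. Qed.
Lemma ipBl f g k : l2 f -> l2 g -> l2 k -> ip (f - g) k = ip f k - ip g k.
Proof. by move=> *; rewrite /ip mulrBl IntB//; exact: l2M. Qed.
Lemma ipZl c f k : l2 f -> l2 k -> ip (c *: f) k = c * ip f k.
Proof.
move=> *; rewrite /ip -IntZ; last exact: l2M.
by congr Int; apply/funext => x; rewrite [RHS]mulrA.
Qed.
Lemma ipDr f g k : l2 f -> l2 g -> l2 k -> ip k (f + g) = ip k f + ip k g.
Proof. by move=> *; rewrite ipC ipDl// !(ipC k). Qed.
Lemma ipBr f g k : l2 f -> l2 g -> l2 k -> ip k (f - g) = ip k f - ip k g.
Proof. by move=> *; rewrite ipC ipBl// !(ipC k). Qed.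
Lemma ipZr c f k : l2 f -> l2 k -> ip k (c *: f) = c * ip k f.
Proof. by move=> *; rewrite ipC ipZl// !(ipC k). Qed.
Lemma ip_ge0 f : 0 <= ip f f.
Proof. by apply: Int_ge0 => x; rewrite -expr2 sqr_ge0. Qed.
Lemma nrm_ge0 f : 0 <= nrm f. Proof. exact: sqrtr_ge0. Qed.
Lemma nrm_sq f : nrm f ^+ 2 = ip f f.
Proof. by rewrite sqr_sqrtr// ip_ge0. Qed.
Lemma ip_sh h f g : l2 f -> l2 g -> ip (sh h f) (sh h g) = ip f g.
Proof. by move=> fi gi; exact: (Int_sh h (l2M fi gi)). Qed.
Lemma nrm_sh h f : l2 f -> nrm (sh h f) = nrm f.
Proof. by move=> fi; rewrite /nrm ip_sh. Qed.
Lemma nrmZ c f : l2 f -> nrm (c *: f) = `|c| * nrm f.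
Proof.
move=> fi; rewrite /nrm ipZl//; last exact: l2Z.
by rewrite ipZr// mulrA -expr2 sqrtrM ?sqr_ge0// sqrtr_sqr.
Qed.
Lemma nrmN f : l2 f -> nrm (- f) = nrm f.
Proof. by move=> fi; rewrite -scaleN1r nrmZ// normrN1 mul1r. Qed.
(** The common source of the Cauchy-Schwarz inequalities for [ip] and for integrals over an
    interval. The case [C = 0] is included, so that neither has to treat a vanishing norm apart. *)
Lemma discriminant_le (A B C : R) : 0 <= A -> 0 <= C ->
  (forall s, 0 <= A - 2 * s * B + s ^+ 2 * C) -> B ^+ 2 <= A * C.
Proof.
move=> A0; rewrite le_eqVlt => /predU1P[<- h|C0 h].
  have [->|B0] := eqVneq B 0; first by rewrite expr0n mulr0.
  (* With [C = 0] the polynomial is affine in [s]; at this point its value is -1. *)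
  have := h ((A + 1) / (2 * B)).
  rewrite (_ : A - _ + _ = -1); last by field.
  by lra.
have := h (B / C); rewrite (_ : A - _ + _ = (A * C - B ^+ 2) / C); last first.
  by field; rewrite gt_eqF.
by rewrite pmulr_lge0 ?invr_gt0// subr_ge0.
Qed.

Lemma cauchy_schwarz f g : l2 f -> l2 g -> `|ip f g| <= nrm f * nrm g.
Proof.
move=> fi gi; rewrite -(@ler_pXn2r _ 2)// ?nnegrE ?mulr_ge0 ?nrm_ge0//.
rewrite real_normK ?num_real// exprMn !nrm_sq.
apply: discriminant_le; [exact: ip_ge0..|] => s.
have := ip_ge0 (f - s *: g).
have si := l2Z s gi; have fsi := l2B fi si.
by rewrite ipBl// !ipBr// !ipZl// !ipZr// (ipC g f); congr (_ <= _); ring.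
Qed.

Lemma nrmD f g : l2 f -> l2 g -> nrm (f + g) <= nrm f + nrm g.
Proof.
move=> fi gi; rewrite -(@ler_pXn2r _ 2)// ?nnegrE ?addr_ge0 ?nrm_ge0//.
have fgi := l2D fi gi.
rewrite nrm_sq ipDl// !ipDr// (ipC g f) -!nrm_sq.
have := cauchy_schwarz fi gi; rewrite ler_norml => /andP[_].
by nra.
Qed.

Lemma nrmB f g : l2 f -> l2 g -> nrm (f - g) <= nrm f + nrm g.
Proof. by move=> fi gi; rewrite -(nrmN gi) nrmD//; exact: l2N. Qed.

Lemma nrm_le f g : l2 f -> l2 g -> (forall x, `|f x| <= `|g x|) ->
  nrm f <= nrm g.
Proof.
move=> fi gi fg; rewrite ler_sqrt ?ip_ge0//.
apply: le_Int; [exact: l2M..|] => x.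
rewrite -[leLHS]/(f x * f x) -[leRHS]/(g x * g x) -!expr2.
by rewrite -real_normK ?num_real// -[leRHS]real_normK ?num_real// lerXn2r ?nnegrE.
Qed.

Lemma nrmMb c p f : mf p -> 0 <= c -> (forall x, `|p x| <= c) -> l2 f ->
  nrm (p * f) <= c * nrm f.
Proof.
move=> mp c0 pc fi; rewrite -[c in leRHS]ger0_norm// -nrmZ//.
apply: nrm_le; [exact: (l2Mb mp pc)|exact: l2Z|] => x.
by rewrite !normrM ler_wpM2r// (le_trans (pc x))// ler_norm.
Qed.

End Integrals.

(** * Fubini on a triangle *)

Section Primitives.
Context {R : realType}.
Notation mu := (@lebesgue_measure R).
Implicit Types (f g F G : R -> R) (a b c h x y : R).

Lemma itg_patch (A : set R) f : measurable A ->
  mu.-integrable A (EFin \o f) <-> itg (f \_ A).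
Proof. by move=> mA; rewrite /itg -restrict_EFin; exact: integrable_mkcond. Qed.

Lemma itg_patchT (A : set R) f : measurable A -> itg f -> itg (f \_ A).
Proof.
move=> mA fi; apply: (iffLR (itg_patch f mA)).
exact: integrableS fi.
Qed.

(** The kernel [f s * g t] restricted to [s <= t] is dominated by [|f s| |g t|], whose double
    integral is finite. Exchanging the two integrals is what later yields integration by parts for
    absolutely continuous functions. *)
Lemma fubini_triangle f g : itg f -> itg g ->
  Int (fun s => f s * \int[mu]_(t in `[s, +oo[) g t) =
  Int (fun t => (\int[mu]_(s in `]-oo, t]) f s) * g t).
Proof.
move=> fi gi; have mf_ := itg_mf fi; have mg := itg_mf gi.
pose T := measurableTypeR R.
pose k (z : T * T) : R := if (z.1 : R) <= z.2 then f z.1 * g z.2 else 0.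
have mk : measurable_fun setT k.
  apply: measurable_fun_ifT => //=.
  - exact: measurable_fun_ler.
  - by apply: measurable_funM; exact: measurableT_comp.
have mEk : measurable_fun setT (EFin \o k) by exact/measurable_EFinP.
have ki : (mu \x mu)%E.-integrable setT (EFin \o k).
  apply/(@integrable12ltyP _ _ _ _ R mu mu _ mEk).
  apply: (@le_lt_trans _ _ (\int[mu]_x ((Int (fun t => `|g t|)) * `|f x|)%:E)%E).
    apply: ge0_le_integral => //.
    - by move=> x _; exact: integral_ge0.
    - apply: (@measurable_fun_fubini_tonelli_F _ _ _ _ _ mu (fun z => `|(k z)%:E|%E)) => //.
      exact: measurableT_comp.
    - by apply/measurable_EFinP; apply: measurable_funM => //; exact: mf_abs.
    - move=> x _.
      have gai : itg (fun t => `|f x| * `|g t|).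
        by apply: (itgZ `|f x|); exact: (integrable_norm gi).
      rewrite mulrC -IntZ; last exact: (integrable_norm gi).
      rewrite -EFin_Int//.
      apply: ge0_le_integral => //.
      + apply: measurableT_comp => //; apply/measurable_EFinP.
        exact: (measurableT_comp mk).
      + by apply/measurable_EFinP; exact: itg_mf.
      + move=> y _ /=; rewrite lee_fin /k /=; case: ifP => _.
          by rewrite normrM.
        by rewrite normr0 mulr_ge0.
  rewrite EFin_Int ?ltry//; apply: (@itgZ _ (Int (fun t => `|g t|)) (fun x => `|f x|)).
  exact: (integrable_norm fi).
have := Fubini ki; rewrite /= => fub.
rewrite /Int; congr fine.
transitivity (\int[mu]_x \int[mu]_y (k (x, y))%:E)%E; last first.
  rewrite fub; apply: eq_integral => t _.
  transitivity (\int[mu]_x ((g t)%:E * ((f \_ `]-oo, t]) x)%:E))%E.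
    apply: eq_integral => s _; rewrite /k /= patchE mem_setE in_itv /=.
    by case: ifP => _; rewrite -EFinM ?mulr0// mulrC.
  rewrite integralZl//; last exact: itg_patchT.
  rewrite mulrC EFinM; congr (_ * _)%E; rewrite Rintegral_mkcond EFin_Int//.
  exact: itg_patchT.
apply: eq_integral => s _.
transitivity (\int[mu]_x ((f s)%:E * ((g \_ `[s, +oo[) x)%:E))%E; last first.
  apply: eq_integral => t _; rewrite /k /= patchE mem_setE in_itv /= andbT.
  by case: ifP => _; rewrite -EFinM ?mulr0.
rewrite integralZl//; last exact: itg_patchT.
rewrite EFinM; congr (_ * _)%E; rewrite Rintegral_mkcond EFin_Int//.
exact: itg_patchT.
Qed.

End Primitives.

(** * Absolutely continuous functions *)

Section Prim.
Context {R : realType}.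
Notation mu := (@lebesgue_measure R).
Implicit Types (f g F G : R -> R) (a b c h x y M : R).

Definition loci f := mf f /\
  forall x y, mu.-integrable `[x, y] (EFin \o f).
Definition II x y f : R := \int[mu]_(t in `[x, y]) f t.
(* [F] is locally absolutely continuous with a.e. derivative [f]. *)
Definition prim F f := loci f /\ forall x y, x <= y -> F y - F x = II x y f.

Lemma itg_loci f : itg f -> loci f.
Proof. by move=> fi; split; [exact: itg_mf|move=> x y; exact: integrableS fi]. Qed.

Lemma loci_patch x y f : loci f -> itg (f \_ `[x, y]).
Proof. by move=> [_ /(_ x y)]; exact: (iffLR (itg_patch _ _)). Qed.

Lemma bounded_loci M f : mf f -> (forall x, `|f x| <= M) -> loci f.
Proof.
move=> mf_ fM; split => // x y.
apply: measurable_bounded_integrable => //.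
- by rewrite /= lebesgue_measure_itv; case: ifP => _; rewrite ?ltry.
- exact: (measurable_funS measurableT).
- exists M; split; first exact: num_real.
  by move=> N MN z _ /=; rewrite (le_trans (fM z))// ltW.
Qed.

Lemma loci_cst c : loci (fun=> c).
Proof. by apply: (@bounded_loci `|c|); first exact: mf_cst. Qed.

Lemma lociD f g : loci f -> loci g -> loci (f + g).
Proof.
move=> [mf_ fi] [mg gi]; split; first exact: mfD.
by move=> x y; exact: (integrableD _ (fi x y) (gi x y)).
Qed.
Lemma lociZ c f : loci f -> loci (c *: f).
Proof.
move=> [mf_ fi]; split; first exact: mfZ.
by move=> x y; exact: (integrableZl _ c (fi x y)).
Qed.
Lemma loci_le f g : mf f -> (forall x, `|f x| <= g x) -> loci g -> loci f.
Proof.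
move=> mf_ fg [mg gi]; split => // x y.
apply: (le_integrable _ _ _ (gi x y)) => //.
  by apply/measurable_EFinP; exact: (measurable_funS measurableT).
by move=> z _ /=; rewrite lee_fin (le_trans (fg z))// ler_norm.
Qed.

Lemma l2_loci f : l2 f -> loci f.
Proof.
move=> [mf_ fi]; apply: (@loci_le _ ((fun x => f x ^+ 2) + (fun=> 1))) => //.
- move=> x; change (`|f x| <= f x ^+ 2 + 1).
  by rewrite ler_norml; apply/andP; split; nra.
- apply: lociD; first exact: itg_loci.
  exact: loci_cst.
Qed.

Lemma IID x y f g : loci f -> loci g -> II x y (f + g) = II x y f + II x y g.
Proof. by move=> [_ fi] [_ gi]; exact: RintegralD. Qed.
Lemma IIZ c x y f : loci f -> II x y (c *: f) = c * II x y f.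
Proof. by move=> [_ fi]; exact: RintegralZl. Qed.
Lemma II_split x y z f : loci f -> x <= y -> y <= z ->
  II x z f = II x y f + II y z f.
Proof.
move=> [_ fi] xy yz; apply/eqP; rewrite addrC -subr_eq; apply/eqP.
rewrite /II (@Rintegral_itvB _ f (BLeft x) (BRight z) y)//.
rewrite Rintegral_itv_obnd_cbnd//; apply: integrableS (fi y z) => // t /=.
by rewrite !in_itv /= => /andP[/ltW -> ->].
Qed.
Lemma II_refl x f : II x x f = 0.
Proof. by rewrite /II set_itv1 Rintegral_set1. Qed.
Lemma II_ge0 x y f : (forall z, 0 <= f z) -> 0 <= II x y f.
Proof. by move=> f0; exact: Rintegral_ge0. Qed.
Lemma II_le x y f g : loci f -> loci g -> (forall z, z \in `[x, y] -> f z <= g z) ->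
  II x y f <= II x y g.
Proof. by move=> [_ fi] [_ gi] fg; apply: le_Rintegral => // z; exact: fg. Qed.
Lemma eq_II x y f g : (forall z, z \in `[x, y] -> f z = g z) ->
  II x y f = II x y g.
Proof. by move=> fg; apply: eq_Rintegral => z; rewrite inE => /fg. Qed.
Lemma II_cst x y c : x <= y -> II x y (fun=> c) = c * (y - x).
Proof.
move=> xy; rewrite /II Rintegral_cst; last exact: measurable_itv.
rewrite /= lebesgue_measure_itv /= lte_fin.
by move: xy; rewrite le_eqVlt => /predU1P[->|->]; rewrite ?ltxx ?subrr.
Qed.

Lemma prim_cst c : prim (fun=> c) (fun=> 0).
Proof.
split; first exact: loci_cst.
by move=> x y xy; rewrite II_cst// mul0r subrr.
Qed.
Lemma prim_id : prim id (fun=> 1).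
Proof.
split; first exact: loci_cst.
by move=> x y xy; rewrite II_cst// mul1r.
Qed.
Lemma primD F f G g : prim F f -> prim G g -> prim (F + G) (f + g).
Proof.
move=> [fi Ff] [gi Gg]; split; first exact: lociD.
move=> x y xy; rewrite IID// -Ff// -Gg//.
by change (F y + G y - (F x + G x) = F y - F x + (G y - G x)); ring.
Qed.
Lemma primZ c F f : prim F f -> prim (c *: F) (c *: f).
Proof.
move=> [fi Ff]; split; first exact: lociZ.
move=> x y xy; rewrite IIZ// -Ff//.
by change (c * F y - c * F x = c * (F y - F x)); ring.
Qed.
Lemma primN F f : prim F f -> prim (- F) (- f).
Proof. by rewrite -[- F]scaleN1r -[- f]scaleN1r; exact: primZ. Qed.
Lemma primB F f G g : prim F f -> prim G g -> prim (F - G) (f - g).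
Proof. by move=> Ff Gg; apply: primD => //; exact: primN. Qed.

Lemma prim_loci F f : prim F f -> loci f. Proof. by case. Qed.

Lemma prim_continuous F f : prim F f -> continuous F.
Proof.
move=> [[mf_ fi] Ff] x; set a := x - 1; set b := x + 1.
have ab : a < b by rewrite /a /b; lra.
have := parameterized_integral_continuous (ltW ab) (fi a b).
move=> /(continuous_within_itvP _ ab)[+ _ _] => /(_ x).
have xab : x \in `]a, b[ by rewrite in_itv /= /a /b; apply/andP; split; lra.
move=> /(_ xab) cP.
have FE y : a <= y -> F y = F a + parameterized_integral mu a y f.
  by move=> ay; rewrite /parameterized_integral -[X in _ + X]/(II a y f) -Ff// addrC subrK.
rewrite /continuous_at FE; last by rewrite /a; lra.
apply: (@cvg_trans _ ((F a + parameterized_integral mu a y f) @[y --> x])).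
  apply: near_eq_cvg; exists 1 => //= y /=.
  by rewrite ltr_norml => /andP[_ h]; rewrite -FE// /a; lra.
exact: (cvgD (cvg_cst (F a)) cP).
Qed.

Lemma prim_mf F f : prim F f -> mf F.
Proof. by move=> /prim_continuous; exact: mf_cont. Qed.

Lemma prim_bounded F f a b : prim F f ->
  exists M, forall x, x \in `[a, b] -> `|F x| <= M.
Proof.
move=> Ff; have [li pr] := Ff.
exists (`|F a| + \int[mu]_(t in `[a, b]) `|f t|) => x.
rewrite in_itv /= => /andP[ax xb].
rewrite (_ : F x = F a + II a x f); last by rewrite -pr// addrC subrK.
rewrite (le_trans (ler_normD _ _))// lerD2l.
have [_ fi] := li.
rewrite (le_trans (le_normr_Rintegral _ (fi a x)))//.
have li' : loci (fun x => `|f x|).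
  split; first by apply: mf_abs; case: li.
  by move=> u v; exact: (integrable_norm (fi u v)).
by rewrite -/(II _ _ _) -[leRHS]/(II _ _ _) (II_split li' ax xb) lerDl II_ge0.
Qed.

Lemma prim_lociM F f g : prim F f -> loci g -> loci (F * g).
Proof.
move=> Ff [mg gi]; split; first by apply: mfM => //; exact: prim_mf Ff.
move=> x y; have [M FM] := prim_bounded x y Ff.
have [_ Mg] : loci (M *: g) by apply: lociZ.
apply: (le_integrable _ _ _ (Mg x y)) => //.
  apply/measurable_EFinP; apply: (measurable_funS measurableT) => //.
  by apply: mfM => //; exact: prim_mf Ff.
move=> z /FM Fz /=; rewrite lee_fin !normrM ler_wpM2r//.
by rewrite (le_trans Fz)// ler_norm.
Qed.

Lemma prim_ext F f x : prim F f -> F x = F 0 + (if 0 <= x then II 0 x f else - II x 0 f).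
Proof.
move=> [_ Ff]; case: ifPn => [x0|]; first by rewrite -Ff// addrC subrK.
by rewrite -ltNge => /ltW x0; rewrite -Ff// opprB addrC subrK.
Qed.

Lemma prim_exists f : loci f -> exists F, prim F f /\ F 0 = 0.
Proof.
move=> fi; exists (fun x => if 0 <= x then II 0 x f else - II x 0 f).
split; last by rewrite lexx II_refl.
split=> // x y xy.
have [x0|x0] := leP 0 x.
  by rewrite (le_trans x0 xy) (II_split fi x0 xy) addrC addKr.
have [y0|y0] := leP 0 y.
  by rewrite (II_split fi (ltW x0) y0) opprK addrC.
by rewrite (II_split fi xy (ltW y0)) opprK addrC addrK.
Qed.

(* Fubini on the triangle {s <= t}: [f s * (G b - G s)] and [(F t - F a) * g t]
   have the same integral over [a, b]. *)
Lemma primM F f G g : prim F f -> prim G g ->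
  prim (F * G) (G * f + F * g).
Proof.
move=> Ff Gg; have fi := prim_loci Ff; have gi := prim_loci Gg.
have Gfi := prim_lociM Gg fi; have Fgi := prim_lociM Ff gi.
split; first exact: lociD.
move=> a b ab.
have := fubini_triangle (loci_patch a b fi) (loci_patch a b gi).
set L := Int _; set Q := Int _.
have -> : L = G b * (F b - F a) - II a b (G * f).
  rewrite /L Ff.2// -IIZ// -[X in _ = X](_ : II a b (G b *: f + (- 1) *: (G * f)) = _); last first.
    by rewrite IID ?IIZ// ?mulN1r//; exact: lociZ.
  rewrite /Int /II [RHS]Rintegral_mkcond; apply: eq_Rintegral => s _.
  rewrite !patchE; case: ifPn => [|_]; last by rewrite mul0r.
  rewrite mem_setE in_itv /= => /andP[as_ sb].
  rewrite (_ : \int[mu]_(t in _) _ = G b - G s).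
    by change (f s * (G b - G s) = G b * f s + (- 1) * (G s * f s)); ring.
  rewrite -Rintegral_mkcondr Gg.2// /II; congr Rintegral.
  apply/seteqP; split => t /=; rewrite !in_itv /= ?andbT.
    by move=> [st /andP[_ tb]]; rewrite st tb.
  by move=> /andP[st tb]; rewrite st tb (le_trans as_).
have -> : Q = II a b (F * g) - F a * (G b - G a).
  rewrite /Q Gg.2// -IIZ// -[X in _ = X](_ : II a b (F * g + (- 1) *: (F a *: g)) = _); last first.
    rewrite IID//; last by apply: lociZ; exact: lociZ.
    by rewrite (IIZ (-1)) ?mulN1r//; exact: lociZ.
  rewrite /Int /II [RHS]Rintegral_mkcond; apply: eq_Rintegral => t _.
  rewrite !patchE; case: ifPn => [|_]; last by rewrite mulr0.
  rewrite mem_setE in_itv /= => /andP[at_ tb].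
  rewrite (_ : \int[mu]_(s in _) _ = F t - F a).
    by change ((F t - F a) * g t = F t * g t + (- 1) * (F a * g t)); ring.
  rewrite -Rintegral_mkcondr Ff.2// /II; congr Rintegral.
  apply/seteqP; split => s /=; rewrite !in_itv /= ?andbT.
    by move=> [st /andP[-> _]]; rewrite st.
  by move=> /andP[-> st]; rewrite st (le_trans st).
rewrite IID//.
change (G b * (F b - F a) - II a b (G * f) = II a b (F * g) - F a * (G b - G a) -> F b * G b - F a * G a = II a b (G * f) + II a b (F * g)).
lra.
Qed.

Lemma II_sh h x y f : loci f -> II x y (sh h f) = II (x + h) (y + h) f.
Proof.
move=> fi; rewrite /II Rintegral_mkcond [RHS]Rintegral_mkcond -/(Int _) -/(Int _).
rewrite -(Int_sh h (loci_patch _ _ fi)); congr Int; apply/funext => t.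
by rewrite /sh !patchE !mem_setE !in_itv /= !lerD2r.
Qed.

(* Fubini for [f (x + s)] on the strip [0 <= s <= h]. *)
Lemma itg_Int_average f h : itg f -> 0 <= h ->
  itg (fun x => II x (x + h) f) /\ Int (fun x => II x (x + h) f) = h * Int f.
Proof.
move=> fi h0; have mf_ := itg_mf fi; have li := itg_loci fi.
pose T := measurableTypeR R.
pose k (z : T * T) : R := if (0 <= (z.2 : R)) && ((z.2 : R) <= h) then f (z.1 + z.2) else 0.
have mk : measurable_fun setT k.
  apply: measurable_fun_ifT => //=.
  - by apply: measurable_and; apply: measurable_fun_ler.
  - apply: measurableT_comp => //; exact: measurable_funD.
have mEk : measurable_fun setT (EFin \o k) by exact/measurable_EFinP.
have kE x : (fun y : T => k (x, y)) = (sh x f) \_ `[0, h].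
  apply/funext => y; rewrite patchE mem_setE in_itv /= /k /sh /= addrC.
  by [].
have kE2 (y : R) : (fun x : T => k (x, y)) = (if y \in `[0, h] then sh y f else 0).
  by apply/funext => x; rewrite in_itv /= /k /sh /=; case: ifP.
have ki : (mu \x mu)%E.-integrable setT (EFin \o k).
  apply/(@integrable21ltyP _ _ _ _ R mu mu _ mEk).
  rewrite (eq_integral (fun y : T => (((fun=> Int (fun x => `|f x|)) \_ `[0, h]) y)%:E)).
    rewrite EFin_Int ?ltry//.
    exact: loci_patch (loci_cst _).
  move=> y _; rewrite /= patchE mem_setE.
  transitivity (\int[mu]_x (`|(if y \in `[0, h] then sh y f else 0) x|)%:E)%E.
    by apply: eq_integral => x _; rewrite -kE2.
  case: ifP => _; last by under eq_integral do rewrite normr0; rewrite integral0.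
  rewrite EFin_Int; last exact: (integrable_norm (itg_sh y fi)).
  by congr EFin; rewrite -(Int_sh y (integrable_norm fi)).
have FE x : fubini_F mu (EFin \o k) x = (II x (x + h) f)%:E.
  rewrite /fubini_F /= (eq_integral (fun y : T => (((sh x f) \_ `[0, h]) y)%:E)); last first.
    by move=> y _; rewrite -kE.
  rewrite EFin_Int; last by apply: loci_patch; apply: itg_loci; exact: itg_sh.
  by rewrite /Int -Rintegral_mkcond -/(II _ _ _) II_sh// add0r addrC.
have Fi : itg (fun x => II x (x + h) f).
  have := integrable_fubini_F ki; rewrite /itg; congr (is_true (integrable _ _ _)).
  by apply/funext => x; exact: FE.
split=> //; apply: EFin_inj; rewrite -EFin_Int//.
transitivity (\int[mu]_x \int[mu]_y (EFin \o k) (x, y))%E.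
  by apply: eq_integral => x _; rewrite -FE.
rewrite (Fubini ki) /=.
rewrite (eq_integral (fun y : T => (((fun=> Int f) \_ `[0, h]) y)%:E)).
  rewrite EFin_Int; last exact: loci_patch (loci_cst _).
  by rewrite /Int -Rintegral_mkcond -/(Int _) -/(II _ _ _) II_cst// subr0 mulrC.
move=> y _; rewrite patchE mem_setE.
transitivity (\int[mu]_x ((if y \in `[0, h] then sh y f else 0) x)%:E)%E.
  by apply: eq_integral => x _; rewrite -kE2.
case: ifP => _; last by rewrite integral0.
by rewrite EFin_Int; [congr EFin; exact: Int_sh|exact: itg_sh].
Qed.

(** The integral of [f] over [[x, x + 1]] is [F (x + 1) - F x]. Integrated in [x] it gives [Int f]
    by Fubini and 0 by translation invariance, which avoids any discussion of the limits of [F] at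
    infinity. *)
Lemma Int_prim0 F f : prim F f -> itg F -> itg f -> Int f = 0.
Proof.
move=> [_ Ff] Fi fi; have [_] := itg_Int_average fi ler01.
rewrite mul1r => <-.
rewrite (_ : (fun x => _) = sh 1 F - F); last first.
  by apply/funext => x; rewrite -Ff// lerDl.
by rewrite IntB ?Int_sh ?subrr//; exact: itg_sh.
Qed.

(** Cauchy-Schwarz against the constant 1: the nonnegative polynomial in [s] is the integral of
    [(f - s)^2]. *)
Lemma II_sqr x y f : x <= y -> l2 f ->
  (II x y f) ^+ 2 <= (y - x) * II x y (fun t => f t ^+ 2).
Proof.
move=> xy fi; have li := l2_loci fi; have [mf_ f2] := fi.
rewrite mulrC.
apply: discriminant_le; [by apply: II_ge0 => t; exact: sqr_ge0|by rewrite subr_ge0|].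
move=> s.
have c1 := loci_cst 1.
have sfi := lociZ (2 * s) li; have si := lociZ (s ^+ 2) c1.
have f2i := itg_loci f2.
have : 0 <= II x y ((fun t => f t ^+ 2) + ((- (2 * s)) *: f + s ^+ 2 *: (fun=> 1))).
  apply: II_ge0 => t.
  change (0 <= f t ^+ 2 + (- (2 * s) * f t + s ^+ 2 * 1)).
  by have := sqr_ge0 (f t - s); congr (_ <= _); ring.
have nsfi := lociZ (- (2 * s)) li.
rewrite !IID ?IIZ ?II_cst//; last exact: lociD.
by congr (_ <= _); ring.
Qed.

End Prim.

(** * Difference quotients in L2 *)

Section DiffQuot.
Context {R : realType}.
Notation mu := (@lebesgue_measure R).
Implicit Types (f g F G : R -> R) (a b c h x y M : R).

Lemma loci_locally_integrable f : loci f -> locally_integrable setT f.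
Proof.
move=> [mf_ fi]; split; [exact: mf_|exact: openT|move=> K _ cK].
have [M [_ KM]] := compact_bounded cK.
pose N := `|M| + 1.
have KN : K `<=` `[- N, N]%classic.
  move=> x Kx; rewrite /= in_itv /= -ler_norml; apply: KM => //.
  by rewrite /N (le_lt_trans (ler_norm M))// ltrDl.
have mK : measurable K by exact: compact_measurable.
have : mu.-integrable K (EFin \o f) by apply: integrableS (fi (- N) N).
by move=> /integrableP[].
Qed.

(** Lebesgue differentiation for the primitive based at [x - 1], which differs from [F] by a
    constant near [x]. *)
Lemma prim_derive_ae F f : prim F f ->
  {ae mu, forall x, h^-1 * (F (x + h) - F x) @[h --> 0^'] --> f x}.
Proof.
move=> [fi Ff]; have := lebesgue_differentiation (loci_locally_integrable fi).
apply: ae_mono => x fx.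
have x1 : x < x + 1 by rewrite ltrDl.
have ax : (BLeft (x - 1)%R < BRight x :> \bar R)%E by rewrite /= lte_fin; lra.
have [dG] := FTC1_lebesgue_pt x1 (fi.2 (x - 1) (x + 1)) ax fx.
set G := (fun y => _) in dG *; rewrite derive1E => Gf.
have : (fun h => h^-1 *: ((G \o shift x) (h *: 1) - G x)) @ 0^' --> 'D_1 G x := dG.
rewrite Gf; apply: cvg_trans; apply: near_eq_cvg.
exists 1 => //= h /=; rewrite sub0r normrN ltr_norml => /andP[h1 _] h0.
have GE y : x - 1 <= y -> G y = F y - F (x - 1) by move=> xy; rewrite Ff.
rewrite [h%:A]mulr1 (addrC h) !GE; [|lra|lra].
by rewrite -[RHS]/(h^-1 * _); congr (_ * _); ring.
Qed.

Definition dq h F : R -> R := h^-1 *: (sh h F - F).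

Definition hs (n : nat) : R := n.+1%:R^-1.

Lemma hs_gt0 n : 0 < hs n.
Proof. by rewrite invr_gt0. Qed.

Lemma hs_cvg : hs n @[n --> \oo] --> (0 : R).
Proof. exact: cvg_harmonic. Qed.

Lemma dq_cvg_ae F f (e : nat -> R) : prim F f -> (forall n, e n != 0) ->
  e n @[n --> \oo] --> (0 : R) ->
  {ae mu, forall x, dq (e n) F x @[n --> \oo] --> f x}.
Proof.
move=> /prim_derive_ae + e0 ec; apply: ae_mono => x /cvgr_dnbhsP; exact.
Qed.

Lemma ip_sqr f : ip f f = Int (fun x => f x ^+ 2).
Proof. by congr Int; apply/funext => x; rewrite expr2. Qed.

(* By Fatou's lemma applied to [(G n + g) ^ 2] and the parallelogram law. *)
Lemma l2_cvg_ae (G : nat -> R -> R) g : (forall n, l2 (G n)) -> l2 g ->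
  (forall n, nrm (G n) <= nrm g) ->
  {ae mu, forall x, G n x @[n --> \oo] --> g x} ->
  nrm (G n - g) @[n --> \oo] --> (0 : R).
Proof.
move=> Gi gi Gg Gc.
have Gpg n := l2D (Gi n) gi; have Gmg n := l2B (Gi n) gi.
have par n : nrm (G n - g) ^+ 2 <= 4 * nrm g ^+ 2 - nrm (G n + g) ^+ 2.
  have : nrm (G n) ^+ 2 <= nrm g ^+ 2 by rewrite lerXn2r ?nnegrE ?nrm_ge0.
  rewrite !nrm_sq ipBl// !ipBr// ipDl// !ipDr// (ipC g); lra.
pose P n x := (((G n + g) x) ^+ 2)%:E.
have mP n : measurable_fun setT (P n).
  by apply/measurable_EFinP; apply: mfX; exact: l2_mf.
have P0 n x : setT x -> (0 <= P n x)%E by move=> _; rewrite lee_fin sqr_ge0.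
have := fatou mu measurableT mP P0.
have -> : (\int[mu]_x limn_einf (P^~ x) = (4 * nrm g ^+ 2)%:E)%E.
  have g2 := itgZ 4 gi.2.
  rewrite nrm_sq /ip -IntZ; last exact: l2M.
  rewrite -EFin_Int; last by apply: itgZ; exact: l2M.
  apply: ae_eq_integral => //.
  - rewrite (_ : (fun x => _) = fun x => (- limn_esup (fun n => - P n x))%E).
      apply: measurableT_comp => //; apply: measurable_fun_limn_esup => n.
      change (measurable_fun setT (EFin \o (- (fun x => (G n + g) x ^+ 2)))).
      by apply/measurable_EFinP; apply: mfN; apply: mfX; exact: l2_mf.
    by apply/funext => x; rewrite (limn_esupN (P^~ x)) oppeK.
  - by apply/measurable_EFinP; apply: mfZ; apply: mfM; exact: l2_mf.
  - apply: ae_mono Gc => x Gx _.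
    have Pc : P^~ x @ \oo --> (4 * (g x * g x))%:E.
      rewrite /P; apply: cvg_EFin; first exact: nearW.
      rewrite (_ : 4 * (g x * g x) = (g x + g x) * (g x + g x)); last by ring.
      have h : (G n x + g x) @[n --> \oo] --> g x + g x.
        by apply: cvgD => //; exact: cvg_cst.
      exact: (cvgM h h).
    rewrite is_cvg_limn_einfE; last by apply/cvg_ex; eexists; exact: Pc.
    exact: cvg_lim Pc.
rewrite limn_einf_lim.
have /cvg_lim -> // := @cvg_einfs_sup R (fun n => \int[mu]_x P n x)%E.
(* [le4] says that [4 |g|^2] is at most the lower limit of [|G n + g|^2]; with [par] this forces
   [|G n - g|] to 0. *)
move=> le4.
apply/cvgr0Pnorm_le => e e0.
have e20 : 0 < e ^+ 2 by rewrite exprn_gt0.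
have : ((4 * nrm g ^+ 2 - e ^+ 2)%:E < ereal_sup (range (einfs (fun n => \int[mu]_x P n x))))%E.
  by apply: lt_le_trans le4; rewrite lte_fin; lra.
move=> /ereal_sup_gt[_ [m _ <-]] lem; exists m => // n /= mn.
rewrite ger0_norm ?nrm_ge0// -(@ler_pXn2r _ 2)// ?nnegrE ?nrm_ge0 ?(ltW e0)//.
rewrite (le_trans (par n))// lerBlDr -lerBlDl.
have : ((4 * nrm g ^+ 2 - e ^+ 2)%:E < \int[mu]_x P n x)%E.
  by apply: (lt_le_trans lem); apply: ereal_inf_lbound; exists n.
rewrite EFin_Int; last exact: (Gpg n).2.
by rewrite lte_fin (nrm_sq (G n + g)) ip_sqr => /ltW.
Qed.

Definition Hs F f := [/\ prim F f, l2 F & l2 f].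

Lemma HsD F f G g : Hs F f -> Hs G g -> Hs (F + G) (f + g).
Proof. by case=> ? ? ? [] ? ? ?; split; [exact: primD|exact: l2D|exact: l2D]. Qed.
Lemma HsZ c F f : Hs F f -> Hs (c *: F) (c *: f).
Proof. by case=> ? ? ?; split; [exact: primZ|exact: l2Z|exact: l2Z]. Qed.
Lemma HsN F f : Hs F f -> Hs (- F) (- f).
Proof. by case=> ? ? ?; split; [exact: primN|exact: l2N|exact: l2N]. Qed.
Lemma HsB F f G g : Hs F f -> Hs G g -> Hs (F - G) (f - g).
Proof. by case=> ? ? ? [] ? ? ?; split; [exact: primB|exact: l2B|exact: l2B]. Qed.

Lemma prim_sh h F f : prim F f -> prim (sh h F) (sh h f).
Proof.
move=> [[mf_ fi] Ff]; split.
  split; first exact: mf_sh.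
  move=> x y; apply: (iffRL (itg_patch _ _)) => //.
  rewrite (_ : _ \_ _ = sh h (f \_ `[x + h, y + h])).
    by apply: itg_sh; apply: loci_patch.
  by apply/funext => t; rewrite /sh !patchE !mem_setE !in_itv /= !lerD2r.
by move=> x y xy; rewrite II_sh// -Ff// lerD2r.
Qed.
Lemma Hs_sh h F f : Hs F f -> Hs (sh h F) (sh h f).
Proof. by case=> ? ? ?; split; [exact: prim_sh|exact: l2_sh|exact: l2_sh]. Qed.

Lemma HsM c c' p q F f : prim p q -> mf q -> (forall x, `|p x| <= c) ->
  (forall x, `|q x| <= c') -> Hs F f -> Hs (p * F) (F * q + p * f).
Proof.
move=> pq mq pc qc [Ff Fi fi]; split; first exact: primM.
- exact: (l2Mb (prim_mf pq) pc).
- by apply: l2D; [rewrite mulrC; exact: (l2Mb mq qc)|exact: (l2Mb (prim_mf pq) pc)].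
Qed.

Lemma Hs_dq h F f : Hs F f -> Hs (dq h F) (dq h f).
Proof. by move=> Ff; apply: HsZ; apply: HsB => //; exact: Hs_sh. Qed.

Lemma l2_dq h F : l2 F -> l2 (dq h F).
Proof. by move=> Fi; apply: l2Z; apply: l2B => //; exact: l2_sh. Qed.

Lemma dqB h F G : dq h (F - G) = dq h F - dq h G.
Proof.
apply/funext => x.
change (h^-1 * ((F (x + h) - G (x + h)) - (F x - G x)) =
  h^-1 * (F (x + h) - F x) - h^-1 * (G (x + h) - G x)).
by ring.
Qed.

(** By Cauchy-Schwarz, [(F (x + h) - F x)^2] is at most [h] times the integral of [f^2] over
    [[x, x + h]]; integrating in [x] produces a second factor [h]. *)
Lemma nrm_dq_pos h F f : 0 < h -> Hs F f -> nrm (dq h F) <= nrm f.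
Proof.
move=> h0 [Ff Fi fi]; have [mf_ f2] := fi.
rewrite -(@ler_pXn2r _ 2)// ?nnegrE ?nrm_ge0// !nrm_sq.
have [Ai AE] := itg_Int_average f2 (ltW h0).
have -> : ip f f = Int (h^-1 *: (fun x => II x (x + h) (fun t => f t ^+ 2))).
  by rewrite IntZ// AE mulrA mulVf ?mul1r ?gt_eqF// ip_sqr.
have Di := l2_dq h Fi.
apply: le_Int; [exact: l2M|exact: itgZ|move=> x].
have xh : x <= x + h by rewrite lerDl ltW.
have := II_sqr xh fi; rewrite -Ff.2// addrAC subrr add0r.
set A := II _ _ _ => le1.
change (h^-1 * (F (x + h) - F x) * (h^-1 * (F (x + h) - F x)) <= h^-1 * A).
rewrite (_ : _ * _ = h^-1 ^+ 2 * (F (x + h) - F x) ^+ 2); last by ring.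
rewrite (_ : h^-1 * A = h^-1 ^+ 2 * (h * A)); last by field; rewrite gt_eqF.
by rewrite ler_wpM2l// sqr_ge0.
Qed.

Lemma dqN h F : dq (- h) F = sh (- h) (dq h F).
Proof.
apply/funext => x.
change ((- h)^-1 * (F (x - h) - F x) = h^-1 * (F (x - h + h) - F (x - h))).
by rewrite subrK invrN; ring.
Qed.

Lemma nrm_dq h F f : h != 0 -> Hs F f -> nrm (dq h F) <= nrm f.
Proof.
rewrite neq_lt => /orP[h0|h0] Ff; last exact: nrm_dq_pos.
have [_ Fi _] := Ff.
rewrite -[h]opprK dqN nrm_sh; last exact: l2_dq.
by apply: nrm_dq_pos => //; rewrite oppr_gt0.
Qed.

(** The quotients converge almost everywhere and their norms never exceed that of the limit, so the
    convergence is strong. *)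
Lemma dq_cvg F f (e : nat -> R) : Hs F f -> (forall n, e n != 0) ->
  e n @[n --> \oo] --> (0 : R) ->
  nrm (dq (e n) F - f) @[n --> \oo] --> (0 : R).
Proof.
move=> Ff e0 ec; have [pF Fi fi] := Ff; apply: l2_cvg_ae => //.
- by move=> n; exact: l2_dq.
- by move=> n; exact: nrm_dq.
- exact: dq_cvg_ae.
Qed.

(** Discrete integration by parts: translations preserve the inner product, so the adjoint of the
    forward quotient is minus the backward one. *)
Lemma ip_dqN h F G : l2 F -> l2 G -> ip (dq (- h) F) G = - ip F (dq h G).
Proof.
move=> Fi Gi; rewrite /dq.
have s1 := l2_sh (- h) Fi; have s2 := l2_sh h Gi.
have b1 := l2B s1 Fi; have b2 := l2B s2 Gi.
rewrite ipZl// ipZr// ipBl// ipBr//.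
rewrite -(ip_sh h s1 Gi) (_ : sh h (sh (- h) F) = F).
  by rewrite invrN; ring.
by apply/funext => x; rewrite /sh addrK.
Qed.

(** [F^2] vanishes at 0 and has derivative [2 F f], whose integral Cauchy-Schwarz bounds. *)
Lemma sup_bound F f x : Hs F f -> F 0 = 0 -> F x ^+ 2 <= 2 * (nrm F * nrm f).
Proof.
move=> [Ff Fi fi] F0.
have p2 := primM Ff Ff.
have Ffi := l2M Fi fi.
have ai : itg (fun x => 2 * `|F x * f x|) by apply: (itgZ 2); exact: (integrable_norm Ffi).
have key y z : y <= z -> `|II y z (F * f + F * f)| <= 2 * Int (fun x => `|F x * f x|).
  move=> yz; rewrite -IntZ; last exact: (integrable_norm Ffi).
  rewrite /II Rintegral_mkcond; apply: le_abs_Int => //.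
    by apply: loci_patch; apply: lociD; apply: itg_loci.
  move=> t; rewrite patchE; case: ifP => _; last by rewrite normr0 mulr_ge0.
  change (`|F t * f t + F t * f t| <= 2 * `|F t * f t|).
  by rewrite -mulr2n normrMn mulr_natl.
have cs : Int (fun x => `|F x * f x|) <= nrm F * nrm f.
  have aF : l2 (fun x => `|F x|).
    by apply: (l2_le _ _ Fi) => [|y]; [apply: mf_abs; exact: l2_mf|rewrite normr_id].
  have af : l2 (fun x => `|f x|).
    by apply: (l2_le _ _ fi) => [|y]; [apply: mf_abs; exact: l2_mf|rewrite normr_id].
  rewrite (_ : Int _ = ip (fun x => `|F x|) (fun x => `|f x|)); last first.
    by congr Int; apply/funext => y; rewrite normrM.
  apply: (le_trans (ler_norm _)); apply: (le_trans (cauchy_schwarz aF af)).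
  by apply: ler_pM; rewrite ?nrm_ge0//; apply: nrm_le => // y; rewrite normr_id.
have E : F x ^+ 2 = (F * F) x by rewrite expr2.
have F00 : (F * F) 0 = 0 by rewrite -[LHS]/(F 0 * F 0) F0 mul0r.
apply: (@le_trans _ _ (2 * Int (fun x => `|F x * f x|))); last by rewrite ler_pM2l.
apply: le_trans (ler_norm _) _; rewrite E (prim_ext x p2) F00 add0r.
by case: ifPn => [x0|]; [exact: key|rewrite -ltNge normrN => /ltW; exact: key].
Qed.

End DiffQuot.

(** * Continuous families of functions *)

Section Families.
Context {R : realType}.
Notation mu := (@lebesgue_measure R).
Implicit Types (f g F G p q : R -> R) (a b c h x y M s t : R).
Implicit Types (U V P Q : R -> R -> R) (e : R -> R).

Definition to0 t e := e s @[s --> t] --> (0 : R).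

Lemma to0_le t e e' : (forall s, 0 <= e s <= e' s) -> to0 t e' -> to0 t e.
Proof.
move=> ee' e'0; apply: (squeeze_cvgr _ _ e'0); last exact: cvg_cst.
by apply: nearW => s; exact: ee'.
Qed.
Lemma to0D t e e' : to0 t e -> to0 t e' -> to0 t (fun s => e s + e' s).
Proof. by move=> h h'; rewrite /to0 -[X in _ --> X]addr0; exact: cvgD. Qed.
Lemma to0M t e e' : to0 t e -> to0 t e' -> to0 t (fun s => e s * e' s).
Proof. by move=> h h'; rewrite /to0 -[X in _ --> X](mulr0 0); exact: cvgM. Qed.
Lemma to0Z t c e : to0 t e -> to0 t (fun s => c * e s).
Proof. by move=> h; rewrite /to0 -[X in _ --> X](mulr0 c); apply: cvgM => //; exact: cvg_cst. Qed.

(* Continuity in [t] is for the L^2 norm in [l2c] and for the H^1 norm in [H0c]. *)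
Definition l2c P := (forall t, l2 (P t)) /\ forall t, to0 t (fun s => nrm (P s - P t)).
Definition H0c U P := [/\ forall t, Hs (U t) (P t), forall t, U t 0 = 0, l2c U & l2c P].

Lemma l2cD P Q : l2c P -> l2c Q -> l2c (fun t => P t + Q t).
Proof.
move=> [Pi Pc] [Qi Qc]; split; first by move=> t; exact: l2D.
move=> t; apply: to0_le (to0D (Pc t) (Qc t)) => s.
rewrite nrm_ge0 /= (_ : _ - _ = (P s - P t) + (Q s - Q t)).
  by apply: nrmD; exact: l2B.
by rewrite opprD addrACA.
Qed.
Lemma l2cZ c P : l2c P -> l2c (fun t => c *: P t).
Proof.
move=> [Pi Pc]; split; first by move=> t; exact: l2Z.
move=> t; apply: to0_le (to0Z `|c| (Pc t)) => s.
by rewrite nrm_ge0 /= -scalerBr nrmZ//; exact: l2B.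
Qed.
Lemma l2cMb c p P : mf p -> (forall x, `|p x| <= c) -> l2c P ->
  l2c (fun t => p * P t).
Proof.
move=> mp pc [Pi Pc]; split; first by move=> t; exact: (l2Mb mp pc).
move=> t; apply: to0_le (to0Z c (Pc t)) => s.
rewrite nrm_ge0 /= -mulrBr nrmMb//; last exact: l2B.
exact: le_trans (normr_ge0 _) (pc 0).
Qed.

Lemma sup_norm_le F f x : Hs F f -> F 0 = 0 -> `|F x| <= nrm F + nrm f.
Proof.
move=> Ff F0; have Fb := sup_bound x Ff F0.
rewrite -(@ler_pXn2r _ 2)// ?nnegrE ?addr_ge0 ?nrm_ge0// real_normK ?num_real//.
by have := sqr_ge0 (nrm F); have := sqr_ge0 (nrm f); nra.
Qed.

Lemma H0c_sup U P s t x : H0c U P ->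
  `|U s x - U t x| <= nrm (U s - U t) + nrm (P s - P t).
Proof.
move=> [UP U0 _ _].
by apply: (sup_norm_le x (HsB (UP s) (UP t))); rewrite -[LHS]/(U s 0 - U t 0) !U0 subrr.
Qed.

Lemma l2M_H0 F f g : Hs F f -> F 0 = 0 -> l2 g -> l2 (F * g).
Proof.
move=> Ff F0 gi; have [pF _ _] := Ff.
by apply: (l2Mb (prim_mf pF) (fun x => sup_norm_le x Ff F0)).
Qed.

Lemma nrmM_H0 F f g : Hs F f -> F 0 = 0 -> l2 g ->
  nrm (F * g) <= (nrm F + nrm f) * nrm g.
Proof.
move=> Ff F0 gi; have [pF _ _] := Ff.
apply: nrmMb => //; [exact: prim_mf pF|by rewrite addr_ge0// nrm_ge0|].
by move=> x; exact: sup_norm_le.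
Qed.

(** The H^1 norm controls the sup norm, so each term of [dU Q + dU dQ + U dQ] is small in L^2. *)
Lemma l2cM U P Q : H0c U P -> l2c Q -> l2c (fun t => U t * Q t).
Proof.
move=> [UP U0 [Ui Uc] [Pi Pc]] [Qi Qc]; split.
  by move=> t; exact: (l2M_H0 (UP t)).
move=> t.
pose e s := nrm (U s - U t) + nrm (P s - P t).
have e0 : to0 t e by exact: to0D.
apply: to0_le (to0D (to0D (to0Z (nrm (Q t)) e0) (to0M e0 (Qc t)))
  (to0Z (nrm (U t) + nrm (P t)) (Qc t))) => s.
rewrite nrm_ge0 /=.
have dQ := l2B (Qi s) (Qi t).
have dU := HsB (UP s) (UP t).
have dU0 : (U s - U t) 0 = 0 by rewrite -[LHS]/(U s 0 - U t 0) !U0 subrr.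
rewrite (_ : _ - _ = ((U s - U t) * Q t + (U s - U t) * (Q s - Q t)) + U t * (Q s - Q t)).
  have i1 := l2M_H0 dU dU0 (Qi t).
  have i2 := l2M_H0 dU dU0 dQ.
  have i3 := l2M_H0 (UP t) (U0 t) dQ.
  apply: le_trans (nrmD (l2D i1 i2) i3) _; apply: lerD.
    apply: le_trans (nrmD i1 i2) _; apply: lerD.
      by rewrite [leRHS]mulrC; exact: nrmM_H0.
    exact: nrmM_H0.
  exact: nrmM_H0.
by rewrite !mulrBr !mulrBl; apply/funext => x; rewrite !fctE; ring.
Qed.

Lemma H0cD U P V Q : H0c U P -> H0c V Q ->
  H0c (fun t => U t + V t) (fun t => P t + Q t).
Proof.
move=> [UP U0 Uc Pc] [VQ V0 Vc Qc]; split; [|..|exact: l2cD|exact: l2cD].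
- by move=> t; exact: HsD.
- by move=> t; rewrite -[LHS]/(U t 0 + V t 0) U0 V0 addr0.
Qed.
Lemma H0cZ c U P : H0c U P -> H0c (fun t => c *: U t) (fun t => c *: P t).
Proof.
move=> [UP U0 Uc Pc]; split; [|..|exact: l2cZ|exact: l2cZ].
- by move=> t; exact: HsZ.
- by move=> t; rewrite -[LHS]/(c * U t 0) U0 mulr0.
Qed.
Lemma H0cM U P V Q : H0c U P -> H0c V Q ->
  H0c (fun t => U t * V t) (fun t => V t * P t + U t * Q t).
Proof.
move=> UPc VQc; have [UP U0 Uc Pc] := UPc; have [VQ V0 Vc Qc] := VQc.
have dc := l2cD (l2cM VQc Pc) (l2cM UPc Qc).
have uc := l2cM UPc Vc.
split=> //.
- move=> t; split; [|exact: uc.1|exact: dc.1].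
  by have [pU _ _] := UP t; have [pV _ _] := VQ t; exact: primM.
- by move=> t; rewrite -[LHS]/(U t 0 * V t 0) U0 mul0r.
Qed.
Lemma H0cMb c c' p q U P : prim p q -> mf q -> (forall x, `|p x| <= c) ->
  (forall x, `|q x| <= c') -> H0c U P ->
  H0c (fun t => p * U t) (fun t => q * U t + p * P t).
Proof.
move=> pq mq pc qc [UP U0 Uc Pc]; split.
- by move=> t; rewrite (mulrC q); exact: (HsM pq mq pc qc).
- by move=> t; rewrite -[LHS]/(p 0 * U t 0) U0 mulr0.
- exact: (l2cMb (prim_mf pq) pc).
- by apply: l2cD; [exact: (l2cMb mq qc)|exact: (l2cMb (prim_mf pq) pc)].
Qed.

(* [A n s] is L^2-continuous in [s] at [t], uniformly in [n], and [A n t]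
   converges to [A0] in L^2. *)
Definition ucv t (A : nat -> R -> R -> R) A0 := [/\ forall n s, l2 (A n s), l2 A0,
  exists2 e, to0 t e & forall n s, nrm (A n s - A n t) <= e s &
  nrm (A n t - A0) @[n --> \oo] --> (0 : R)].

Lemma ucv_const t P : l2c P -> ucv t (fun=> P) (P t).
Proof.
move=> [Pi Pc]; split=> //; first by exists (fun s => nrm (P s - P t)).
rewrite subrr (_ : nrm 0 = 0); first exact: cvg_cst.
by rewrite /nrm /ip mulr0 Int0 sqrtr0.
Qed.

(** A difference quotient of [U s - U t] is bounded by [nrm (P s - P t)] whatever its step; this is
    the origin of the uniformity in [n]. *)
Lemma ucv_dq t (k : nat -> R) U P : (forall n, k n != 0) ->
  k n @[n --> \oo] --> (0 : R) -> H0c U P ->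
  ucv t (fun n s => dq (k n) (U s)) (P t).
Proof.
move=> k0 kc [UP U0 Uc Pc]; split.
- by move=> n s; apply: l2_dq; exact: Uc.1.
- exact: Pc.1.
- exists (fun s => nrm (P s - P t)); first exact: Pc.2.
  by move=> n s; rewrite -dqB; apply: nrm_dq => //; exact: HsB.
- exact: dq_cvg.
Qed.

Lemma ucvD t A A0 B B0 : ucv t A A0 -> ucv t B B0 ->
  ucv t (fun n s => A n s + B n s) (A0 + B0).
Proof.
move=> [Ai A0i [eA eA0 Ae] Ac] [Bi B0i [eB eB0 Be] Bc].
have E (f1 f2 g1 g2 : R -> R) : f1 + g1 - (f2 + g2) = (f1 - f2) + (g1 - g2).
  by rewrite opprD addrACA.
split; [by move=> n s; exact: l2D|exact: l2D|..].
- exists (fun s => eA s + eB s); first exact: to0D.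
  move=> n s; rewrite E; apply: le_trans (lerD (Ae n s) (Be n s)).
  by apply: nrmD; exact: l2B.
- apply: (@squeeze_cvgr _ _ _ _ (fun=> 0) (fun n => nrm (A n t - A0) + nrm (B n t - B0))).
  + by apply: nearW => n; rewrite nrm_ge0 /= E; apply: nrmD; exact: l2B.
  + exact: cvg_cst.
  + by rewrite -[X in _ --> X]addr0; exact: cvgD.
Qed.

Lemma ucvMb t c p A A0 : mf p -> (forall x, `|p x| <= c) -> ucv t A A0 ->
  ucv t (fun n s => p * A n s) (p * A0).
Proof.
move=> mp pc [Ai A0i [e e0 Ae] Ac].
have c0 : 0 <= c by exact: le_trans (normr_ge0 _) (pc 0).
split; [by move=> n s; exact: (l2Mb mp pc)|exact: (l2Mb mp pc)|..].
- exists (fun s => c * e s); first exact: to0Z.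
  move=> n s; rewrite -mulrBr.
  apply: le_trans (nrmMb mp c0 pc (l2B (Ai n s) (Ai n t))) _.
  by rewrite ler_wpM2l.
- apply: (@squeeze_cvgr _ _ _ _ (fun=> 0) (fun n => c * nrm (A n t - A0))).
  + by apply: nearW => n; rewrite nrm_ge0 /= -mulrBr; apply: nrmMb => //; exact: l2B.
  + exact: cvg_cst.
  + by rewrite -[X in _ --> X](mulr0 c); apply: cvgM => //; exact: cvg_cst.
Qed.

Lemma cvg_dist_le (u b : nat -> R) l : (forall n, `|u n - l| <= b n) ->
  b n @[n --> \oo] --> (0 : R) -> u n @[n --> \oo] --> l.
Proof.
move=> ub /cvgr0Pnorm_le bc; apply/cvgrPdist_le => e e0.
have [m _ h] := bc e e0; exists m => // n /= mn.
by rewrite distrC (le_trans (ub n))// (le_trans (ler_norm _))// h.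
Qed.

(** The scalar analogue of [ucv], meant for the time derivatives of approximating functionals: the
    modulus of continuity at [t] is common to all [n]. *)
Definition icv t (g : nat -> R -> R) c :=
  (exists2 e, to0 t e & forall n s, `|g n s - g n t| <= e s) /\
  g n t @[n --> \oo] --> c.

Lemma icvD t (g1 : nat -> R -> R) c1 (g2 : nat -> R -> R) c2 : icv t g1 c1 -> icv t g2 c2 ->
  icv t (fun n s => g1 n s + g2 n s) (c1 + c2).
Proof.
move=> [[e1 e10 h1] k1] [[e2 e20 h2] k2]; split; last exact: cvgD.
exists (fun s => e1 s + e2 s); first exact: to0D.
move=> n s; apply: le_trans (lerD (h1 n s) (h2 n s)).
rewrite (_ : _ - _ = (g1 n s - g1 n t) + (g2 n s - g2 n t)); last by ring.
exact: ler_normD.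
Qed.
Lemma icvN t (g : nat -> R -> R) c : icv t g c -> icv t (fun n s => - g n s) (- c).
Proof.
move=> [[e e0 h] k]; split; last exact: cvgN.
by exists e => // n s; rewrite -opprD normrN.
Qed.

Lemma ip_bound_cvg f g f' g' : l2 f -> l2 g -> l2 f' -> l2 g' ->
  `|ip f' g' - ip f g| <=
  nrm (f' - f) * nrm g + nrm f * nrm (g' - g) + nrm (f' - f) * nrm (g' - g).
Proof.
move=> fi gi fi' gi'; have df := l2B fi' fi; have dg := l2B gi' gi.
rewrite (_ : _ - _ = ip (f' - f) g + ip f (g' - g) + ip (f' - f) (g' - g)).
  apply: le_trans (ler_normD _ _) _; apply: lerD; last exact: cauchy_schwarz.
  by apply: le_trans (ler_normD _ _) _; apply: lerD; exact: cauchy_schwarz.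
by rewrite !ipBl// !ipBr//; ring.
Qed.

Lemma icv_ip t A A0 B B0 : ucv t A A0 -> ucv t B B0 ->
  icv t (fun n s => ip (A n s) (B n s)) (ip A0 B0).
Proof.
move=> [Ai A0i [eA eA0 Ae] Ac] [Bi B0i [eB eB0 Be] Bc].
have bdd (C : nat -> R -> R -> R) C0 : (forall n s, l2 (C n s)) -> l2 C0 ->
    nrm (C n t - C0) @[n --> \oo] --> (0 : R) ->
    exists2 M, 0 <= M & forall n, nrm (C n t) <= M.
  move=> Ci C0i Cc.
  have /cvg_seq_bounded[M [_ MC]] : cvgn (fun n => nrm (C n t - C0)).
    by apply/cvg_ex; exists 0.
  exists (`|M| + 1 + nrm C0); first by rewrite !addr_ge0 ?nrm_ge0.
  move=> n; rewrite -[C n t](subrK C0).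
  apply: le_trans (nrmD (l2B (Ci n t) C0i) C0i) _; rewrite lerD2r.
  apply: le_trans (ler_norm _) _; apply: MC => //.
  by rewrite (le_lt_trans (ler_norm M))// ltrDl.
have [MA MA0 hA] := bdd A A0 Ai A0i Ac; have [MB MB0 hB] := bdd B B0 Bi B0i Bc.
split.
  exists (fun s => MB * eA s + MA * eB s + eA s * eB s).
    by apply: to0D; [apply: to0D; exact: to0Z|exact: to0M].
  move=> n s; apply: le_trans (ip_bound_cvg (Ai n t) (Bi n t) (Ai n s) (Bi n s)) _.
  apply: lerD; [apply: lerD|].
  - by rewrite [leRHS]mulrC; apply: ler_pM; rewrite ?nrm_ge0.
  - by apply: ler_pM; rewrite ?nrm_ge0.
  - by apply: ler_pM; rewrite ?nrm_ge0.
apply: (cvg_dist_le (fun n => ip_bound_cvg A0i B0i (Ai n t) (Bi n t))).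
rewrite -[X in _ --> X](_ : 0 * nrm B0 + nrm A0 * 0 + 0 * 0 = 0 :> R); last by ring.
apply: cvgD; last exact: cvgM.
by apply: cvgD; apply: cvgM => //; exact: cvg_cst.
Qed.

End Families.

(** * Differentiation along the flow *)

Section TimeCalculus.
Context {R : realType}.
Notation mu := (@lebesgue_measure R).
Implicit Types (f g F G p q w : R -> R) (a b c h x y M s t : R).
Implicit Types (U V P Q : R -> R -> R) (e : R -> R).

Lemma is_derive_eps (Phi : R -> R) t c :
  (forall d, 0 < d -> \forall h \near 0, `|Phi (t + h) - Phi t - h * c| <= d * `|h|) ->
  is_derive t 1 Phi c.
Proof.
move=> H.
have : (fun h => h^-1 *: ((Phi \o shift t) (h *: 1) - Phi t)) @ 0^' --> (c : R).
  apply/cvgrPdist_le => d d0; have [r r0 h] := H d d0.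
  exists r => // k /= kr k0; rewrite distrC.
  have := h k kr; rewrite [k%:A]mulr1 (addrC k).
  have k1 : 0 < `|k| by rewrite normr_gt0.
  rewrite (_ : _ - c = k^-1 * (Phi (t + k) - Phi t - k * c)); last first.
    by rewrite -[_ *: _]/(_ * _); field.
  by rewrite [k^-1 * _]mulrC normrM normfV ler_pdivrMr.
move=> cv; apply: DeriveDef; first by apply/cvg_ex; exists c.
exact: cvg_lim cv.
Qed.

Lemma is_derive_continuous (f df : R -> R) x : is_derive x 1 f (df x) ->
  {for x, continuous f}.
Proof.
by case=> dx _; apply: differentiable_continuous; exact/derivable1_diffP.
Qed.

Lemma MVT_pos (f df : R -> R) a h : 0 <= h -> (forall x, is_derive x 1 f (df x)) ->
  exists2 r, a <= r <= a + h & f (a + h) - f a = h * df r.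
Proof.
move=> h0 fd.
have fc : continuous f by move=> x; exact: is_derive_continuous (fd x).
have ah : a <= a + h by rewrite lerDl.
have [r + E] := MVT_segment ah (fun x _ => fd x) (continuous_subspaceT fc).
rewrite in_itv /= => arh; exists r => //.
by rewrite E addrAC subrr add0r mulrC.
Qed.

Lemma MVT_any (f df : R -> R) a h : (forall x, is_derive x 1 f (df x)) ->
  exists2 r, `|r - a| <= `|h| & f (a + h) - f a = h * df r.
Proof.
move=> fd; have [h0|h0] := leP 0 h.
  have [r /andP[ar rh] E] := MVT_pos a h0 fd; exists r => //.
  by rewrite !ger0_norm ?subr_ge0// lerBlDl.
have h0' : 0 <= - h by rewrite oppr_ge0 ltW.
have [r /andP[ar rh] E] := MVT_pos (a + h) h0' fd; exists r; last first.
  by move: E; rewrite addrK; lra.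
by rewrite addrK in rh; rewrite ler0_norm ?subr_le0// ltr0_norm//; lra.
Qed.

(** The mean value theorem bounds [Phi n (t + h) - Phi n t - h * c] by the common modulus of
    continuity and [|g n t - c|]. Letting [n] tend to infinity at fixed [h] gives differentiability
    of the limit. *)
Lemma derive_limit (Phi g : nat -> R -> R) (Phi0 : R -> R) t c :
  (forall n s, is_derive s 1 (Phi n) (g n s)) ->
  (forall s, Phi n s @[n --> \oo] --> Phi0 s) -> icv t g c ->
  is_derive t 1 Phi0 c.
Proof.
move=> dPhi Phic [[e e0 ge] gc]; apply: is_derive_eps => d d0.
have /cvgr0Pnorm_le/(_ _ d0)[r r0 er] := e0.
exists r => // h /=; rewrite sub0r normrN => hr.
have step n : `|Phi n (t + h) - Phi n t - h * c| <= (d + `|g n t - c|) * `|h|.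
  have [s sh ->] := MVT_any t h (dPhi n).
  rewrite -mulrBr normrM mulrC ler_wpM2r//.
  rewrite (_ : _ - c = (g n s - g n t) + (g n t - c)); last by ring.
  apply: le_trans (ler_normD _ _) _; rewrite lerD2r.
  apply: le_trans (ge n s) _; apply: le_trans (ler_norm _) _.
  by apply: er; rewrite /= distrC (le_lt_trans sh).
have lim1 : `|Phi n (t + h) - Phi n t - h * c| @[n --> \oo] -->
    `|Phi0 (t + h) - Phi0 t - h * c|.
  by apply: cvg_norm; apply: cvgB; [exact: cvgB|exact: cvg_cst].
have lim2 : (d + `|g n t - c|) * `|h| @[n --> \oo] --> (d + 0) * `|h|.
  apply: cvgM; last exact: cvg_cst.
  apply: cvgD; first exact: cvg_cst.
  rewrite -(normr0 R) -(subrr c); apply: cvg_norm.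
  by apply: cvgB => //; exact: cvg_cst.
rewrite -[d]addr0; apply: ler_cvg_to lim1 lim2 _.
by apply: nearW => n; exact: step.
Qed.

(* [evol U F G]: the H^{-1}-valued derivative of [U] at time [t] is the
   functional [w |-> ip (F t) w' + ip (G t) w]. *)
Definition evol U (F G : R -> R -> R) := forall t d, 0 < d ->
  \forall h \near (0 : R), forall w w', Hs w w' ->
  `|ip (U (t + h) - U t) w - h * (ip (F t) w' + ip (G t) w)| <=
  d * `|h| * (nrm w + nrm w').

Lemma H0c_near U P t d : H0c U P -> 0 < d ->
  \forall h \near (0 : R), nrm (U (t + h) - U t) <= d /\ nrm (P (t + h) - P t) <= d.
Proof.
move=> [_ _ [_ Uc] [_ Pc]] d0.
have /cvgr0Pnorm_le/(_ _ d0)[r r0 er] := Uc t.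
have /cvgr0Pnorm_le/(_ _ d0)[r' r'0 er'] := Pc t.
exists (Num.min r r'); first by rewrite /= lt_min; apply/andP.
move=> h /=; rewrite sub0r normrN lt_min => /andP[hr hr'].
have E : `|t - (t + h)| = `|h| by rewrite opprD addrA subrr add0r normrN.
split; apply: le_trans (ler_norm _) _; [apply: er|apply: er']; by rewrite /= E.
Qed.

(** Interpolation between H^{-1} and H^1: the increment of [U] serves as its own test function. Its
    pairing with itself is [O(h)] times its H^1 norm, and that norm tends to 0. *)
Lemma evol_sq U P (F G : R -> R -> R) t d : H0c U P -> l2 (F t) -> l2 (G t) -> evol U F G ->
  0 < d -> \forall h \near (0 : R), nrm (U (t + h) - U t) ^+ 2 <= d * `|h|.
Proof.
move=> UP Fi Gi ev d0.
(* With both norms of the increment below [d / K], the main term contributes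
   [nrm (F t) + nrm (G t)], and the error term of [evol], taken with constant 1, contributes 2. *)
set K := nrm (F t) + nrm (G t) + 2.
have K0 : 0 < K by rewrite /K ltr_wpDl ?addr_ge0 ?nrm_ge0.
have dK : 0 < d / K by rewrite divr_gt0.
have n1 := H0c_near t UP dK; have n2 := ev t 1 ltr01.
near=> h.
have [Uh Ph] : nrm (U (t + h) - U t) <= d / K /\ nrm (P (t + h) - P t) <= d / K.
  by near: h.
have [US _ [Ui _] [Pi _]] := UP.
have dUi := l2B (Ui (t + h)) (Ui t); have dPi := l2B (Pi (t + h)) (Pi t).
have : `|ip (U (t + h) - U t) (U (t + h) - U t) - h * (ip (F t) (P (t + h) - P t)
    + ip (G t) (U (t + h) - U t))| <= 1 * `|h| *
    (nrm (U (t + h) - U t) + nrm (P (t + h) - P t)).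
  by (have : forall w w', Hs w w' -> `|ip (U (t + h) - U t) w - h * (ip (F t) w' + ip (G t) w)| <=
  1 * `|h| * (nrm w + nrm w') by near: h); apply; exact: HsB.
rewrite nrm_sq mul1r; set A := ip _ _; set B := _ + ip _ _ => le1.
have BK : `|B| <= (nrm (F t) + nrm (G t)) * (d / K).
  apply: le_trans (ler_normD _ _) _; rewrite mulrDl; apply: lerD.
    by apply: le_trans (cauchy_schwarz Fi dPi) _; rewrite ler_wpM2l ?nrm_ge0.
  by apply: le_trans (cauchy_schwarz Gi dUi) _; rewrite ler_wpM2l ?nrm_ge0.
have AE : A = (A - h * B) + h * B by rewrite subrK.
apply: le_trans (ler_norm _) _; rewrite AE.
apply: le_trans (ler_normD _ _) _.
rewrite (_ : d * `|h| = `|h| * (2 * (d / K)) + `|h| * ((nrm (F t) + nrm (G t)) * (d / K))).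
  apply: lerD; last by rewrite normrM ler_wpM2l.
  by apply: le_trans le1 _; rewrite ler_wpM2l// mulrDl mul1r lerD.
by rewrite /K; field; rewrite -/K gt_eqF.
Unshelve. all: by end_near. Qed.

(** A chain rule: the gradient [(W1, W2)] lies in H^1 and can be tested against the H^{-1}
    derivative, while the remainder, quadratic in L^2, is [o(h)] by [evol_sq]. *)
Lemma evol_derive (Phi : R -> R) U1 P1 U2 P2 (F1 G1 F2 G2 : R -> R -> R) t c W1 W1' W2 W2' :
  H0c U1 P1 -> H0c U2 P2 -> l2 (F1 t) -> l2 (G1 t) -> l2 (F2 t) -> l2 (G2 t) ->
  evol U1 F1 G1 -> evol U2 F2 G2 -> Hs W1 W1' -> Hs W2 W2' ->
  (\forall h \near (0 : R), `|Phi (t + h) - Phi t - (ip (U1 (t + h) - U1 t) W1 +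
     ip (U2 (t + h) - U2 t) W2)| <=
     c * (nrm (U1 (t + h) - U1 t) ^+ 2 + nrm (U2 (t + h) - U2 t) ^+ 2)) ->
  is_derive t 1 Phi ((ip (F1 t) W1' + ip (G1 t) W1) + (ip (F2 t) W2' + ip (G2 t) W2)).
Proof.
move=> UP1 UP2 F1i G1i F2i G2i ev1 ev2 W1s W2s Phih.
apply: is_derive_eps => d d0.
pose K := `|c| * 2 + (nrm W1 + nrm W1') + (nrm W2 + nrm W2') + 1.
have K0 : 0 < K by rewrite /K ltr_wpDl// !addr_ge0 ?nrm_ge0// mulr_ge0.
have dK : 0 < d / K by rewrite divr_gt0.
have s1 := evol_sq UP1 F1i G1i ev1 dK; have s2 := evol_sq UP2 F2i G2i ev2 dK.
have e1 := ev1 t _ dK; have e2 := ev2 t _ dK.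
near=> h.
have q1 : nrm (U1 (t + h) - U1 t) ^+ 2 <= d / K * `|h| by near: h.
have q2 : nrm (U2 (t + h) - U2 t) ^+ 2 <= d / K * `|h| by near: h.
have r1 : `|ip (U1 (t + h) - U1 t) W1 - h * (ip (F1 t) W1' + ip (G1 t) W1)| <=
    d / K * `|h| * (nrm W1 + nrm W1').
  move: W1s; have : forall w w', Hs w w' ->
    `|ip (U1 (t + h) - U1 t) w - h * (ip (F1 t) w' + ip (G1 t) w)| <=
    d / K * `|h| * (nrm w + nrm w') by near: h.
  by apply.
have r2 : `|ip (U2 (t + h) - U2 t) W2 - h * (ip (F2 t) W2' + ip (G2 t) W2)| <=
    d / K * `|h| * (nrm W2 + nrm W2').
  move: W2s; have : forall w w', Hs w w' ->
    `|ip (U2 (t + h) - U2 t) w - h * (ip (F2 t) w' + ip (G2 t) w)| <=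
    d / K * `|h| * (nrm w + nrm w') by near: h.
  by apply.
have r3 : `|Phi (t + h) - Phi t - (ip (U1 (t + h) - U1 t) W1 +
     ip (U2 (t + h) - U2 t) W2)| <=
     c * (nrm (U1 (t + h) - U1 t) ^+ 2 + nrm (U2 (t + h) - U2 t) ^+ 2) by near: h.
move: q1 q2 r1 r2 r3.
set n1 := nrm _ ^+ 2; set n2 := nrm (U2 _ - _) ^+ 2.
set a1 := ip _ W1; set a2 := ip _ W2.
set b1 := ip _ W1' + _; set b2 := ip _ W2' + _ => q1 q2 r1 r2 r3.
have n10 : 0 <= n1 by exact: sqr_ge0.
have n20 : 0 <= n2 by exact: sqr_ge0.
have E : Phi (t + h) - Phi t - h * (b1 + b2) =
  (Phi (t + h) - Phi t - (a1 + a2)) + (a1 - h * b1) + (a2 - h * b2) by ring.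
rewrite E; apply: le_trans (ler_normD _ _) _.
apply: le_trans (lerD (ler_normD _ _) (lexx _)) _.
apply: le_trans (lerD (lerD r3 r1) r2) _.
have : c * (n1 + n2) <= `|c| * (2 * (d / K * `|h|)).
  apply: le_trans (ler_norm _) _; rewrite normrM ler_wpM2l//.
  by rewrite ger0_norm ?addr_ge0//; lra.
have k1 : d * `|h| = d / K * `|h| * K by field; rewrite gt_eqF.
rewrite k1; rewrite {5}/K.
have p0 : 0 <= d / K * `|h| by rewrite mulr_ge0// ltW.
move: p0; set p := d / K * `|h|; nra.
Unshelve. all: by end_near. Qed.

(** [20 J - m] and [20 J + m] are nondecreasing, so the increments of [m] are dominated by those of
    [J], which is monotone and bounded. On each [[t, t + 1]] the derivative [J'] takes the value
    [J (t + 1) - J t], where [m] is therefore small, and [m t] is close to that value of [m]. *)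
Lemma decay_from_virial (m J m' J' : R -> R) B :
  (forall t, is_derive t 1 m (m' t)) -> (forall t, is_derive t 1 J (J' t)) ->
  (forall t, `|m' t| <= 20 * J' t) -> (forall t, 0 <= m t <= 5 * J' t) ->
  (forall t, `|J t| <= B) -> m t @[t --> +oo] --> (0 : R).
Proof.
move=> dm dJ mJ mle JB.
have inc t h : 0 <= h -> `|m (t + h) - m t| <= 20 * (J (t + h) - J t).
  move=> h0.
  have dp s : is_derive s 1 (20 *: J - m) (20 * J' s - m' s) by apply: is_deriveB.
  have dq s : is_derive s 1 (20 *: J + m) (20 * J' s + m' s) by apply: is_deriveD.
  have [r _] := MVT_any t h dp; have [r' _] := MVT_any t h dq.
  rewrite -[LHS]/(20 * J (t + h) + m (t + h) - (20 * J t + m t)) => e1.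
  rewrite -[LHS]/(20 * J (t + h) - m (t + h) - (20 * J t - m t)) => e2.
  have := mJ r; have := mJ r'; rewrite !ler_norml => /andP[h1 _] /andP[_ h2].
  have : 0 <= h * (20 * J' r' + m' r') by rewrite mulr_ge0//; lra.
  have : 0 <= h * (20 * J' r - m' r) by rewrite mulr_ge0//; lra.
  by move=> ? ?; apply/andP; split; lra.
pose S := [set J t | t in setT].
have hS : has_sup S.
  split; first by exists (J 0), 0.
  by exists B => _ [t _ <-]; rewrite (le_trans (ler_norm _)).
apply/cvgr0Pnorm_le => e e0.
(* 25 = 20 + 5: the increment of [m] from [t] to [r] costs 20 parts and [m r] itself 5. *)
have d0 : 0 < e / 25 by rewrite divr_gt0.
have [_ [T _ <-] JT] := sup_adherent d0 hS.
exists T; split; first exact: num_real.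
move=> t Tt.
have JS s : J s <= sup S by apply: sup_ubound; [exact: hS.2|exists s].
have JTt : J T <= J t.
  have := inc T (t - T); rewrite subr_ge0 (ltW Tt) => /(_ isT).
  by rewrite (addrC T) subrK => /(le_trans (normr_ge0 _)); lra.
have [r /andP[tr _] E] := MVT_pos t ler01 dJ.
have J1 := JS (t + 1).
have mr := mle r; have mt := mle t.
have mrt : `|m r - m t| <= 20 * (e / 25).
  have := inc t (r - t); rewrite subr_ge0 tr => /(_ isT).
  rewrite (addrC t) subrK => /le_trans; apply.
  by rewrite ler_pM2l//; have := JS r; lra.
rewrite ger0_norm; last by case/andP: mt.
move: mrt; rewrite ler_norml => /andP[h1 h2].
by case/andP: mr => _; rewrite mul1r in E; lra.
Qed.

End TimeCalculus.

(** * Weights *)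

Section Weights.
Context {R : realType}.
Notation mu := (@lebesgue_measure R).
Implicit Types (f g F G p q w : R -> R) (a b c h x y M s t : R).

Lemma FTC2_II F f a b : a <= b ->
  (forall x, x \in `[a, b] -> is_derive x 1 F (f x)) ->
  (forall x, x \in `[a, b] -> {for x, continuous f}) -> F b - F a = II a b f.
Proof.
rewrite le_eqVlt => /predU1P[->|ab] Fd fc; first by rewrite subrr II_refl.
have Fc x : x \in `[a, b] -> {for x, continuous F}.
  move=> /Fd; case=> dx _; apply: differentiable_continuous; exact/derivable1_diffP.
apply/esym; rewrite /II /Rintegral (@continuous_FTC2 _ f F a b)//.
- by apply: continuous_in_subspaceT => x; rewrite inE => /fc.
- split.
  + by move=> x /subset_itv_oo_cc /Fd [].
  + by apply: cvg_at_right_filter; apply: Fc; rewrite in_itv /= lexx ltW.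
  + by apply: cvg_at_left_filter; apply: Fc; rewrite in_itv /= lexx ltW.
- by move=> x /subset_itv_oo_cc /Fd; rewrite derive1E => -[].
Qed.

Lemma prim_C1 F f : (forall x, is_derive x 1 F (f x)) -> continuous f -> prim F f.
Proof.
move=> Fd fc; split; last first.
  by move=> x y xy; exact: (FTC2_II xy (fun z _ => Fd z) (fun z _ => fc z)).
split; first exact: mf_cont.
move=> x y; apply: continuous_compact_integrable; first exact: segment_compact.
exact: continuous_subspaceT.
Qed.

(** The end points are left out because [sg 0 = 1] disagrees with the value -1 on the left half
    line. *)
Lemma eq_II_oo x y f g : mu.-integrable `[x, y] (EFin \o f) ->
  mu.-integrable `[x, y] (EFin \o g) ->
  (forall z, x < z < y -> f z = g z) -> II x y f = II x y g.
Proof.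
move=> fi gi fg.
have oo k : mu.-integrable `[x, y] (EFin \o k) ->
    II x y k = \int[mu]_(t in `]x, y[) k t.
  move=> ki; rewrite /II -Rintegral_itv_bndo_bndc; last first.
    by apply: integrableS ki => // t /=; rewrite !in_itv /= => /andP[-> /ltW].
  rewrite -Rintegral_itv_obnd_cbnd//.
  by apply: integrableS ki => // t /=; rewrite !in_itv /= => /andP[/ltW -> /ltW].
by rewrite !oo//; apply: eq_Rintegral => z; rewrite inE /= in_itv /=; exact: fg.
Qed.

Lemma prim_glue F f : loci f ->
  (forall x y, 0 <= x -> x <= y -> F y - F x = II x y f) ->
  (forall x y, y <= 0 -> x <= y -> F y - F x = II x y f) -> prim F f.
Proof.
move=> fi Fp Fn; split => // x y xy.
have [x0|/ltW x0] := leP 0 x; first exact: Fp.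
have [y0|/ltW y0] := leP 0 y; last exact: Fn.
by rewrite (II_split fi x0 y0) -(Fn _ _ (lexx 0) x0) -(Fp _ _ (lexx 0) y0); ring.
Qed.

Lemma prim_eq F f g : prim F f -> f =1 g -> prim F g.
Proof. by move=> Ff /funext <-. Qed.

(** The value 1 at the origin makes [sg x * sg x = 1] hold everywhere. *)
Definition sg x : R := if x < 0 then -1 else 1.
Definition wt x : R := (1 + `|x|)^-1.

Lemma sg_norm x : `|sg x| = 1.
Proof. by rewrite /sg; case: ifP; rewrite ?normrN1 ?normr1. Qed.
Lemma sg_sqr x : sg x * sg x = 1.
Proof. by rewrite /sg; case: ifP; lra. Qed.
Lemma sg_mul x : sg x * x = `|x|.
Proof. by rewrite /sg; case: ltrP => x0; [rewrite mulN1r ltr0_norm|rewrite mul1r ger0_norm]. Qed.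
Lemma mf_sg : mf sg.
Proof. by apply: measurable_fun_ifT => //; exact: measurable_fun_ltr. Qed.

Lemma wt_gt0 x : 0 < wt x. Proof. by rewrite invr_gt0 ltr_pwDl. Qed.
Lemma wt_le1 x : wt x <= 1.
Proof. by rewrite invf_le1 ?ltr_pwDl// lerDl. Qed.
Lemma wtK x : wt x * (1 + `|x|) = 1.
Proof. by rewrite mulVf// gt_eqF// ltr_pwDl. Qed.
Lemma wt_norm x : `|wt x| <= 1.
Proof. by rewrite gtr0_norm ?wt_gt0 ?wt_le1. Qed.

(** [F 0 = 0] removes the jump at the origin, so that no Dirac mass appears in the derivative. This
    is how the vanishing of u at the origin enters the virial estimate. *)
Lemma prim_sg F f : prim F f -> F 0 = 0 -> prim (sg * F) (sg * f).
Proof.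
move=> [[mf_ fi] Ff] F0.
have li : loci (sg * f).
  split; first by apply: mfM => //; exact: mf_sg.
  move=> x y; apply: (le_integrable _ _ _ (fi x y)) => //.
    apply/measurable_EFinP; apply: (measurable_funS measurableT) => //.
    by apply: mfM => //; exact: mf_sg.
  by move=> z _ /=; rewrite lee_fin normrM sg_norm mul1r.
apply: prim_glue => // x y xy0 xy.
  rewrite (@eq_II _ x y _ f); last first.
    move=> z; rewrite in_itv /= => /andP[xz _].
    by rewrite -[LHS]/(sg z * f z) /sg ltNge (le_trans xy0 xz) mul1r.
  rewrite -Ff// -[LHS]/(sg y * F y - sg x * F x) /sg !ltNge (le_trans xy0 xy) xy0.
  by rewrite !mul1r.
have N z : z <= 0 -> sg z * F z = - F z.
  rewrite le_eqVlt => /predU1P[->|z0]; first by rewrite F0 mulr0 oppr0.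
  by rewrite /sg z0 mulN1r.
have fl : loci f by split.
rewrite (@eq_II_oo x y _ ((-1) *: f)); [|exact: li.2|exact: (lociZ (-1) fl).2|]; last first.
  move=> z /andP[_ zy]; rewrite -[LHS]/(sg z * f z).
  by rewrite /sg (lt_le_trans zy xy0).
rewrite IIZ//.
by rewrite -Ff// -[LHS]/(sg y * F y - sg x * F x) !N// ?(le_trans xy xy0)//; ring.
Qed.

(** On a half line [|x| = e x] with [e] equal to 1 or -1, and [wt] coincides there with the smooth
    function [1 / (1 + e x)]. *)
Lemma wt_derive_half (e : R) a b : a <= b -> e * a >= 0 -> e * b >= 0 -> e * e = 1 ->
  (forall x, a < x < b -> sg x = e) -> loci (fun x => - (sg x * (wt x * wt x))) ->
  wt b - wt a = II a b (fun x => - (sg x * (wt x * wt x))).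
Proof.
move=> ab ea eb e2 sge li.
pose F x := (1 + e * x)^-1; pose f x := - (e * (F x * F x)).
have pos x : x \in `[a, b] -> 0 <= e * x.
  rewrite in_itv /= => /andP[ax xb].
  have [e0|e0] := leP 0 e; first by rewrite (le_trans ea)// ler_wpM2l.
  by rewrite (le_trans eb)// ler_wnM2l// ltW.
have FE x : x \in `[a, b] -> wt x = F x.
  move=> xab; rewrite /wt /F; congr (_ + _)^-1.
  have := pos x xab; have : `|x| = `|e * x|.
    rewrite normrM (_ : `|e| = 1) ?mul1r//.
    have : `|e| ^+ 2 = 1 by rewrite real_normK ?num_real// expr2.
    by move=> /eqP; rewrite sqrf_eq1 => /predU1P[//|/eqP h]; have := normr_ge0 e; rewrite h; lra.
  by move=> -> /ger0_norm.
have Fd x : x \in `[a, b] -> is_derive x 1 F (f x).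
  move=> /pos ex; pose g (x : R) := 1 + e * x.
  have ne0 : g x != 0 by rewrite gt_eqF// ltr_pwDl.
  have [gd gE] : is_derive x 1 g e.
    apply: is_derive_eps => d d0; exists 1 => //= h _.
    rewrite (_ : _ - _ - _ = 0); last by rewrite /g; ring.
    by rewrite normr0 mulr_ge0// ltW.
  have dV := derivableV ne0 gd; have := deriveV ne0 gd; rewrite gE => dVE.
  have -> : f x = - (g x) ^- 2 *: e.
    by rewrite -[RHS]/(_ * _) /f /F -exprVn expr2 /g; ring.
  exact: DeriveDef dV dVE.
rewrite (FE b) ?(FE a) ?in_itv /= ?lexx ?ab//.
have fc x : x \in `[a, b] -> {for x, continuous f}.
  move=> xab; have Fc : {for x, continuous F}.
    by case: (Fd x xab) => dx _; apply: differentiable_continuous; exact/derivable1_diffP.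
  apply: cvgN; apply: cvgM; first exact: cvg_cst.
  exact: (cvgM Fc Fc).
rewrite (FTC2_II ab Fd fc).
apply: eq_II_oo; [|exact: li.2|].
  apply: continuous_compact_integrable; first exact: segment_compact.
  by apply: continuous_in_subspaceT => x; rewrite inE => /fc.
move=> x axb; rewrite /f sge// FE// in_itv /=.
by case/andP: axb => /ltW -> /ltW ->.
Qed.

Lemma prim_wt : prim wt (fun x => - (sg x * (wt x * wt x))).
Proof.
have mw : mf wt.
  apply: mf_cont => x; apply: cvgV; first by rewrite gt_eqF// ltr_pwDl.
  apply: cvgD; first exact: cvg_cst.
  by apply: cvg_norm; exact: cvg_id.
have li : loci (fun x => - (sg x * (wt x * wt x))).
  apply: (@bounded_loci _ 1).
    by apply: mfN; apply: mfM; [exact: mf_sg|exact: mfM].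
  move=> x; rewrite normrN normrM sg_norm mul1r normrM.
  by rewrite mulr_ile1// ?wt_norm.
apply: prim_glue => // x y xy0 xy.
  apply: (@wt_derive_half 1) => //; rewrite ?mul1r ?mulr1//.
    exact: le_trans xy.
  by move=> z /andP[xz _]; rewrite /sg ltNge (le_trans xy0)// ltW.
apply: (@wt_derive_half (-1)) => //; rewrite ?mulN1r ?mulN1r ?opprK ?oppr_ge0//.
  exact: le_trans xy0.
by move=> z /andP[_ zy]; rewrite /sg (lt_le_trans zy).
Qed.

Definition phi x : R := x * wt x.
Definition w2 : R -> R := wt * wt.
Definition w2' x : R := - (2 * sg x * (wt x) ^+ 3).
Definition w3 : R -> R := w2 * wt.
Definition w3' x : R := - (3 * sg x * (wt x) ^+ 4).
Definition w4 : R -> R := w2 * w2.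
Definition w4' x : R := - (4 * sg x * (wt x) ^+ 5).

Lemma mf_wt : mf wt. Proof. exact: prim_mf prim_wt. Qed.
Lemma mf_w2 : mf w2. Proof. by apply: mfM; exact: mf_wt. Qed.
Lemma mf_sgwt c n : mf (fun x => - (c * sg x * wt x ^+ n)).
Proof.
apply: mfN; apply: mfM; first by apply: mfM; [exact: mf_cst|exact: mf_sg].
by apply: mfX; exact: mf_wt.
Qed.

Lemma sgwt_bound c n x : 0 <= c -> `|- (c * sg x * wt x ^+ n)| <= c.
Proof.
move=> c0; rewrite normrN !normrM sg_norm mulr1 normrX ger0_norm//.
by rewrite ler_piMr// exprn_ile1// wt_norm.
Qed.
Lemma w2_bound x : `|w2 x| <= 1.
Proof. by rewrite normrM mulr_ile1 ?wt_norm. Qed.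
Lemma w3_bound x : `|w3 x| <= 1.
Proof. by rewrite normrM mulr_ile1 ?wt_norm ?w2_bound. Qed.
Lemma w4_bound x : `|w4 x| <= 1.
Proof. by rewrite normrM mulr_ile1 ?w2_bound. Qed.
Lemma phi_bound x : `|phi x| <= 1.
Proof.
rewrite normrM (gtr0_norm (wt_gt0 x)) mulrC -[leRHS](wtK x).
rewrite ler_pM2l ?wt_gt0//.
by rewrite lerDr.
Qed.

Lemma prim_phi : prim phi w2.
Proof.
apply: (prim_eq (primM prim_id prim_wt)) => x.
change (wt x * 1 + x * (- (sg x * (wt x * wt x))) = wt x * wt x).
have := wtK x; rewrite -sg_mul; set s := sg x => wx.
(* Since [wt x * (1 + |x|) = 1], the term [wt x] splits as [wt x ^ 2 + |x| * wt x ^ 2], and the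
   second part cancels. *)
have -> : wt x * 1 = wt x * (wt x * (1 + s * x)) by rewrite wx.
by ring.
Qed.
Lemma prim_w2 : prim w2 w2'.
Proof.
apply: (prim_eq (primM prim_wt prim_wt)) => x.
change (wt x * (- (sg x * (wt x * wt x))) + wt x * (- (sg x * (wt x * wt x))) = w2' x).
by rewrite /w2'; ring.
Qed.
Lemma prim_w3 : prim w3 w3'.
Proof.
apply: (prim_eq (primM prim_w2 prim_wt)) => x.
change (wt x * w2' x + (wt x * wt x) * (- (sg x * (wt x * wt x))) = w3' x).
by rewrite /w2' /w3'; ring.
Qed.
Lemma prim_w4 : prim w4 w4'.
Proof.
apply: (prim_eq (primM prim_w2 prim_w2)) => x.
change ((wt x * wt x) * w2' x + (wt x * wt x) * w2' x = w4' x).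
by rewrite /w2' /w4'; ring.
Qed.

End Weights.

(** * Conservation of mass and the virial functional *)

Section Evolution.
Context {R : realType}.
Notation mu := (@lebesgue_measure R).
Implicit Types (f g F G p q w : R -> R) (a b c h x y M s t : R).

Lemma ipNl f g : l2 f -> l2 g -> ip (- f) g = - ip f g.
Proof. by move=> fi gi; rewrite -scaleN1r ipZl// mulN1r. Qed.
Lemma ipNr f g : l2 f -> l2 g -> ip g (- f) = - ip g f.
Proof. by move=> fi gi; rewrite ipC ipNl// ipC. Qed.
Lemma ip_mul p f g : ip (p * f) g = ip f (p * g).
Proof. by rewrite /ip mulrCA mulrA. Qed.

Lemma Hs_Int0 F f G g : Hs F f -> Hs G g -> Int (G * f + F * g) = 0.
Proof.
move=> [Ff Fi fi] [Gg Gi gi]; apply: (Int_prim0 (primM Ff Gg)); first exact: l2M.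
by apply: itgD; exact: l2M.
Qed.

Variables (eps : R) (U1 U2 P1 P2 : R -> R -> R).
Definition rho t := U1 t * U1 t + U2 t * U2 t.
Definition drho t := U1 t * P1 t + U1 t * P1 t + (U2 t * P2 t + U2 t * P2 t).
(* The nonlinearity is [nl * u]. *)
Definition nl t := rho t + eps *: (rho t * rho t).
Definition dnl t := drho t + eps *: (rho t * drho t + rho t * drho t).
Definition N1 t := nl t * U1 t.
Definition N2 t := nl t * U2 t.
Definition dN1 t := U1 t * dnl t + nl t * P1 t.
Definition dN2 t := U2 t * dnl t + nl t * P2 t.

Hypothesis h1 : H0c U1 P1.
Hypothesis h2 : H0c U2 P2.

Lemma H0c_rho : H0c rho drho.
Proof. by apply: H0cD; exact: H0cM. Qed.
Lemma H0c_nl : H0c nl dnl.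
Proof. by apply: H0cD; [exact: H0c_rho|apply: H0cZ; apply: H0cM; exact: H0c_rho]. Qed.
Lemma H0c_N1 : H0c N1 dN1.
Proof. by apply: H0cM => //; exact: H0c_nl. Qed.
Lemma H0c_N2 : H0c N2 dN2.
Proof. by apply: H0cM => //; exact: H0c_nl. Qed.

Let u1 t : l2 (U1 t). Proof. by have [_ _ [+ _] _] := h1; exact. Qed.
Let u2 t : l2 (U2 t). Proof. by have [_ _ [+ _] _] := h2; exact. Qed.
Let p1 t : l2 (P1 t). Proof. by have [_ _ _ [+ _]] := h1; exact. Qed.
Let p2 t : l2 (P2 t). Proof. by have [_ _ _ [+ _]] := h2; exact. Qed.
Let n1 t : l2 (N1 t). Proof. by have [_ _ [+ _] _] := H0c_N1; exact. Qed.
Let n2 t : l2 (N2 t). Proof. by have [_ _ [+ _] _] := H0c_N2; exact. Qed.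
Let s1 t : Hs (U1 t) (P1 t). Proof. by have [+ _ _ _] := h1; exact. Qed.
Let s2 t : Hs (U2 t) (P2 t). Proof. by have [+ _ _ _] := h2; exact. Qed.

Hypothesis ev1 : evol U1 P2 N2.
Hypothesis ev2 : evol U2 (fun t => - P1 t) (fun t => - N1 t).

(** [evol_derive] for [u_t = i (u_xx - nl u)]: the pair [(P2, N2)] drives [U1] and [(-P1, -N1)]
    drives [U2]. *)
Lemma flow_derive (Phi : R -> R) t c W1 W1' W2 W2' c' : Hs W1 W1' -> Hs W2 W2' ->
  (\forall h \near (0 : R), `|Phi (t + h) - Phi t - (ip (U1 (t + h) - U1 t) W1 +
     ip (U2 (t + h) - U2 t) W2)| <=
     c * (nrm (U1 (t + h) - U1 t) ^+ 2 + nrm (U2 (t + h) - U2 t) ^+ 2)) ->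
  c' = ip (P2 t) W1' + ip (N2 t) W1 - ip (P1 t) W2' - ip (N1 t) W2 ->
  is_derive t 1 Phi c'.
Proof.
move=> W1s W2s Ph ->.
have [_ W2i W2'i] := W2s.
have := evol_derive h1 h2 (p2 t) (n2 t) (l2N (p1 t)) (l2N (n1 t)) ev1 ev2 W1s W2s Ph.
by rewrite !ipNl// addrA.
Qed.

Lemma derive0_const (Phi : R -> R) : (forall t, is_derive t 1 Phi 0) ->
  forall t, Phi t = Phi 0.
Proof.
move=> d t; have [r _] := MVT_any 0 t d.
by rewrite add0r mulr0 => /eqP; rewrite subr_eq0 => /eqP.
Qed.

Lemma weighted_square_expand c p f g : mf p -> (forall x, `|p x| <= c) -> l2 f -> l2 g ->
  ip (p * g) g - ip (p * f) f - ip (g - f) (2 *: (p * f)) = ip (p * (g - f)) (g - f).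
Proof.
move=> mp pc fi gi; have pf := l2Mb mp pc fi; have pg := l2Mb mp pc gi.
have gf := l2B gi fi.
rewrite ipZr// mulrBr !ipBl// !ipBr//.
rewrite (ip_mul p g f) (ipC (p * f) g) (ipC (p * f) f).
by ring.
Qed.

(** The nonlinearity is a real multiple of u, so its two contributions cancel; so do the terms
    [p P1 P2]. Only the mass flux against the derivative [q] of the weight is left. *)
Lemma weighted_mass_derive c c' p q t : prim p q -> mf q ->
  (forall x, `|p x| <= c) -> (forall x, `|q x| <= c') ->
  is_derive t 1 (fun t => ip (p * U1 t) (U1 t) + ip (p * U2 t) (U2 t))
    (2 * (ip (P2 t) (q * U1 t) - ip (P1 t) (q * U2 t))).
Proof.
move=> pq mq pc qc; have mp := prim_mf pq.
have qi k := l2Mb mq qc k; have pi k := l2Mb mp pc k.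
apply: (flow_derive (c := c) (HsZ 2 (HsM pq mq pc qc (s1 t))) (HsZ 2 (HsM pq mq pc qc (s2 t)))).
- exists 1 => //= h _.
  rewrite (_ : _ - _ - _ =
     (ip (p * U1 (t + h)) (U1 (t + h)) - ip (p * U1 t) (U1 t)
       - ip (U1 (t + h) - U1 t) (2 *: (p * U1 t))) +
     (ip (p * U2 (t + h)) (U2 (t + h)) - ip (p * U2 t) (U2 t)
       - ip (U2 (t + h) - U2 t) (2 *: (p * U2 t)))); last by ring.
  rewrite !(weighted_square_expand mp pc)//.
  have bd f : l2 f -> `|ip (p * f) f| <= c * nrm f ^+ 2.
    move=> fi; apply: le_trans (cauchy_schwarz (pi _ fi) fi) _.
    rewrite expr2 mulrA ler_wpM2r ?nrm_ge0// nrmMb//.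
    exact: le_trans (normr_ge0 _) (pc 0).
  apply: le_trans (ler_normD _ _) _; rewrite [leRHS]mulrDr.
  by apply: lerD; apply: bd; exact: l2B.
- have i1 := qi _ (u1 t); have i2 := qi _ (u2 t); have i3 := pi _ (u1 t).
  have i4 := pi _ (u2 t); have i5 := pi _ (p1 t); have i6 := pi _ (p2 t).
  rewrite (mulrC (U1 t) q) (mulrC (U2 t) q).
  have i7 := l2D i1 i5; have i8 := l2D i2 i6.
  rewrite !ipZr// !ipDr//.
  have -> : ip (N2 t) (p * U1 t) = ip (N1 t) (p * U2 t).
    by congr Int; apply/funext => x; rewrite /N1 /N2 !fctE; ring.
  have -> : ip (P2 t) (p * P1 t) = ip (P1 t) (p * P2 t).
    by congr Int; apply/funext => x; rewrite !fctE; ring.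
  by ring.
Qed.

Definition mass t := ip (U1 t) (U1 t) + ip (U2 t) (U2 t).

Lemma mass_conserved t : mass t = mass 0.
Proof.
apply: derive0_const => {}t.
have mc : mf (fun=> 0 : R) by exact: mf_cst.
have := @weighted_mass_derive 1 0 (fun=> 1) (fun=> 0) t (prim_cst 1) mc.
rewrite (_ : (fun=> 0) * U1 t = 0); last by apply/funext => x; rewrite !fctE mul0r.
rewrite (_ : (fun=> 0) * U2 t = 0); last by apply/funext => x; rewrite !fctE mul0r.
have ip0 f : ip f 0 = 0 by rewrite /ip mulr0 Int0.
rewrite !ip0 subrr mulr0 (_ : (fun t => _) = mass).
  by apply=> x; rewrite ?normr1 ?normr0.
apply/funext => s; congr (ip _ _ + ip _ _); apply/funext => x; exact: mul1r.
Qed.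

(* The virial functional [J] is approximated by [Jn n], in which the derivative
   is replaced by a difference quotient: these are defined on L^2, hence
   differentiable along the flow. *)
Definition J t := ip (phi * U1 t) (P2 t) - ip (phi * U2 t) (P1 t).
Definition Jn n t := ip (phi * U1 t) (dq (hs n) (U2 t))
  - ip (phi * U2 t) (dq (hs n) (U1 t)).

(** With [g] the derivative of [f], this is the derivative of [w2 * f]; [phiU] plays the same part
    for [phi * f]. *)
Definition w2U f g := w2' * f + w2 * g.
Definition phiU f g := w2 * f + phi * g.

(** The contribution of one component of u to the derivative of [Jn]. In [dJ_part] each quotient is
    replaced by the derivative that it approximates. *)
Definition dJn_part n P U N : R :=
  ip P (w2 * dq (hs n) U + dq (- hs n) (w2 * U))
  + ip N (phi * dq (hs n) U + dq (- hs n) (phi * U)).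
Definition dJ_part P U N : R :=
  ip P (w2 * P + w2U U P) + ip N (phi * P + phiU U P).

Lemma hs_neq0 n : hs n != 0 :> R. Proof. by rewrite gt_eqF// hs_gt0. Qed.

Lemma HsMb_phi f g : Hs f g -> Hs (phi * f) (f * w2 + phi * g).
Proof. by move=> fg; exact: (HsM prim_phi mf_w2 phi_bound w2_bound fg). Qed.

Lemma l2_phi f : l2 f -> l2 (phi * f).
Proof. by move=> fi; exact: (l2Mb (prim_mf prim_phi) phi_bound fi). Qed.
Lemma l2_w2 f : l2 f -> l2 (w2 * f).
Proof. by move=> fi; exact: (l2Mb mf_w2 w2_bound fi). Qed.

Lemma dqD h F G : dq h (F + G) = dq h F + dq h G.
Proof. by rewrite -[G]opprK dqB -[X in _ = _ + X]opprK; congr (_ - _); apply/funext => x; rewrite /dq /sh !fctE; ring. Qed.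

Lemma Jn_derive n t : is_derive t 1 (Jn n)
  (dJn_part n (P2 t) (U2 t) (N2 t) + dJn_part n (P1 t) (U1 t) (N1 t)).
Proof.
pose k : R := hs n; have k0 : k != 0 := hs_neq0 n.
(* Applied to [U2], this is the gradient of [Jn] in [U1]; applied to [U1], it is minus the gradient
   in [U2]. The backward quotient comes from the adjoint of [dq k]. *)
have W f g : Hs f g -> Hs (phi * dq k f + dq (- k) (phi * f))
    (dq k f * w2 + phi * dq k g + dq (- k) (f * w2 + phi * g)).
  move=> fg; apply: HsD; first by apply: HsMb_phi; exact: Hs_dq.
  by apply: Hs_dq; exact: HsMb_phi.
have bdd f : l2 f -> nrm (dq k f) <= `|k^-1| * 2 * nrm f.
  move=> fi; rewrite nrmZ; last by apply: l2B => //; exact: l2_sh.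
  rewrite -mulrA ler_wpM2l//; apply: le_trans (nrmB (l2_sh k fi) fi) _.
  by rewrite nrm_sh// mulr_natl.
apply: (flow_derive (c := `|k^-1| * 2) (W _ _ (s2 t)) (HsN (W _ _ (s1 t)))).
- exists 1 => //= h _.
  have := u1 (t + h); have := u2 (t + h); have := u1 t; have := u2 t.
  rewrite /Jn -/k.
  set a := U1 t; set b := U2 t; set a' := U1 (t + h); set b' := U2 (t + h).
  move=> bi ai bi' ai'.
  have dai := l2B ai' ai; have dbi := l2B bi' bi.
  have [pa pb pa' pb'] : [/\ l2 (phi * a), l2 (phi * b), l2 (phi * a') & l2 (phi * b')].
    by split; exact: l2_phi.
  have [qa qb qa' qb'] : [/\ l2 (dq k a), l2 (dq k b), l2 (dq k a') & l2 (dq k b')].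
    by split; exact: l2_dq.
  have [ra rb] : l2 (phi * dq k a) /\ l2 (phi * dq k b) by split; exact: l2_phi.
  have [ra' rb'] : l2 (dq (- k) (phi * a)) /\ l2 (dq (- k) (phi * b)) by split; exact: l2_dq.
  have dpa := l2_phi dai; have dpb := l2_phi dbi.
  have dqa : l2 (dq k (a' - a)) by exact: l2_dq.
  have dqb : l2 (dq k (b' - b)) by exact: l2_dq.
  (* [Jn] is quadratic, so the remainder is exactly its value at the increments. *)
  rewrite (_ : _ - _ = ip (phi * (a' - a)) (dq k (b' - b)) - ip (phi * (b' - b)) (dq k (a' - a))).
    have csd f g : l2 f -> l2 g -> `|ip (phi * f) (dq k g)| <= `|k^-1| * (nrm f ^+ 2 + nrm g ^+ 2).
      move=> fi gi; apply: le_trans (cauchy_schwarz (l2_phi fi) (l2_dq k gi)) _.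
      have nf : nrm (phi * f) <= nrm f.
        by rewrite -[leRHS]mul1r; exact: (nrmMb (prim_mf prim_phi) ler01 phi_bound fi).
      apply: (@le_trans _ _ (nrm f * (`|k^-1| * 2 * nrm g))).
        exact: (ler_pM (nrm_ge0 _) (nrm_ge0 _) nf (bdd _ gi)).
      have := mulr_ge0 (normr_ge0 k^-1) (sqr_ge0 (nrm f - nrm g)).
      by move: (`|k^-1|) (nrm f) (nrm g) => x y z; nra.
    apply: le_trans (ler_normB _ _) _.
    by apply: le_trans (lerD (csd _ _ dai dbi) (csd _ _ dbi dai)) _; lra.
  have ea := l2B qa' qa; have eb := l2B qb' qb.
  have rabp := l2D rb rb'; have rabp' := l2D ra ra'.
  rewrite ipNr// !ipDr//.
  have t1 f g : l2 f -> l2 g -> ip f (dq (- k) g) = - ip (dq k f) g.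
    by move=> fi gi; rewrite ipC ip_dqN// ipC.
  rewrite !t1// !dqB !mulrBr !ipBl ?ipBr//.
  rewrite -(ip_mul phi a' (dq k b)) -(ip_mul phi a (dq k b)).
  rewrite -(ip_mul phi b' (dq k a)) -(ip_mul phi b (dq k a)).
  rewrite (ipC (dq k a')) (ipC (dq k a) (phi * b)) (ipC (dq k b')).
  by rewrite (ipC (dq k b) (phi * a)); ring.
- rewrite ipNr; last 2 first.
  + by have [] := W _ _ (s1 t).
  + exact: p1.
  rewrite ipNr; last 2 first.
  + by have [] := W _ _ (s1 t).
  + exact: n1.
  rewrite !opprK /dJn_part -/k.
  (* The quotients of [g], which stand for second derivatives of u, cancel by discrete integration
     by parts. Only quotients of H^1 functions remain, and these have limits. *)
  have key f g : Hs f g -> ip g (dq k f * w2 + phi * dq k g + dq (- k) (f * w2 + phi * g))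
      = ip g (w2 * dq k f + dq (- k) (w2 * f)).
    move=> [_ fi gi].
    have wi := l2_w2 fi; have pgi := l2_phi gi.
    have e1 := l2_w2 (l2_dq k fi); have e2 := l2_phi (l2_dq k gi).
    have e3 := l2_dq (- k) wi; have e4 := l2_dq (- k) pgi.
    rewrite !(mulrC _ w2) dqD !ipDr//; [|exact: l2D|exact: l2D].
    have -> : ip g (dq (- k) (phi * g)) = - ip g (phi * dq k g).
      by rewrite ipC ip_dqN// ip_mul.
    by ring.
  by rewrite (key _ _ (s2 t)) (key _ _ (s1 t)); ring.
Qed.

(** Every quotient left in the derivative of [Jn] acts on an H^1-continuous family, [U], [w2 * U] or
    [phi * U], so that [ucv_dq] supplies the uniformity asked by [derive_limit]. *)
Lemma J_derive t : is_derive t 1 J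
  (dJ_part (P2 t) (U2 t) (N2 t) + dJ_part (P1 t) (U1 t) (N1 t)).
Proof.
have kc : (- hs n : R) @[n --> \oo] --> (0 : R) by rewrite -oppr0; apply: cvgN; exact: hs_cvg.
have kn n : - hs n != 0 :> R by rewrite oppr_eq0 hs_neq0.
have part U P N : H0c U P -> l2c N ->
    icv t (fun n s => dJn_part n (P s) (U s) (N s)) (dJ_part (P t) (U t) (N t)).
  move=> UP Nc; have [_ _ _ Pc] := UP.
  apply: icvD; apply: icv_ip; try exact: ucv_const.
    apply: ucvD.
      by apply: (ucvMb mf_w2 w2_bound); exact: (ucv_dq _ hs_neq0 (@hs_cvg R) UP).
    apply: (ucv_dq _ kn kc (H0cMb prim_w2 _ w2_bound _ UP)).
      exact: mf_sgwt.
    by move=> x; exact: sgwt_bound.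
  apply: ucvD.
    by apply: (ucvMb (prim_mf prim_phi) phi_bound); exact: (ucv_dq _ hs_neq0 (@hs_cvg R) UP).
  exact: (ucv_dq _ kn kc (H0cMb prim_phi mf_w2 phi_bound w2_bound UP)).
have [_ _ N1c _] := H0c_N1; have [_ _ N2c _] := H0c_N2.
apply: (derive_limit (Phi := Jn) Jn_derive _ (icvD (part _ _ _ h2 N2c) (part _ _ _ h1 N1c))).
move=> s; rewrite /Jn /J.
have [_ _ U1c _] := h1; have [_ _ U2c _] := h2.
have ph U : l2c U -> l2c (fun t => phi * U t).
  by move=> Uc; exact: (l2cMb (prim_mf prim_phi) phi_bound Uc).
apply: cvgB.
  exact: (icv_ip (ucv_const s (ph _ U1c)) (ucv_dq s hs_neq0 (@hs_cvg R) h2)).2.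
exact: (icv_ip (ucv_const s (ph _ U2c)) (ucv_dq s hs_neq0 (@hs_cvg R) h1)).2.
Qed.

End Evolution.

(** * Conservation of energy *)

Section Virial.
Context {R : realType}.
Notation mu := (@lebesgue_measure R).
Implicit Types (f g F G p q w : R -> R) (a b c d e h x y M s t : R).

(** A second-order Taylor bound for [r^2 / 4 + eps r^3 / 6] with [r = |u|^2], the potential energy
    density, whose gradient is the nonlinearity. *)
Lemma potential_remainder (eps K : R) : exists2 C, 0 <= C & forall a b d e r r',
  `|a| <= K -> `|b| <= K -> `|d| <= 1 -> `|e| <= 1 ->
  r = a * a + b * b -> r' = (a + d) * (a + d) + (b + e) * (b + e) ->
  `|(4^-1 * (r' * r') + eps / 6 * (r' * r' * r'))
    - (4^-1 * (r * r) + eps / 6 * (r * r * r))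
    - (d * ((r + eps * (r * r)) * a) + e * ((r + eps * (r * r)) * b))|
    <= C * (d * d + e * e).
Proof.
pose k := 2 * K ^+ 2; pose E := `|eps|.
have k0 : 0 <= k by rewrite mulr_ge0// sqr_ge0.
have E0 : 0 <= E by exact: normr_ge0.
exists (2^-1 * (k + E * (k * k)) + (8 * k + 4) * (4^-1 + E / 2 * k + E / 6 * (k + 4))).
  by have Ek := mulr_ge0 E0 k0; have := mulr_ge0 E0 (mulr_ge0 k0 k0); have := mulr_ge0 Ek k0; nra.
move=> a b d e r r' aK bK d1 e1 rE r'E0.
(* [sig] is the increment [r' - r]. The remainder equals [(r + eps r^2) q / 2] plus [sig^2] times a
   bounded factor, and [sig^2] is [O(q)]. *)
pose q := d * d + e * e; pose sig := 2 * (a * d + b * e) + q.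
have sqle x y : `|x| <= y -> x * x <= y ^+ 2.
  move=> xy; rewrite -expr2 -real_normK ?num_real// lerXn2r ?nnegrE//.
  exact: le_trans xy.
have r0 : 0 <= r by rewrite rE addr_ge0// -expr2 sqr_ge0.
have rk : r <= k by rewrite rE /k mulr_natl mulr2n; apply: lerD; exact: sqle.
have q0 : 0 <= q by rewrite addr_ge0// -expr2 sqr_ge0.
have q2 : q <= 2.
  have := sqle _ _ d1; have := sqle _ _ e1; rewrite expr1n /q => ? ?; lra.
have c1 : (a * d + b * e) ^+ 2 <= r * q.
  by have := sqr_ge0 (a * e - b * d); rewrite rE /q; lra.
have c2 : `|2 * (a * d + b * e)| <= r + q.
  rewrite ler_norml; apply/andP; split.
    by have := sqr_ge0 (a + d); have := sqr_ge0 (b + e); rewrite rE /q; lra.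
  by have := sqr_ge0 (a - d); have := sqr_ge0 (b - e); rewrite rE /q; lra.
have s1 : `|sig| <= k + 4.
  apply: le_trans (ler_normD _ _) _; rewrite (ger0_norm q0).
  by apply: le_trans (lerD c2 (lexx _)) _; lra.
have s2 : sig ^+ 2 <= (8 * k + 4) * q.
  have : sig ^+ 2 <= 8 * (r * q) + 2 * q ^+ 2.
    by have := sqr_ge0 (2 * (a * d + b * e) - q); rewrite /sig; lra.
  have : r * q <= k * q by rewrite ler_wpM2r.
  have : q ^+ 2 <= 2 * q by rewrite expr2 ler_wpM2r.
  by lra.
have r'E : r' = r + sig by rewrite r'E0 rE /sig /q; ring.
have -> : (4^-1 * (r' * r') + eps / 6 * (r' * r' * r'))
    - (4^-1 * (r * r) + eps / 6 * (r * r * r))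
    - (d * ((r + eps * (r * r)) * a) + e * ((r + eps * (r * r)) * b)) =
  2^-1 * (r + eps * (r * r)) * q +
   sig ^+ 2 * (4^-1 + eps / 2 * r + eps / 6 * sig).
  by rewrite r'E /sig /q; field.
apply: le_trans (ler_normD _ _) _; rewrite [leRHS]mulrDl; apply: lerD.
  rewrite normrM (ger0_norm q0) ler_wpM2r//.
  rewrite normrM ger0_norm ?invr_ge0// ler_pM2l ?invr_gt0//.
  apply: le_trans (ler_normD _ _) _; rewrite ger0_norm//; apply: lerD => //.
  by rewrite normrM -/E ler_wpM2l// ger0_norm ?mulr_ge0// ler_pM.
rewrite normrM (ger0_norm (sqr_ge0 _)).
rewrite [X in _ <= X](_ : _ = (8 * k + 4) * q * (4^-1 + E / 2 * k + E / 6 * (k + 4))); last by rewrite /q; ring.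
apply: ler_pM => //; first exact: sqr_ge0.
apply: le_trans (ler_normD _ _) _; apply: lerD.
  apply: le_trans (ler_normD _ _) _; rewrite ger0_norm ?invr_ge0// lerD2l.
  rewrite !normrM -/E (ger0_norm r0) normfV ger0_norm//.
  by rewrite ler_wpM2l// divr_ge0.
rewrite !normrM -/E normfV (@ger0_norm _ 6)//.
by rewrite ler_wpM2l// divr_ge0.
Qed.

(** With [X = w P] and [Y = s w^2 U], the difference of the two sides is
    [9/5 (X - 5/6 Y)^2 + Y^2 / 20]. *)
Lemma virial_pointwise (w s U P : R) : s * s = 1 ->
  5^-1 * (w ^+ 2 * P ^+ 2 + w ^+ 4 * U ^+ 2) <=
  2 * w ^+ 2 * P ^+ 2 - 3 * s * w ^+ 3 * U * P + 3 / 2 * w ^+ 4 * U ^+ 2.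
Proof.
move=> ss; have := sqr_ge0 (w * P - 5 / 6 * s * w ^+ 2 * U).
have := sqr_ge0 (w ^+ 2 * U).
have -> : (w * P - 5 / 6 * s * w ^+ 2 * U) ^+ 2 =
  w ^+ 2 * P ^+ 2 - 5 / 3 * s * w ^+ 3 * U * P + 25 / 36 * (s * s) * w ^+ 4 * U ^+ 2 by field.
by rewrite ss; lra.
Qed.

(** Write [w^5 q a] as [w^2] times the product of [w q] and [w^2 a], then use Young's inequality and
    [w^2 <= 1]. *)
Lemma dwmass_pointwise (w s a p b q : R) : 0 <= w <= 1 -> `|s| = 1 ->
  `|2 * (q * (- (4 * s * w ^+ 5) * a) - p * (- (4 * s * w ^+ 5) * b))| <=
  4 * (w * w * p * p + w * w * (w * w) * a * a +
      (w * w * q * q + w * w * (w * w) * b * b)).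
Proof.
move=> /andP[w0 w1] s1.
have -> : 2 * (q * (- (4 * s * w ^+ 5) * a) - p * (- (4 * s * w ^+ 5) * b)) =
   8 * (- s * w ^+ 2) * ((w * q) * (w ^+ 2 * a) - (w * p) * (w ^+ 2 * b)) by ring.
set T := _ + _ + _.
have hz : `|(w * q) * (w ^+ 2 * a) - (w * p) * (w ^+ 2 * b)| <= T / 2.
  rewrite ler_norml; apply/andP; split.
    have := sqr_ge0 (w * q + w ^+ 2 * a); have := sqr_ge0 (w * p - w ^+ 2 * b).
    by rewrite /T; lra.
  have := sqr_ge0 (w * q - w ^+ 2 * a); have := sqr_ge0 (w * p + w ^+ 2 * b).
  by rewrite /T; lra.
rewrite normrM (_ : 4 * T = 8 * (T / 2)); last by field.
apply: ler_pM => //.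
rewrite normrM normrM normrN s1 mul1r ger0_norm// ger0_norm ?sqr_ge0//.
by rewrite ler_piMr// exprn_ile1.
Qed.

Variables (eps : R) (U1 U2 P1 P2 : R -> R -> R).
Hypothesis h1 : H0c U1 P1.
Hypothesis h2 : H0c U2 P2.
Local Notation rho := (rho U1 U2).
Local Notation drho := (drho U1 U2 P1 P2).
Local Notation nl := (nl eps U1 U2).
Local Notation N1 := (N1 eps U1 U2).
Local Notation N2 := (N2 eps U1 U2).
Local Notation dN1 := (dN1 eps U1 U2 P1 P2).
Local Notation dN2 := (dN2 eps U1 U2 P1 P2).
Local Notation mass := (mass U1 U2).
Hypothesis ev1 : evol U1 P2 N2.
Hypothesis ev2 : evol U2 (fun t => - P1 t) (fun t => - N1 t).

Let u1 t : l2 (U1 t). Proof. by have [_ _ [+ _] _] := h1; exact. Qed.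
Let u2 t : l2 (U2 t). Proof. by have [_ _ [+ _] _] := h2; exact. Qed.
Let p1 t : l2 (P1 t). Proof. by have [_ _ _ [+ _]] := h1; exact. Qed.
Let p2 t : l2 (P2 t). Proof. by have [_ _ _ [+ _]] := h2; exact. Qed.
Let hN1 := H0c_N1 eps h1 h2.
Let hN2 := H0c_N2 eps h1 h2.
Let hr := H0c_rho h1 h2.
Let n1 t : l2 (N1 t). Proof. by have [_ _ [+ _] _] := hN1; exact. Qed.
Let n2 t : l2 (N2 t). Proof. by have [_ _ [+ _] _] := hN2; exact. Qed.
Let s1 t : Hs (U1 t) (P1 t). Proof. by have [+ _ _ _] := h1; exact. Qed.
Let s2 t : Hs (U2 t) (P2 t). Proof. by have [+ _ _ _] := h2; exact. Qed.
Let r_i t : l2 (rho t). Proof. by have [_ _ [+ _] _] := hr; exact. Qed.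
Let rr_i t : l2 (rho t * rho t).
Proof. by have [_ _ [+ _] _] := H0cM hr hr; exact. Qed.

Definition vden t : R -> R :=
  4^-1 *: (rho t * rho t) + (eps / 6) *: (rho t * rho t * rho t).
Definition potential t := Int (vden t).

Lemma itg_vden t : itg (vden t).
Proof. by apply: itgD; apply: itgZ; apply: l2M. Qed.

Lemma potential_derive t :
  is_derive t 1 potential (ip (P2 t) (dN1 t) - ip (P1 t) (dN2 t)).
Proof.
have [_ z1 _ _] := h1; have [_ z2 _ _] := h2.
pose K := (nrm (U1 t) + nrm (P1 t)) + (nrm (U2 t) + nrm (P2 t)).
have [C C0 HC] := potential_remainder eps K.
have [hN1s _ _ _] := hN1; have [hN2s _ _ _] := hN2.
apply: (flow_derive h1 h2 ev1 ev2 (c := C) (hN1s t) (hN2s t)); last first.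
  have -> : ip (N2 t) (N1 t) = ip (N1 t) (N2 t) by exact: ipC.
  by ring.
(* One half for each of the two norms keeps the increments at most 1 in the sup norm, as
   [potential_remainder] requires. *)
have half : 0 < 2^-1 :> R by rewrite invr_gt0.
have e1 := H0c_near t h1 half; have e2 := H0c_near t h2 half.
near=> h.
have [a1 a2] : nrm (U1 (t + h) - U1 t) <= 2^-1 /\ nrm (P1 (t + h) - P1 t) <= 2^-1 by near: h.
have [b1 b2] : nrm (U2 (t + h) - U2 t) <= 2^-1 /\ nrm (P2 (t + h) - P2 t) <= 2^-1 by near: h.
have da := l2B (u1 (t + h)) (u1 t); have db := l2B (u2 (t + h)) (u2 t).
rewrite /potential -IntB; [|exact: itg_vden..].
have i1 := l2M da (n1 t); have i2 := l2M db (n2 t).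
rewrite -[ip _ _ + _](IntD i1 i2) -IntB; [|by apply: itgB; exact: itg_vden|exact: itgD].
have j1 := l2M da da; have j2 := l2M db db.
rewrite !nrm_sq -(IntD j1 j2) -IntZ; last exact: itgD.
apply: le_abs_Int.
- by apply: itgB; [apply: itgB; exact: itg_vden|exact: itgD].
- by apply: itgZ; exact: itgD.
move=> x.
have K1 : `|U1 t x| <= K.
  apply: (le_trans (sup_norm_le x (s1 t) (z1 t))); rewrite /K lerDl.
  by rewrite addr_ge0// nrm_ge0.
have K2 : `|U2 t x| <= K.
  apply: (le_trans (sup_norm_le x (s2 t) (z2 t))); rewrite /K lerDr.
  by rewrite addr_ge0// nrm_ge0.
have D1 : `|U1 (t + h) x - U1 t x| <= 1.
  by apply: le_trans (H0c_sup _ _ x h1) _; lra.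
have D2 : `|U2 (t + h) x - U2 t x| <= 1.
  by apply: le_trans (H0c_sup _ _ x h2) _; lra.
have := HC _ _ _ _ _ _ K1 K2 D1 D2 erefl erefl.
have E1 : U1 t x + (U1 (t + h) x - U1 t x) = U1 (t + h) x by rewrite addrC subrK.
have E2 : U2 t x + (U2 (t + h) x - U2 t x) = U2 (t + h) x by rewrite addrC subrK.
by rewrite E1 E2.
Unshelve. all: by end_near. Qed.

Definition kinetic t := 2^-1 * (ip (P1 t) (P1 t) + ip (P2 t) (P2 t)).
Definition kinetic_dq n t := 2^-1 *
  (ip (dq (hs n) (U1 t)) (dq (hs n) (U1 t)) + ip (dq (hs n) (U2 t)) (dq (hs n) (U2 t))).

(** Discrete integration by parts turns the second-order terms into [ip (dq P2) (dq P1)] twice, with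
    opposite signs. What is left pairs first quotients of the nonlinearity and of u. *)
Lemma kinetic_dq_derive n t : is_derive t 1 (kinetic_dq n)
  (ip (dq (hs n) (N2 t)) (dq (hs n) (U1 t)) - ip (dq (hs n) (N1 t)) (dq (hs n) (U2 t))).
Proof.
pose k : R := hs n; have k0 : k != 0 := hs_neq0 n.
(* The gradient of [kinetic_dq], minus a discrete Laplacian. *)
have W f g : Hs f g -> Hs (- dq (- k) (dq k f)) (- dq (- k) (dq k g)).
  by move=> fg; apply: HsN; apply: Hs_dq; exact: Hs_dq.
have bdd f : l2 f -> nrm (dq k f) <= `|k^-1| * 2 * nrm f.
  move=> fi; rewrite nrmZ; last by apply: l2B => //; exact: l2_sh.
  rewrite -mulrA ler_wpM2l//; apply: le_trans (nrmB (l2_sh k fi) fi) _.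
  by rewrite nrm_sh// mulr_natl.
have byparts f g : l2 f -> l2 g -> ip g (- dq (- k) (dq k f)) = ip (dq k g) (dq k f).
  move=> fi gi; have dfi := l2_dq k fi.
  rewrite ipNr//; last exact: l2_dq.
  by rewrite ipC ip_dqN// opprK ipC.
apply: (flow_derive h1 h2 ev1 ev2 (c := 2^-1 * (`|k^-1| * 2) ^+ 2) (W _ _ (s1 t)) (W _ _ (s2 t))).
- exists 1 => //= h _.
  have := u1 (t + h); have := u2 (t + h); have := u1 t; have := u2 t.
  rewrite /kinetic_dq -/k.
  set a := U1 t; set b := U2 t; set a' := U1 (t + h); set b' := U2 (t + h).
  move=> bi ai bi' ai'.
  have dai := l2B ai' ai; have dbi := l2B bi' bi.
  rewrite !byparts// !dqB.
  have [qa qb qa' qb'] : [/\ l2 (dq k a), l2 (dq k b), l2 (dq k a') & l2 (dq k b')].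
    by split; exact: l2_dq.
  have ea := l2B qa' qa; have eb := l2B qb' qb.
  rewrite (_ : _ - _ = 2^-1 * (ip (dq k (a' - a)) (dq k (a' - a)) +
      ip (dq k (b' - b)) (dq k (b' - b)))); last first.
    rewrite !dqB !ipBl// !ipBr// (ipC (dq k a')) (ipC (dq k b') (dq k b)).
    by field.
  rewrite -!nrm_sq ger0_norm; last by rewrite mulr_ge0// addr_ge0// sqr_ge0.
  rewrite -mulrA ler_pM2l ?invr_gt0// mulrDr -!exprMn.
  by apply: lerD; rewrite lerXn2r ?nnegrE ?nrm_ge0 ?mulr_ge0 ?nrm_ge0// bdd.
- rewrite !byparts// -/k (ipC (dq k (P2 t))) ; ring.
Qed.

Lemma kinetic_derive t : is_derive t 1 kinetic
  (ip (dN2 t) (P1 t) - ip (dN1 t) (P2 t)).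
Proof.
have uc U P : H0c U P -> ucv t (fun n s => dq (hs n) (U s)) (P t).
  by move=> UP; exact: (ucv_dq _ (@hs_neq0 R) (@hs_cvg R) UP).
have icv1 := icv_ip (uc _ _ hN2) (uc _ _ h1).
have icv2 := icv_ip (uc _ _ hN1) (uc _ _ h2).
apply: (derive_limit (Phi := kinetic_dq) kinetic_dq_derive _ (icvD icv1 (icvN icv2))).
move=> s; apply: cvgM; first exact: cvg_cst.
have ucs U P : H0c U P -> ucv s (fun n r => dq (hs n) (U r)) (P s).
  by move=> UP; exact: (ucv_dq _ (@hs_neq0 R) (@hs_cvg R) UP).
by apply: cvgD; [exact: (icv_ip (ucs _ _ h1) (ucs _ _ h1)).2|
  exact: (icv_ip (ucs _ _ h2) (ucs _ _ h2)).2].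
Qed.

Lemma energy_conserved t : kinetic t + potential t = kinetic 0 + potential 0.
Proof.
apply: (@derive0_const _ (fun t => kinetic t + potential t)) => {}t.
have := is_deriveD (kinetic_derive t) (potential_derive t).
rewrite (ipC (dN2 t)) (ipC (dN1 t)).
set A := ip (P1 t) _; set B := ip (P2 t) _.
by rewrite (_ : A - B + (B - A) = 0); last by ring.
Qed.

(** * A priori bounds for small data *)

Definition grad t := ip (P1 t) (P1 t) + ip (P2 t) (P2 t).

Lemma grad_ge0 t : 0 <= grad t.
Proof. by rewrite addr_ge0// ip_ge0. Qed.
Lemma mass_ge0 t : 0 <= mass t.
Proof. by rewrite addr_ge0// ip_ge0. Qed.

(** [S] comes from [sup_bound] on each component. The product bound on [S^2] lets the conserved mass
    control the sextic energy; the sum bound gives the smallness of the sup norm. *)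
Lemma rho_bounds t : exists S, [/\ 0 <= S, S ^+ 2 <= 4 * (mass t * grad t),
  S <= mass t + grad t & forall x, 0 <= rho t x <= S].
Proof.
have [_ z1 _ _] := h1; have [_ z2 _ _] := h2.
exists (2 * (nrm (U1 t) * nrm (P1 t) + nrm (U2 t) * nrm (P2 t))).
rewrite /mass /grad -!nrm_sq.
have := nrm_ge0 (U1 t); have := nrm_ge0 (U2 t).
have := nrm_ge0 (P1 t); have := nrm_ge0 (P2 t) => d0 c0 b0 a0; split.
- by rewrite mulr_ge0// addr_ge0// mulr_ge0.
- have := sqr_ge0 (nrm (U1 t) * nrm (P2 t) - nrm (U2 t) * nrm (P1 t)); lra.
- have := sqr_ge0 (nrm (U1 t) - nrm (P1 t)); have := sqr_ge0 (nrm (U2 t) - nrm (P2 t)); lra.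
- move=> x; rewrite -[rho t x]/(U1 t x * U1 t x + U2 t x * U2 t x) -!expr2.
  by rewrite addr_ge0 ?sqr_ge0//= mulrDr lerD// sup_bound.
Qed.

Lemma Int_rho t : Int (rho t) = mass t.
Proof. by rewrite IntD//; exact: l2M. Qed.

Lemma itg_rho t : itg (rho t).
Proof. by apply: itgD; exact: l2M. Qed.

(** The quartic term is nonnegative. In the sextic one, the integral of [rho^3] is at most
    [S^2 mass], hence at most [4 mass^2 grad]. *)
Lemma potential_lower t :
  - (2 / 3 * `|eps| * mass t ^+ 2) * grad t <= potential t.
Proof.
have [S [S0 S2 _ rS]] := rho_bounds t; have ri := itg_rho t.
have : Int ((- (`|eps| / 6 * S ^+ 2)) *: rho t) <= potential t.
  apply: le_Int; [exact: itgZ|exact: itg_vden|move=> x].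
  change (- (`|eps| / 6 * S ^+ 2) * rho t x <=
    4^-1 * (rho t x * rho t x) + eps / 6 * (rho t x * rho t x * rho t x)).
  have /andP[] := rS x; move: (rho t x) => r r0 rS'.
  have e1 : - `|eps| * (r * r * r) <= eps * (r * r * r).
    by rewrite ler_wpM2r ?mulr_ge0// lerNl -normrN ler_norm.
  have e2 : `|eps| * (r * r * r) <= `|eps| * (S ^+ 2 * r).
    by rewrite ler_wpM2l// ler_wpM2r// expr2 ler_pM.
  by have := sqr_ge0 r; lra.
rewrite IntZ// Int_rho => /(le_trans _); apply.
have := mass_ge0 t; have := grad_ge0 t; move: (mass t) (grad t) S2 => m g S2 g0 m0.
have : `|eps| * (S ^+ 2 * m) <= `|eps| * (4 * (m * g) * m).
  by rewrite ler_wpM2l// ler_wpM2r.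
by lra.
Qed.

Lemma potential_upper t S : (forall x, 0 <= rho t x <= S) ->
  potential t <= (S / 4 + `|eps| / 6 * S ^+ 2) * mass t.
Proof.
move=> rS; have ri := itg_rho t.
rewrite -Int_rho -IntZ//.
apply: le_Int; [exact: itg_vden|exact: itgZ|move=> x].
change (4^-1 * (rho t x * rho t x) + eps / 6 * (rho t x * rho t x * rho t x)
  <= (S / 4 + `|eps| / 6 * S ^+ 2) * rho t x).
have /andP[] := rS x; move: (rho t x) => r r0 rS'.
have e1 : eps * (r * r * r) <= `|eps| * (r * r * r).
  by rewrite ler_wpM2r ?mulr_ge0// ler_norm.
have e2 : `|eps| * (r * r * r) <= `|eps| * (S ^+ 2 * r).
  by rewrite ler_wpM2l// ler_wpM2r// expr2 ler_pM.
have e3 : r * r <= S * r by rewrite ler_wpM2r.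
by lra.
Qed.

Let dlt := (8 * (1 + `|eps|))^-1.

(** As the mass is conserved, the potential is at least [- grad t / 4] at every time. Since the
    kinetic energy is [grad t / 2], this gives [grad t / 4 <= D] from an initial energy of at most
    [D], without any continuity argument in time. *)
Lemma small_data_bounds t : mass 0 <= dlt ^+ 2 -> grad 0 <= dlt ^+ 2 ->
  grad t <= 4 * dlt ^+ 2 /\ forall x, `|eps| * rho t x <= 3 / 4.
Proof.
have [D DD] : {D : R | D = dlt ^+ 2} by exists (dlt ^+ 2).
rewrite -DD => m0 g0; have e0 := normr_ge0 eps.
have D0 : 0 <= D by rewrite DD sqr_ge0.
have ep : 0 < 1 + `|eps| by rewrite ltr_pwDl.
(* The factor 8 in [dlt] serves here: both [D] and [|eps| D] are at most 1/64. *)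
have DE : (1 + `|eps|) ^+ 2 * D = 64^-1.
  by rewrite DD /dlt; field; rewrite gt_eqF.
have D1 : (1 + `|eps|) * D <= 64^-1.
  rewrite -DE expr2 -mulrA ler_peMl ?lerDl// mulr_ge0// ltW//.
have eD : `|eps| * D <= 64^-1 by rewrite (le_trans _ D1)// ler_wpM2r// lerDr.
have D2 : D <= 64^-1 by rewrite (le_trans _ D1)// ler_peMl// lerDl.
have gt0 := grad_ge0 t; have mt0 := mass_ge0 t.
have mt := mass_conserved h1 h2 ev1 ev2 t.
have [S [S0 S2 SM rS]] := rho_bounds 0.
have S2D : S <= 2 * D by rewrite (le_trans SM)// mulr_natl mulr2n lerD.
have En := energy_conserved t.
have low := potential_lower t.
have up := potential_upper rS.
have Emt : `|eps| * mass t ^+ 2 <= 64^-1 * 64^-1.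
  rewrite mt expr2 mulrA; apply: ler_pM => //; rewrite ?mulr_ge0 ?mass_ge0//.
    by rewrite (le_trans _ eD)// ler_wpM2l.
  by rewrite (le_trans m0).
have low2 : - 4^-1 * grad t <= potential t.
  apply: le_trans low; rewrite ler_wpM2r//; lra.
have up2 : potential 0 <= 2^-1 * D.
  apply: (le_trans up); apply: ler_pM => //.
  - by rewrite addr_ge0// ?mulr_ge0// sqr_ge0.
  - exact: mass_ge0.
  have : `|eps| * S ^+ 2 <= `|eps| * D * (4 * D).
    have -> : `|eps| * D * (4 * D) = `|eps| * (2 * D) ^+ 2 by ring.
    by rewrite ler_wpM2l// lerXn2r ?nnegrE// mulr_ge0.
  have : `|eps| * D * (4 * D) <= 64^-1 * (4 * 64^-1).
    by apply: ler_pM; rewrite ?mulr_ge0//; lra.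
  by lra.
have gradt : grad t <= 4 * D.
  by move: En; rewrite /kinetic -/(grad t) -/(grad 0); lra.
split=> // x.
have [S' [_ _ SM' rS']] := rho_bounds t.
have /andP[_ rx] := rS' x.
(* At most [D] from the mass and [4 D] from the gradient. *)
have : rho t x <= 5 * D.
  by apply: (le_trans rx); apply: (le_trans SM'); rewrite mt; lra.
by move=> /(ler_wpM2l e0); lra.
Qed.

(** * Local decay *)

Local Notation J := (J U1 U2 P1 P2).
Definition dJ t := dJ_part (P2 t) (U2 t) (N2 t) + dJ_part (P1 t) (U1 t) (N1 t).

Definition yden t : R -> R :=
  (w2 * P1 t) * P1 t + (w4 * U1 t) * U1 t + ((w2 * P2 t) * P2 t + (w4 * U2 t) * U2 t).
Definition wmass t := ip (w4 * U1 t) (U1 t) + ip (w4 * U2 t) (U2 t).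
Definition dwmass t := 2 * (ip (P2 t) (w4' * U1 t) - ip (P1 t) (w4' * U2 t)).

Let mw4 : mf (@w4 R). Proof. exact: prim_mf prim_w4. Qed.
Let l2_w4 f : l2 f -> l2 (w4 * f). Proof. exact: (l2Mb mw4 (@w4_bound R)). Qed.

Lemma itg_yden t : itg (yden t).
Proof.
by apply: itgD; apply: itgD; apply: l2M => //;
  [exact: l2_w2|exact: l2_w4|exact: l2_w2|exact: l2_w4].
Qed.

(** Exact derivatives of zero integral are subtracted: that of [phi (rho^2 / 2 + eps rho^3 / 3)],
    and half that of [sg w3 U^2] for each component. What remains is bounded below pointwise by
    [virial_pointwise], plus [w^2 rho^2 (1/2 + 2 eps rho / 3)], which the smallness makes
    nonnegative. *)
Lemma virial_lower t : (forall x, `|eps| * rho t x <= 3 / 4) ->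
  5^-1 * Int (yden t) <= dJ t.
Proof.
move=> small.
(* Chosen so that the derivative of [rho * hh] is [nl * drho]. *)
pose hh : R -> R := 2^-1 *: rho t + (eps / 3) *: (rho t * rho t).
pose dhh : R -> R := 2^-1 *: drho t + (eps / 3) *: (rho t * drho t + rho t * drho t).
have [hrs _ _ _] := hr; have [hrrs _ _ _] := H0cM hr hr.
have hhs : Hs hh dhh by apply: HsD; exact: HsZ.
have Z1 := Hs_Int0 (HsMb_phi (hrs t)) hhs.
have phr := HsMb_phi (hrs t).
have [_ ha hb] := hhs; have [_ hc hd] := phr.
have hz1 := itgD (l2M ha hd) (l2M hc hb).
have sgs f g : Hs f g -> f 0 = 0 -> Hs (sg * f) (sg * g).
  move=> [fg fi gi] f0; have sb x : `|sg x| <= 1 by rewrite sg_norm.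
  split; [exact: prim_sg|exact: (l2Mb mf_sg sb)|exact: (l2Mb mf_sg sb)].
have w3s f g : Hs f g -> Hs (w3 * f) (f * w3' + w3 * g).
  apply: (HsM prim_w3 _ (@w3_bound R)); first exact: mf_sgwt.
  by move=> x; exact: sgwt_bound.
have [_ z1 _ _] := h1; have [_ z2 _ _] := h2.
have W1 := w3s _ _ (sgs _ _ (s1 t) (z1 t)).
have W2 := w3s _ _ (sgs _ _ (s2 t) (z2 t)).
have Z2 := Hs_Int0 W1 (s1 t); have Z3 := Hs_Int0 W2 (s2 t).
have [_ hw1 hw1'] := W1; have [_ hw2 hw2'] := W2.
have hz2 := itgD (l2M (u1 t) hw1') (l2M hw1 (p1 t)).
have hz3 := itgD (l2M (u2 t) hw2') (l2M hw2 (p2 t)).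
have part (U P N : R -> R) : Hs U P -> l2 N -> itg (P * (w2 * P + w2U U P) + N * (phi * P + phiU U P)) /\
    dJ_part P U N = Int (P * (w2 * P + w2U U P) + N * (phi * P + phiU U P)).
  move=> [_ Ui Pi] Ni.
  have l1 : l2 (w2U U P).
    apply: l2D; last exact: l2_w2.
    apply: (l2Mb _ _ Ui); first exact: mf_sgwt.
    by move=> x; exact: sgwt_bound.
  have l3 : l2 (phiU U P) by apply: l2D; [exact: l2_w2|exact: l2_phi].
  have i1 := l2M Pi (l2D (l2_w2 Pi) l1).
  have i2 := l2M Ni (l2D (l2_phi Pi) l3).
  by split; [exact: itgD|rewrite /dJ_part -IntD].
have [i1 E1] := part _ _ _ (s1 t) (n1 t).
have [i2 E2] := part _ _ _ (s2 t) (n2 t).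
rewrite /dJ E1 E2 -IntD// -IntZ; last exact: itg_yden.
set Z1f := (X in Int X = 0) in Z1; set Z2f := (X in Int X = 0) in Z2.
set Z3f := (X in Int X = 0) in Z3.
have i12 := itgD i2 i1.
have i4 := itgZ (- 2^-1) (itgD hz2 hz3).
have i5 := itgB i12 hz1.
rewrite [leRHS](_ : _ = Int ((P2 t * (w2 * P2 t + w2U (U2 t) (P2 t)) +
    N2 t * (phi * P2 t + phiU (U2 t) (P2 t)) +
    (P1 t * (w2 * P1 t + w2U (U1 t) (P1 t)) +
    N1 t * (phi * P1 t + phiU (U1 t) (P1 t)))) - Z1f + - 2^-1 *: (Z2f + Z3f))); last first.
  rewrite (IntD i5 i4) (IntB i12 hz1) IntZ; last exact: itgD.
  by rewrite (IntD hz2 hz3) Z1 Z2 Z3 addr0 mulr0 subr0 addr0.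
apply: le_Int; [apply: itgZ; exact: itg_yden|exact: itgD|move=> x].
have ss := sg_sqr x.
have p1x := virial_pointwise (wt x) (U1 t x) (P1 t x) ss.
have p2x := virial_pointwise (wt x) (U2 t x) (P2 t x) ss.
have rx : 0 <= wt x ^+ 2 * (rho t x) ^+ 2 * (2^-1 + 2 / 3 * (eps * rho t x)).
  apply: mulr_ge0; first by rewrite mulr_ge0// sqr_ge0.
  have r0 : 0 <= rho t x.
    by rewrite -[rho t x]/(U1 t x * U1 t x + U2 t x * U2 t x) addr_ge0// -expr2 sqr_ge0.
  have := small x; rewrite -(ger0_norm r0) -normrM ler_norml => /andP[].
  by rewrite (ger0_norm r0); lra.
have rE : rho t x = U1 t x * U1 t x + U2 t x * U2 t x by [].
move: p1x p2x rx.
suff -> : (P2 t * (w2 * P2 t + w2U (U2 t) (P2 t)) +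
    N2 t * (phi * P2 t + phiU (U2 t) (P2 t)) +
    (P1 t * (w2 * P1 t + w2U (U1 t) (P1 t)) +
    N1 t * (phi * P1 t + phiU (U1 t) (P1 t))) - Z1f + - 2^-1 *: (Z2f + Z3f)) x =
  2 * wt x ^+ 2 * P1 t x ^+ 2 - 3 * sg x * wt x ^+ 3 * U1 t x * P1 t x
    + 3 / 2 * (sg x * sg x) * wt x ^+ 4 * U1 t x ^+ 2
  + (2 * wt x ^+ 2 * P2 t x ^+ 2 - 3 * sg x * wt x ^+ 3 * U2 t x * P2 t x
    + 3 / 2 * (sg x * sg x) * wt x ^+ 4 * U2 t x ^+ 2)
  + wt x ^+ 2 * (rho t x) ^+ 2 * (2^-1 + 2 / 3 * (eps * rho t x)).
  rewrite ss mulr1 => p1x p2x rx.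
  rewrite (_ : (5^-1 *: yden t) x = 5^-1 * (wt x ^+ 2 * P1 t x ^+ 2 + wt x ^+ 4 * U1 t x ^+ 2)
     + 5^-1 * (wt x ^+ 2 * P2 t x ^+ 2 + wt x ^+ 4 * U2 t x ^+ 2)); first by lra.
  change (5^-1 * (wt x * wt x * P1 t x * P1 t x + wt x * wt x * (wt x * wt x) * U1 t x * U1 t x +
    (wt x * wt x * P2 t x * P2 t x + wt x * wt x * (wt x * wt x) * U2 t x * U2 t x)) =
    5^-1 * (wt x ^+ 2 * P1 t x ^+ 2 + wt x ^+ 4 * U1 t x ^+ 2)
     + 5^-1 * (wt x ^+ 2 * P2 t x ^+ 2 + wt x ^+ 4 * U2 t x ^+ 2)).
  by ring.
rewrite rE.
(* Pointwise algebra: [f], [w], [s] stand for the values of [phi], [wt], [sg], and [(a, p)],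
   [(b, q)] for the components of u with their derivatives. *)
have fld (f w s a p b q : R) : (q * (w * w * q + ((-(2 * s * w ^+ 3)) * b + w * w * q)) + ((a * a + b
  * b) + eps * ((a * a + b * b) * (a * a + b * b))) * b * (f * q + (w * w * b + f * q))) + (p *
  (w * w * p + ((-(2 * s * w ^+ 3)) * a + w * w * p)) + ((a * a + b * b) + eps * ((a * a + b * b)
  * (a * a + b * b))) * a * (f * p + (w * w * a + f * p))) - ((2^-1 * (a * a + b * b) + eps/3 *
  ((a * a + b * b) * (a * a + b * b))) * ((a * a + b * b) * (w * w) + f * (a * p + a * p + (b * q
  + b * q))) + f * (a * a + b * b) * (2^-1 * (a * p + a * p + (b * q + b * q)) + eps/3 * ((a * a
  + b * b) * (a * p + a * p + (b * q + b * q)) + (a * a + b * b) * (a * p + a * p + (b * q + b *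
  q))))) + - 2^-1 * ((a * (s * a * (-(3 * s * w ^+ 4)) + w * w * w * (s * p)) + w * w * w * (s *
  a) * p) + (b * (s * b * (-(3 * s * w ^+ 4)) + w * w * w * (s * q)) + w * w * w * (s * b) * q))
  =
  2 * w ^+ 2 * p ^+ 2 - 3 * s * w ^+ 3 * a * p +
  3 / 2 * (s * s) * w ^+ 4 * a ^+ 2 +
  (2 * w ^+ 2 * q ^+ 2 - 3 * s * w ^+ 3 * b * q +
   3 / 2 * (s * s) * w ^+ 4 * b ^+ 2) +
  w ^+ 2 * (a * a + b * b) ^+ 2 * (2^-1 + 2 / 3 * (eps * (a * a + b * b))) by field.
exact: (fld (phi x) (wt x) (sg x) (U1 t x) (P1 t x) (U2 t x) (P2 t x)).
Qed.

Lemma dwmass_bound t : `|dwmass t| <= 4 * Int (yden t).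
Proof.
have li f : l2 f -> l2 (w4' * f).
  by apply: l2Mb; [exact: mf_sgwt|move=> x; exact: sgwt_bound].
have i1 := l2M (p2 t) (li _ (u1 t)); have i2 := l2M (p1 t) (li _ (u2 t)).
rewrite /dwmass -IntB// -IntZ; last exact: itgB.
rewrite -IntZ; last exact: itg_yden.
apply: le_abs_Int; [apply: itgZ; exact: itgB|apply: itgZ; exact: itg_yden|move=> x].
have wx : 0 <= wt x <= 1 by rewrite ltW ?wt_gt0 ?wt_le1.
exact: (dwmass_pointwise (U1 t x) (P1 t x) (U2 t x) (P2 t x) wx (sg_norm x)).
Qed.

Lemma wmass_ge0 t : 0 <= wmass t.
Proof.
have p f : 0 <= ip (w4 * f) f.
  apply: Int_ge0 => x.
  change (0 <= wt x * wt x * (wt x * wt x) * f x * f x).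
  by rewrite (_ : _ * f x = (wt x ^+ 2 * f x) ^+ 2) ?sqr_ge0//; ring.
by rewrite addr_ge0.
Qed.

Lemma wmass_le t : wmass t <= Int (yden t).
Proof.
have j1 := l2M (l2_w4 (u1 t)) (u1 t); have j2 := l2M (l2_w4 (u2 t)) (u2 t).
rewrite /wmass -[leLHS](IntD j1 j2).
apply: le_Int; [exact: itgD|exact: itg_yden|move=> x].
change (w4 x * U1 t x * U1 t x + w4 x * U2 t x * U2 t x <=
  wt x * wt x * P1 t x * P1 t x + w4 x * U1 t x * U1 t x +
  (wt x * wt x * P2 t x * P2 t x + w4 x * U2 t x * U2 t x)).
have := sqr_ge0 (wt x * P1 t x); have := sqr_ge0 (wt x * P2 t x); lra.
Qed.

Lemma J_bound t : `|J t| <= mass t + grad t.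
Proof.
have nb f : l2 f -> nrm (phi * f) <= nrm f.
  by move=> fi; rewrite -[leRHS]mul1r; exact: (nrmMb (prim_mf prim_phi) ler01 (@phi_bound R) fi).
have cs f g : l2 f -> l2 g -> `|ip (phi * f) g| <= nrm f * nrm g.
  move=> fi gi; apply: le_trans (cauchy_schwarz (l2_phi fi) gi) _.
  by rewrite ler_wpM2r ?nrm_ge0// nb.
apply: le_trans (ler_normB _ _) _.
apply: le_trans (lerD (cs _ _ (u1 t) (p2 t)) (cs _ _ (u2 t) (p1 t))) _.
rewrite /mass /grad -!nrm_sq.
have := sqr_ge0 (nrm (U1 t) - nrm (P2 t)); have := sqr_ge0 (nrm (U2 t) - nrm (P1 t)).
have := sqr_ge0 (nrm (U1 t)); have := sqr_ge0 (nrm (U2 t)).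
have := sqr_ge0 (nrm (P1 t)); have := sqr_ge0 (nrm (P2 t)).
by lra.
Qed.

(** The 1/5 of [virial_lower] gives the constants of [decay_from_virial]: 5 with [wmass_le], and 20
    = 4 * 5 with [dwmass_bound]. *)
Lemma wmass_cvg0 : mass 0 <= ((8 * (1 + `|eps|))^-1) ^+ 2 ->
  grad 0 <= ((8 * (1 + `|eps|))^-1) ^+ 2 ->
  wmass t @[t --> +oo] --> (0 : R).
Proof.
move=> m0 g0; have small t := small_data_bounds t m0 g0.
have low t := virial_lower (small t).2.
apply: (@decay_from_virial _ wmass J dwmass dJ
  (mass 0 + 4 * ((8 * (1 + `|eps|))^-1) ^+ 2)).
- move=> t.
  apply: (weighted_mass_derive h1 h2 ev1 ev2 t prim_w4 (mf_sgwt _ _) (@w4_bound R)).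
  by move=> x; exact: sgwt_bound.
- by move=> t; exact: (J_derive h1 h2 ev1 ev2 t).
- move=> t; apply: le_trans (dwmass_bound t) _.
  by have := low t; lra.
- move=> t; rewrite wmass_ge0 /=; apply: le_trans (wmass_le t) _.
  by have := low t; lra.
- move=> t; apply: le_trans (J_bound t) _.
  by rewrite (mass_conserved h1 h2 ev1 ev2 t) lerD2l; case: (small t).
Qed.

End Virial.

(** * Pointwise control by the weighted mass *)

Section LocalBound.
Context {R : realType}.

(* Integrate the derivative of [w4 F^2] from the origin. *)
Lemma local_sup (F f : R -> R) x : Hs F f -> F 0 = 0 ->
  w4 x * F x ^+ 2 <= 4 * ip (w4 * F) F + 2 * (Num.sqrt (ip (w4 * F) F) * nrm f).
Proof.
move=> [Ff Fi fi] F0.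
have mw4 : mf (@w4 R) := prim_mf prim_w4.
have w4i : l2 (w4 * F) := l2Mb mw4 (@w4_bound R) Fi.
have w4'i : l2 (w4' * F).
  by apply: (l2Mb _ _ Fi); [exact: mf_sgwt|move=> y; exact: sgwt_bound].
have pr := primM (primM prim_w4 Ff) Ff.
(* [B] dominates the derivative of [w4 F^2]: [|w4'| = 4 w^5] is at most [4 w4], and the other part
   is [2 w4 F f]. *)
pose B : R -> R := 4 *: ((w4 * F) * F) + 2 *: (fun y => `|(w4 * F) y * f y|).
have ai := integrable_norm (l2M w4i fi).
have Bi : itg B by apply: itgD; apply: itgZ; [exact: l2M|exact: ai].
have BE : Int B <= 4 * ip (w4 * F) F + 2 * (Num.sqrt (ip (w4 * F) F) * nrm f).
  rewrite IntD; [|by apply: itgZ; exact: l2M|by apply: itgZ; exact: ai].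
  rewrite IntZ; last exact: l2M.
  rewrite IntZ; last exact: ai.
  rewrite lerD2l ler_pM2l//.
  have aw : l2 (fun y => `|(w4 * F) y|).
    by apply: (l2_le _ _ w4i) => [|y]; [apply: mf_abs; exact: l2_mf|rewrite normr_id].
  have af : l2 (fun y => `|f y|).
    by apply: (l2_le _ _ fi) => [|y]; [apply: mf_abs; exact: l2_mf|rewrite normr_id].
  rewrite (_ : Int _ = ip (fun y => `|(w4 * F) y|) (fun y => `|f y|)); last first.
    by congr Int; apply/funext => y; rewrite normrM.
  apply: le_trans (ler_norm _) _; apply: le_trans (cauchy_schwarz aw af) _.
  apply: ler_pM; rewrite ?nrm_ge0//; last by apply: nrm_le => // y; rewrite normr_id.
  (* As [w4 <= 1], [w4^2 <= w4], which compares [nrm (w4 * F)] with the square root of the weighted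
     mass. *)
  rewrite /nrm ler_sqrt; last first.
    apply: Int_ge0 => y; change (0 <= wt y * wt y * (wt y * wt y) * F y * F y).
    by rewrite (_ : _ * F y = (wt y ^+ 2 * F y) ^+ 2) ?sqr_ge0//; ring.
  apply: le_Int; [exact: l2M|exact: l2M|move=> y].
  change (`|w4 y * F y| * `|w4 y * F y| <= w4 y * F y * F y).
  have w40 : 0 <= w4 y by rewrite -[w4 y]/(wt y * wt y * (wt y * wt y)) !mulr_ge0 ?(ltW (wt_gt0 _)).
  have w41 : w4 y <= 1 by rewrite (le_trans (ler_norm _))// w4_bound.
  rewrite -expr2 real_normK ?num_real// exprMn [leRHS](_ : _ = w4 y * F y ^+ 2); last by ring.
  by rewrite ler_wpM2r ?sqr_ge0// expr2 ler_piMr.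
apply: le_trans BE.
have li := prim_loci pr.
have key y z : y <= z -> `|II y z (F * (F * w4' + w4 * f) + w4 * F * f)| <= Int B.
  move=> yz; rewrite /II Rintegral_mkcond; apply: le_abs_Int => //.
    by apply: loci_patch.
  have B0 r : 0 <= B r.
    change (0 <= 4 * (wt r * wt r * (wt r * wt r) * F r * F r) + 2 * `|w4 r * F r * f r|).
    apply: addr_ge0; last exact: mulr_ge0.
    by have := sqr_ge0 (wt r ^+ 2 * F r); lra.
  move=> r; rewrite patchE; case: ifP => _; last by rewrite normr0.
  change (`|F r * (F r * (- (4 * sg r * wt r ^+ 5)) + w4 r * f r) + w4 r * F r * f r| <=
   4 * (wt r * wt r * (wt r * wt r) * F r * F r) + 2 * `|w4 r * F r * f r|).
  rewrite (_ : _ + w4 r * F r * f r = - (4 * sg r * wt r) * (wt r ^+ 2 * F r) ^+ 2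
    + 2 * (w4 r * F r * f r)); last by ring.
  apply: le_trans (ler_normD _ _) _; apply: lerD; last first.
    by rewrite normrM ger0_norm.
  rewrite normrM (ger0_norm (sqr_ge0 _)).
  rewrite [leRHS](_ : _ = 4 * (wt r ^+ 2 * F r) ^+ 2); last by ring.
  rewrite ler_wpM2r ?sqr_ge0// normrN !normrM sg_norm mulr1 ger0_norm//.
  by rewrite ler_piMr// wt_norm.
have E : w4 x * F x ^+ 2 = (w4 * F * F) x by rewrite expr2 mulrA.
have F00 : (w4 * F * F) 0 = 0 by rewrite -[LHS]/(w4 0 * F 0 * F 0) F0 mulr0.
apply: le_trans (ler_norm _) _; rewrite E (prim_ext x pr) F00 add0r.
by case: ifPn => [x0|]; [exact: key|rewrite -ltNge normrN => /ltW; exact: key].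
Qed.

End LocalBound.

(** * Test functions *)

Section TestFunctions.
Context {R : realType}.
Notation mu := (@lebesgue_measure R).
Implicit Types (f g F G p q k : R -> R) (a b c d e h x y M s t : R).

(** A chain of [n] successive derivatives given by existence; in this form, differentiability passes
    through sums, products and compositions by induction on [n]. *)
Fixpoint ndiff (n : nat) f : Prop :=
  if n is m.+1 then exists2 g, forall x, is_derive x 1 f (g x) & ndiff m g else True.

Lemma is_derive_val f x c c' : is_derive x 1 f c -> c = c' -> is_derive x 1 f c'.
Proof. by move=> ? <-. Qed.

Lemma ndiffW n f : ndiff n.+1 f -> ndiff n f.
Proof.
elim: n f => [//|n IH] f [g fg gn]; exists g => //; exact: IH.
Qed.
Lemma ndiff_cst n c : ndiff n (fun=> c).
Proof.
elim: n c => [//|n IH] c; exists (fun=> 0) => // x; exact: is_derive_cst.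
Qed.
Lemma ndiffD n f g : ndiff n f -> ndiff n g -> ndiff n (f + g).
Proof.
elim: n f g => [//|n IH] f g [f' ff' fn] [g' gg' gn].
by exists (f' + g'); [move=> x; exact: is_deriveD|exact: IH].
Qed.
Lemma ndiffM n f g : ndiff n f -> ndiff n g -> ndiff n (f * g).
Proof.
elim: n f g => [//|n IH] f g fs gs.
have := fs; have := gs => -[g' gg' gn] [f' ff' fn].
exists (f * g' + g * f'); first by move=> x; exact: is_deriveM.
by apply: ndiffD; apply: IH => //; exact: ndiffW.
Qed.
Lemma ndiffZ n c f : ndiff n f -> ndiff n (c *: f).
Proof. by move=> fn; exact: (ndiffM (ndiff_cst n c) fn). Qed.

Lemma is_derive_comp f g x df dg : is_derive x 1 g dg -> is_derive (g x) 1 f df ->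
  is_derive x 1 (f \o g) (df * dg).
Proof.
move=> [gd gE] [fd fE]; apply: DeriveDef.
  by apply/derivable1_diffP; apply: differentiable_comp; exact/derivable1_diffP.
by rewrite -derive1E derive1_comp// !derive1E gE fE.
Qed.

Lemma ndiff_exp n f : ndiff n f -> ndiff n (expR \o f).
Proof.
elim: n f => [//|n IH] f fs; have := fs => -[f' ff' fn].
exists ((expR \o f) * f'); last by apply: ndiffM => //; apply: IH; exact: ndiffW.
by move=> x; apply: is_derive_comp.
Qed.

Lemma is_derive_affine c d x : is_derive x 1 (fun x => c * x + d) c.
Proof.
apply: is_derive_eps => e e0; exists 1 => //= h _.
rewrite (_ : _ - _ - _ = 0); last by ring.
by rewrite normr0 mulr_ge0// ltW.
Qed.

Lemma ndiff_affine n c d f : ndiff n f -> ndiff n (fun x => f (c * x + d)).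
Proof.
elim: n f => [//|n IH] f [f' ff' fn].
exists (c *: (fun x => f' (c * x + d))); last by apply: ndiffZ; exact: IH.
move=> x; apply: (is_derive_val (c := f' (c * x + d) * c)); last exact: mulrC.
exact: (is_derive_comp (is_derive_affine c d x) (ff' _)).
Qed.

(* [theta m x = x^-m exp (-1/x)] for [x > 0]; this family is stable under
   differentiation. *)
Definition theta (m : nat) x : R := if 0 < x then x^-1 ^+ m * expR (- x^-1) else 0.

(** With [y = 1/x] this is [y^(m+2) <= (m+2)! e^y], a term of the exponential series. The square on
    the right gives [theta m] the derivative 0 at the origin. *)
Lemma theta_small m x : `|theta m x| <= m.+2`!%:R * x ^+ 2.
Proof.
rewrite /theta; case: ifPn => x0; last by rewrite normr0 mulr_ge0// sqr_ge0.
have y0 : 0 < x^-1 by rewrite invr_gt0.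
have := expR_ge1Dxn m.+1 (ltW y0); set y := x^-1 in y0 * => le1.
have E0 := expR_gt0 y.
have f0 : 0 < m.+2`!%:R :> R by rewrite ltr0n fact_gt0.
have le2 : y ^+ m.+2 <= m.+2`!%:R * expR y.
  rewrite mulrC -ler_pdivrMr// (le_trans _ le1)// lerDr//.
rewrite ger0_norm ?mulr_ge0 ?exprn_ge0 ?expR_ge0 ?(ltW y0)//.
rewrite expRN ler_pdivrMr// mulrAC.
have -> : x ^+ 2 = (y ^+ 2)^-1 by rewrite /y exprVn invrK.
by rewrite ler_pdivlMr ?exprn_gt0// -exprD addn2.
Qed.

Lemma theta_derive m x : is_derive x 1 (theta m)
  ((- m%:R) * theta m.+1 x + theta m.+2 x).
Proof.
have [x0|x0|x0] := ltgtP x 0.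
- apply: (@near_eq_is_derive _ _ _ (fun=> 0)).
    exists (- x) => /=; first by rewrite oppr_gt0.
    move=> y /=; rewrite ltr_norml opprK => /andP[h _].
    by rewrite /theta ifF//; apply/negbTE; rewrite -leNgt; lra.
  by rewrite /theta ltNge (ltW x0) /= mulr0 addr0; exact: is_derive_cst.
- have xn0 : x != 0 by rewrite gt_eqF.
  apply: (@near_eq_is_derive _ _ _ (fun y => y^-1 ^+ m * expR (- y^-1))).
    exists x => //= y /=; rewrite ltr_norml => /andP[_ h].
    by rewrite /theta ifT//; lra.
  have di : is_derive x 1 (fun y : R => y^-1) (- x^-1 ^+ 2).
    have xd : derivable (@id R) x 1 by [].
    apply: DeriveDef; first exact: (derivableV xn0 xd).
    by rewrite (deriveV xn0 xd) derive_id -exprVn -[LHS]/(_ * _) mulr1.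
  have dm := is_deriveX m di.
  have de : is_derive x 1 (fun y : R => expR (- y^-1)) (expR (- x^-1) * x^-1 ^+ 2).
    have := is_derive_comp (is_deriveN di) (is_derive_expR (- x^-1)).
    by rewrite opprK.
  have -> : (fun y : R => y^-1 ^+ m * expR (- y^-1)) =
      (fun y : R => y^-1) ^+ m * (fun y => expR (- y^-1)).
    by apply/funext => y; rewrite -[RHS]/(_ y * _) exprfctE.
  apply: (is_derive_val (is_deriveM dm de)).
  rewrite exprfctE /theta x0.
  change (x^-1 ^+ m * (expR (- x^-1) * x^-1 ^+ 2) +
    expR (- x^-1) * (m%:R * x^-1 ^+ m.-1 * (- x^-1 ^+ 2)) =
    - m%:R * (x^-1 ^+ m.+1 * expR (- x^-1)) + x^-1 ^+ m.+2 * expR (- x^-1)).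
  case: m {dm} => [|m]; rewrite ?expr0 /=; first by ring.
  by rewrite !exprS; ring.
- rewrite x0 /theta ltxx mulr0 addr0.
  apply: is_derive_eps => d d0.
  have f0 : 0 < m.+2`!%:R :> R by rewrite ltr0n fact_gt0.
  exists (d / m.+2`!%:R) => /=; first by rewrite divr_gt0.
  move=> h /=; rewrite sub0r normrN ltr_pdivlMr// => hd.
  rewrite ltxx add0r mulr0 !subr0.
  apply: (le_trans (theta_small m h)).
  by rewrite -real_normK ?num_real// expr2 mulrA ler_wpM2r// mulrC ltW.
Qed.

Lemma ndiff_theta n m : ndiff n (theta m).
Proof.
elim: n m => [//|n IH] m.
exists ((- m%:R) *: theta m.+1 + theta m.+2); first by move=> x; exact: theta_derive.
by apply: ndiffD => //; exact: ndiffZ.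
Qed.

(* Increases to the indicator function of the open interval (a, b). *)
Definition plateau (n : nat) a b : R -> R :=
  fun x => 1 - expR (- n%:R * (theta 0 (x - a) * theta 0 (b - x))).

(** [test_function] with its smoothness expressed by [ndiff]; see [tst_test]. *)
Definition tst f := (forall n, ndiff n f) /\ exists M, forall x, M < `|x| -> f x = 0.

Lemma theta_ge0 m x : 0 <= theta m x.
Proof.
rewrite /theta; case: ifPn => // x0.
by rewrite mulr_ge0 ?expR_ge0// exprn_ge0// invr_ge0 ltW.
Qed.

Lemma theta0_gt0 x : 0 < x -> 0 < theta 0 x.
Proof. by move=> x0; rewrite /theta x0 expr0 mul1r expR_gt0. Qed.

Lemma plateau_out n a b x : ~~ (a < x < b) -> plateau n a b x = 0.
Proof.
rewrite negb_and -!leNgt /plateau /theta => /orP[xa|xb].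
  by rewrite ltNge subr_le0 xa /= mul0r mulr0 expR0 subrr.
by rewrite (ltNge 0 (b - x)) subr_le0 xb /= !mulr0 expR0 subrr.
Qed.

Lemma plateau_bound n a b x : `|plateau n a b x| <= 1.
Proof.
have p0 : 0 <= theta 0 (x - a) * theta 0 (b - x) by rewrite mulr_ge0 ?theta_ge0.
have e1 : expR (- n%:R * (theta 0 (x - a) * theta 0 (b - x))) <= 1.
  by rewrite -expR0 ler_expR mulNr oppr_le0 mulr_ge0.
have := expR_ge0 (- n%:R * (theta 0 (x - a) * theta 0 (b - x))).
by rewrite /plateau ler_norml => h; apply/andP; split; lra.
Qed.

Lemma plateau_tst n a b : tst (plateau n a b).
Proof.
split.
  move=> m.
  have -> : plateau n a b = (fun=> 1) + (-1) *: (expR \o ((- n%:R) *: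
      ((fun x => theta 0 (1 * x + (- a))) * (fun x => theta 0 ((-1) * x + b))))).
    apply/funext => x; rewrite /plateau -[RHS]/(1 + (-1) * expR (- n%:R *
      (theta 0 (1 * x + (- a)) * theta 0 ((-1) * x + b)))).
    by rewrite mul1r mulN1r mulN1r (addrC (- x)).
  apply: ndiffD; first exact: ndiff_cst.
  apply: ndiffZ; apply: ndiff_exp; apply: ndiffZ; apply: ndiffM;
    apply: ndiff_affine; exact: ndiff_theta.
exists (Num.max `|a| `|b|) => x; rewrite gt_max => /andP[ax bx].
apply: plateau_out; apply/negP => /andP[xa xb].
move: ax bx; have := ler_norm b; have := ler_norm (- a); rewrite normrN.
by case: (ltrP x 0) => x0; [rewrite (ltr0_norm x0)|rewrite (ger0_norm x0)] => h1 h2 h3 h4; lra.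
Qed.

Lemma plateau_cvg a b x : a < x < b -> plateau n a b x @[n --> \oo] --> (1 : R).
Proof.
move=> /andP[ax xb]; rewrite /plateau.
set p := _ * _; have p0 : 0 < p by rewrite mulr_gt0// theta0_gt0// subr_gt0.
rewrite -[X in _ --> X]subr0; apply: cvgB; first exact: cvg_cst.
have -> : (fun n : nat => expR (- n%:R * p)) = (fun n => (expR (- p)) ^+ n).
  by apply/funext => n; rewrite mulNr -mulrN expRM_natl.
by apply: cvg_expr; rewrite ger0_norm ?expR_ge0// expR_lt1 oppr_lt0.
Qed.

End TestFunctions.

(** * Weak derivatives *)

Section WeakDerivatives.
Context {R : realType}.
Notation mu := (@lebesgue_measure R).
Implicit Types (f g F G p q k : R -> R) (a b c d e h x y M N s t : R).

Lemma ndiff_derivable n f : ndiff n.+1 f -> forall x, derivable (derive1n n f) x 1.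
Proof.
elim: n f => [|n IH] f [g fg gn] x; first by have [] := fg x.
rewrite derive1Sn (_ : derive1 f = g); first exact: IH.
by apply/funext => y; rewrite derive1E; have [_ ->] := fg y.
Qed.

Lemma tst_test f : tst f -> test_function f.
Proof. by move=> [fn fM]; split=> // n x; exact: (ndiff_derivable (fn n.+1)). Qed.

Lemma test_prim f : test_function f -> prim f (derive1 f).
Proof.
move=> [fd _]; apply: prim_C1.
  by move=> x; apply: DeriveDef; [exact: (fd 0%N)|rewrite derive1E].
by move=> x; apply: differentiable_continuous; apply/derivable1_diffP; exact: (fd 1%N).
Qed.

Lemma test_derive_out f M x : (forall x, M < `|x| -> f x = 0) -> M < `|x| ->
  derive1 f x = 0.
Proof.
move=> fM Mx; rewrite derive1E.
have d0 : is_derive x 1 (fun=> 0 : R) 0 by exact: is_derive_cst.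
have [] : is_derive x 1 f 0; last by move=> _ ->.
apply: near_eq_is_derive d0.
exists (`|x| - M) => /=; first by rewrite subr_gt0.
move=> y /=; rewrite ltrBrDl => h; rewrite fM//.
by have := ler_distD y x 0; rewrite !subr0; lra.
Qed.

Lemma cs_itg f M N : M <= N -> loci f -> (forall x, M < `|x| -> f x = 0) ->
  itg f /\ Int f = II (- N) N f.
Proof.
move=> MN li fM.
have E : f = f \_ `[- N, N].
  apply/funext => x; rewrite patchE mem_setE in_itv /= -ler_norml.
  by case: ifPn => //; rewrite -ltNge => Nx; rewrite fM// (le_lt_trans MN).
split; first by rewrite E; exact: loci_patch.
by rewrite [in LHS]E /Int -Rintegral_mkcond.
Qed.

(** Integration by parts on [[- N, N]], where [N] lies beyond the support of [phi], so that the
    boundary terms vanish. *)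
Lemma prim_weak F f phi : prim F f -> test_function phi ->
  [/\ itg (F * derive1 phi), itg (f * phi) & Int (F * derive1 phi) = - Int (f * phi)].
Proof.
move=> Ff pt; have pp := test_prim pt; have [_ [M pM]] := pt.
have pr := primM Ff pp; pose N := `|M| + 1.
have MN : M <= N by rewrite (le_trans (ler_norm M))// /N lerDl.
have N0 : 0 <= N by rewrite /N addr_ge0.
have l1 : loci (F * derive1 phi) := prim_lociM Ff (prim_loci pp).
have l2' : loci (f * phi) by rewrite mulrC; exact: (prim_lociM pp (prim_loci Ff)).
have o1 x : M < `|x| -> (F * derive1 phi) x = 0.
  by move=> Mx; rewrite -[LHS]/(F x * derive1 phi x) (test_derive_out pM Mx) mulr0.
have o2 x : M < `|x| -> (f * phi) x = 0.
  by move=> Mx; rewrite -[LHS]/(f x * phi x) pM// mulr0.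
have [i1 E1] := cs_itg MN l1 o1; have [i2 E2] := cs_itg MN l2' o2.
split; [exact: i1|exact: i2|].
rewrite E1 E2; apply/eqP; rewrite -addr_eq0 -IID// addrC.
rewrite (mulrC f); have NN : - N <= N by lra.
rewrite -pr.2//.
have MN' : M < N by rewrite (le_lt_trans (ler_norm M))// /N ltrDl.
by rewrite -[_ - _]/(F N * phi N - F (- N) * phi (- N)) !pM ?normrN ?ger0_norm// !mulr0 subrr.
Qed.

Lemma tst_prim f : tst f -> exists f', prim f f'.
Proof. by move=> /tst_test/test_prim; exists (derive1 f). Qed.

Lemma tst_itgM k f : loci k -> tst f -> itg (k * f).
Proof.
move=> ki ft; have [f' pf] := tst_prim ft; have [_ [M fM]] := ft.
have li : loci (k * f) by rewrite mulrC; exact: (prim_lociM pf ki).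
have o x : M < `|x| -> (k * f) x = 0.
  by move=> Mx; rewrite -[LHS]/(k x * f x) fM// mulr0.
exact: (cs_itg (lexx M) li o).1.
Qed.

(* Dominated convergence along [plateau n a b]. *)
Lemma II_eq0_of_test k : loci k -> (forall f, tst f -> Int (k * f) = 0) ->
  forall a b, II a b k = 0.
Proof.
move=> ki kt a b; have [mk _] := ki.
have ai : itg (fun x => `|(k \_ `[a, b]) x|) by exact: (integrable_norm (loci_patch a b ki)).
pose kab : R -> R := k \_ `]a, b[.
have -> : II a b k = Int kab.
  rewrite /II -Rintegral_itv_bndo_bndc; last first.
    by apply: integrableS (ki.2 a b) => // t /=; rewrite !in_itv /= => /andP[-> /ltW].
  rewrite -Rintegral_itv_obnd_cbnd; last first.
    by apply: integrableS (ki.2 a b) => // t /=; rewrite !in_itv /= => /andP[/ltW -> /ltW].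
  by rewrite Rintegral_mkcond.
have mb n : mf (k * plateau n a b) by apply: itg_mf; exact: (tst_itgM ki (plateau_tst n a b)).
have mkab : mf kab.
  by apply: (measurable_restrictT _ _).1 => //; exact: (measurable_funS measurableT).
have [|||||ik _] := @dominated_convergence _ _ R mu setT measurableT
  (fun n => EFin \o (k * plateau n a b)) (EFin \o kab) (EFin \o (fun x => `|(k \_ `[a, b]) x|)).
- by move=> n; apply/measurable_EFinP; exact: mb.
- by apply/measurable_EFinP.
- apply: aeW => x _; apply: cvg_EFin; first exact: nearW.
  rewrite /kab patchE mem_setE in_itv /=.
  case: ifPn => xab; last first.
    rewrite (_ : _ \o _ = fun=> 0); first exact: cvg_cst.
    apply/funext => n; rewrite -[LHS]/(k x * plateau n a b x) plateau_out ?mulr0//.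
  rewrite -[X in _ --> X]mulr1.
  have -> : fine \o (fun n => (EFin \o k * plateau n a b) x) = fun n => k x * plateau n a b x by [].
  by apply: cvgM; [exact: cvg_cst|exact: plateau_cvg].
- exact: ai.
- apply: aeW => x n _; rewrite lee_fin -[(k * _) x]/(k x * plateau n a b x).
  rewrite normrM patchE mem_setE in_itv /=; case: ifPn => xab.
    by rewrite ler_piMr// plateau_bound.
  rewrite plateau_out ?normr0 ?mulr0//; apply: contra xab => /andP[/ltW -> /ltW ->//].
rewrite (_ : [sequence _]_n = fun=> 0%E); last first.
  apply/funext => n; rewrite -[LHS]/(\int[mu]_x ((k * plateau n a b) x)%:E)%E.
  rewrite EFin_Int; last exact: (tst_itgM ki (plateau_tst n a b)).
  by rewrite kt//; exact: plateau_tst.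
move=> c; have := cvg_unique (@ereal_hausdorff R) c (cvg_cst 0%E).
by move=> e; apply: EFin_inj; rewrite -(EFin_Int ik); exact: e.
Qed.

(** The zero function is absolutely continuous with derivative [k], and its difference quotients
    converge almost everywhere to [k]. *)
Lemma ae0_of_II k : loci k -> (forall a b, II a b k = 0) -> {ae mu, forall x, k x = 0}.
Proof.
move=> ki k0; have pk : prim (fun=> 0) k by split=> // x y _; rewrite k0 subrr.
apply: ae_mono (prim_derive_ae pk) => x.
under eq_cvg do rewrite subrr mulr0.
by move=> /cvg_lim <- //; rewrite lim_cst.
Qed.

Lemma prim_is_derive F f x : prim F f -> continuous f -> is_derive x 1 F (f x).
Proof.
move=> [fi Ff] fc; apply: is_derive_eps => d d0.
have /cvgrPdist_le/(_ d d0) := fc x; rewrite -nbhs_nearE => /nbhs_ballP[r r0 rx].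
have B a b : a <= b -> (forall z, z \in `[a, b] -> `|f x - f z| <= d) ->
    `|F b - F a - (b - a) * f x| <= d * (b - a).
  move=> ab fz; rewrite Ff//.
  have e1 : II a b f <= II a b (fun=> f x + d).
    apply: II_le => //; first exact: loci_cst.
    by move=> z /fz; rewrite ler_norml; lra.
  have e2 : II a b (fun=> f x - d) <= II a b f.
    apply: II_le => //; first exact: loci_cst.
    by move=> z /fz; rewrite ler_norml; lra.
  rewrite II_cst// in e1; rewrite II_cst// in e2.
  by rewrite ler_norml; apply/andP; split; nra.
exists r => //= h /=; rewrite sub0r normrN => hr.
have rz z : `|z - x| <= `|h| -> `|f x - f z| <= d.
  by move=> zh; apply: rx; rewrite /ball /= distrC (le_lt_trans zh).
have [h0|h0] := leP 0 h.
  have xh : x <= x + h by rewrite lerDl.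
  have := B _ _ xh; have -> : x + h - x = h by ring.
  rewrite (ger0_norm h0); apply=> z; rewrite in_itv /= => /andP[z1 z2]; apply: rz.
  by rewrite !ger0_norm//; lra.
have xh : x + h <= x by rewrite gerDl ltW.
have := B _ _ xh; have -> : x - (x + h) = - h by ring.
rewrite -normrN (_ : - (_ - _) = F (x + h) - F x - h * f x); last by ring.
rewrite (ltr0_norm h0); apply=> z; rewrite in_itv /= => /andP[z1 z2]; apply: rz.
by rewrite (ltr0_norm h0) -(normrN (z - x)) ger0_norm; lra.
Qed.

Lemma tst_continuous f : tst f -> continuous f.
Proof. by move=> /tst_prim[f' /prim_continuous]. Qed.

Lemma prim_loci_fun F f : prim F f -> loci F.
Proof.
move=> Ff; rewrite (_ : F = F * (fun=> 1)); last by apply/funext => x; rewrite -[RHS]/(F x * 1) mulr1.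
exact: (prim_lociM Ff (loci_cst 1)).
Qed.

Lemma tst_loci f : tst f -> loci f.
Proof. by move=> /tst_prim[f' /prim_loci_fun]. Qed.

Lemma tstD f g : tst f -> tst g -> tst (f + g).
Proof.
move=> [fn [M fM]] [gn [N gN]]; split; first by move=> n; exact: ndiffD.
exists (Num.max M N) => x; rewrite gt_max => /andP[Mx Nx].
by rewrite -[LHS]/(f x + g x) fM// gN// addr0.
Qed.

Lemma tstZ c f : tst f -> tst (c *: f).
Proof.
move=> [fn [M fM]]; split; first by move=> n; exact: ndiffZ.
by exists M => x Mx; rewrite -[LHS]/(c * f x) fM// mulr0.
Qed.

Lemma tst_itg f : tst f -> itg f.
Proof.
move=> ft; rewrite (_ : f = (fun=> 1) * f); last by apply/funext => x; rewrite -[RHS]/(1 * f x) mul1r.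
exact: (tst_itgM (loci_cst 1) ft).
Qed.

(** A primitive is constant on either side of the support; the zero integral makes both constants
    equal, and subtracting them gives compact support. *)
Lemma tst_primitive f : tst f -> Int f = 0 -> exists2 F, tst F & derive1 F = f.
Proof.
move=> ft f0; have [G [Gp _]] := prim_exists (tst_loci ft).
have [fn [M fM]] := ft; pose N := `|M| + 1.
have MN : M < N by rewrite (le_lt_trans (ler_norm M))// /N ltrDl.
have N0 : 0 <= N by rewrite /N addr_ge0.
have GN : G N = G (- N).
  apply/eqP; rewrite -subr_eq0 Gp.2; last by lra.
  by rewrite -(cs_itg (ltW MN) (tst_loci ft) fM).2 f0.
have out a b : a <= b -> (forall z, z \in `[a, b] -> M < `|z|) -> G b = G a.
  move=> ab zM; apply/eqP; rewrite -subr_eq0 Gp.2//.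
  rewrite (@eq_II _ _ _ _ (fun=> 0)); first by rewrite II_cst// mul0r.
  by move=> z /zM /fM.
have Fd x : is_derive x 1 (G + (fun=> - G N)) (f x).
  have := is_deriveD (prim_is_derive x Gp (tst_continuous ft)) (is_derive_cst (- G N) x 1).
  by rewrite addr0.
exists (G + (fun=> - G N)); last first.
  by apply/funext => x; rewrite derive1E; have [_ ->] := Fd x.
split; first by case=> [//|n]; exists f.
exists N => x Nx; apply/eqP; rewrite -[_ x]/(G x - G N) subr_eq0; apply/eqP.
have [x0|x0] := leP 0 x.
  rewrite (ger0_norm x0) in Nx; apply: out; first exact: ltW.
  move=> z; rewrite in_itv /= => /andP[z1 _]; rewrite ger0_norm; lra.
rewrite (ltr0_norm x0) in Nx; rewrite GN; apply/esym/out; first by lra.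
move=> z; rewrite in_itv /= => /andP[_ z1]; rewrite -normrN ger0_norm; lra.
Qed.

(** If all test functions had integral zero, [II_eq0_of_test] for the constant 1 would make the
    length of [[0, 1]] vanish. *)
Lemma tst_unit_mass : exists2 f : R -> R, tst f & Int f = 1.
Proof.
have [[f ft f0]|no] := EM (exists2 f : R -> R, tst f & Int f <> 0).
  exists ((Int f)^-1 *: f); first exact: tstZ.
  by rewrite IntZ ?mulVf//; [exact/eqP|exact: tst_itg].
have := II_eq0_of_test (loci_cst (1 : R)).
move=> /(_ _ 0 1); rewrite II_cst// subr0 mulr1 => h; exfalso.
have : (1 : R) = 0.
  apply: h => f ft; rewrite (_ : _ * f = f); last by apply/funext => x; exact: mul1r.
  by apply: contrapT => f0; apply: no; exists f.
by move/eqP; rewrite oner_eq0.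
Qed.

(* du Bois-Reymond. *)
Lemma ae_cst_of_weak_deriv0 k : loci k ->
  (forall F f, tst F -> tst f -> derive1 F = f -> Int (k * f) = 0) ->
  exists c, {ae mu, forall x, k x = c}.
Proof.
move=> ki k0; have [f0 f0t f01] := tst_unit_mass.
pose c := Int (k * f0); exists c.
have kc : loci (k + (fun=> - c)) by apply: lociD => //; exact: loci_cst.
apply: ae_mono (ae0_of_II kc (II_eq0_of_test kc _)).
  by move=> x /eqP; rewrite -[_ x]/(k x - c) subr_eq0 => /eqP.
(* Removing a multiple of [f0] leaves a function of zero integral, hence the derivative of a test
   function. *)
move=> f ft; pose g := f + (- Int f) *: f0.
have gt : tst g by apply: tstD => //; exact: tstZ.
have g0 : Int g = 0.
  rewrite IntD; [|exact: tst_itg|by apply: itgZ; exact: tst_itg].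
  by rewrite IntZ ?f01 ?mulr1 ?subrr//; exact: tst_itg.
have [F Ft Fg] := tst_primitive gt g0.
have := k0 F g Ft gt Fg.
have -> : k * g = k * f + (- Int f) *: (k * f0).
  apply/funext => x; change (k x * (f x + - Int f * f0 x) = k x * f x + - Int f * (k x * f0 x)).
  by ring.
rewrite IntD; [|exact: tst_itgM|by apply: itgZ; exact: tst_itgM].
rewrite IntZ; last exact: tst_itgM.
rewrite -/c => e.
have -> : (k + (fun=> - c)) * f = k * f + (- c) *: f by apply/funext => x; exact: mulrDl.
rewrite IntD; [|exact: tst_itgM|by apply: itgZ; exact: tst_itg].
rewrite IntZ; last exact: tst_itg.
by rewrite -e; ring.
Qed.

(** [f] minus a primitive of [g] has weak derivative zero, so it is constant almost everywhere. *)
Lemma weak_deriv_prim f g : loci f -> loci g ->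
  (forall phi, test_function phi -> Int (f * derive1 phi) = - Int (g * phi)) ->
  exists F, prim F g /\ {ae mu, forall x, f x = F x}.
Proof.
move=> fi gi fg; have [G [Gp _]] := prim_exists gi.
have Gi := prim_loci_fun Gp.
have [||c hc] := @ae_cst_of_weak_deriv0 (f + (-1) *: G).
- by apply: lociD => //; exact: lociZ.
- move=> F h Ft ht Fh.
  have [i1 i2 E] := prim_weak Gp (tst_test Ft).
  rewrite Fh in i1 E.
  have -> : (f + (-1) *: G) * h = f * h + (-1) *: (G * h).
    by apply/funext => x; change ((f x + -1 * G x) * h x = f x * h x + -1 * (G x * h x)); ring.
  rewrite IntD; [|exact: tst_itgM|exact: itgZ].
  by rewrite IntZ// E -Fh fg ?mulN1r ?opprK ?addNr//; exact: tst_test.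
exists (G + (fun=> c)); split.
  by have := primD Gp (prim_cst c); rewrite (_ : g + _ = g)//; apply/funext => x; exact: addr0.
apply: ae_mono hc => x e; rewrite -[RHS]/(G x + c) -e.
by change (f x = G x + (f x + -1 * G x)); ring.
Qed.

Lemma prim_ae F f g : prim F f -> prim F g -> {ae mu, forall x, f x = g x}.
Proof.
move=> Ff Fg; apply: ae_mono (ae_and (prim_derive_ae Ff) (prim_derive_ae Fg)).
move=> x [h1 h2]; exact: (cvg_unique (@Rhausdorff R) h1 h2).
Qed.

End WeakDerivatives.

(** * Complex-valued Sobolev functions *)

Section ComplexFunctions.
Context {R : realType}.
Notation mu := (@lebesgue_measure R).
Implicit Types (u v z : R -> R[i]) (f g F G : R -> R).

Definition re u : R -> R := fun x => complex.Re (u x).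
Definition im u : R -> R := fun x => complex.Im (u x).

Lemma cmod_sqr (z : R[i]) : cmod z ^+ 2 = complex.Re z * complex.Re z + complex.Im z * complex.Im z.
Proof. by case: z => a b; rewrite /cmod /= sqr_sqrtr ?addr_ge0 ?sqr_ge0// !expr2. Qed.

Lemma cmod_ge0 (z : R[i]) : 0 <= cmod z.
Proof. by case: z => a b; exact: sqrtr_ge0. Qed.

Lemma Re_le_cmod (z : R[i]) : `|complex.Re z| <= cmod z.
Proof.
by rewrite -(ler_pXn2r (n := 2)) ?nnegrE ?cmod_ge0// cmod_sqr real_normK ?num_real// -expr2 lerDl -expr2 sqr_ge0.
Qed.

Lemma Im_le_cmod (z : R[i]) : `|complex.Im z| <= cmod z.
Proof.
by rewrite -(ler_pXn2r (n := 2)) ?nnegrE ?cmod_ge0// cmod_sqr real_normK ?num_real// -expr2 lerDr sqr_ge0.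
Qed.

Lemma cLnorm2_sqr u : cmeasurable u ->
  (cLnorm 2%:E setT u `^ 2 = \int[mu]_x ((re u * re u + im u * im u) x)%:E)%E.
Proof.
move=> [m1 m2]; rewrite /cLnorm patch_setT poweR_Lnorm//.
apply: eq_integral => x _.
by rewrite gee0_abs ?lee_fin ?cmod_ge0// poweR_EFin powR_mulrn ?cmod_ge0// cmod_sqr.
Qed.

Lemma L2P u : L2 u <-> l2 (re u) /\ l2 (im u).
Proof.
split.
  move=> [um uf]; have [m1 m2] := um.
  have fin : itg (re u * re u + im u * im u).
    apply/integrableP; split.
      by apply/measurable_EFinP; apply: mfD; apply: mfM.
    have := cLnorm2_sqr um.
    under eq_integral do rewrite -[X in X%:E]ger0_norm ?addr_ge0 -?expr2 ?sqr_ge0//.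
    move=> <-; rewrite poweR_lty//.
  by split; split=> //; apply: itg_le fin => [|x]; try exact: mfX;
    rewrite ger0_norm ?sqr_ge0// expr2 ?lerDl ?lerDr -expr2 sqr_ge0.
move=> [[m1 i1] [m2 i2]]; have um : cmeasurable u by [].
split=> //; have := cLnorm2_sqr um.
rewrite EFin_Int; last by apply: itgD; [exact: i1|exact: i2].
rewrite ltey; apply: contra_eqN => /eqP ->.
by rewrite poweRyr.
Qed.

Lemma cLnorm2E u : L2 u ->
  (cLnorm 2%:E setT u `^ 2 = (ip (re u) (re u) + ip (im u) (im u))%:E)%E.
Proof.
move=> u2; rewrite cLnorm2_sqr; last by case: u2.
have [[m1 i1] [m2 i2]] := (L2P u).1 u2.
by rewrite EFin_Int ?IntD//; apply: itgD.
Qed.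

Lemma ReM_real (z : R[i]) a : complex.Re (z * a%:C%C) = complex.Re z * a.
Proof. by case: z => x y /=; rewrite mulr0 subr0. Qed.
Lemma ImM_real (z : R[i]) a : complex.Im (z * a%:C%C) = complex.Im z * a.
Proof. by case: z => x y /=; rewrite mulr0 add0r. Qed.

Lemma is_weak_derivP u v : is_weak_deriv u v <-> forall phi, test_function phi ->
  Int (re u * derive1 phi) = - Int (re v * phi) /\
  Int (im u * derive1 phi) = - Int (im v * phi).
Proof.
have E z phi : cintegral (fun x => z x * (phi x)%:C%C) =
    Complex (Int (re z * phi)) (Int (im z * phi)).
  by rewrite /cintegral; congr Complex; apply: eq_Rintegral => x _; rewrite (ReM_real, ImM_real).
split=> [uv phi /uv|uv phi /uv [e1 e2]]; rewrite !E; first by case.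
by rewrite e1 e2.
Qed.

Lemma ae0_continuous (K : R -> R) : continuous K -> {ae mu, forall x, K x = 0} ->
  forall x, K x = 0.
Proof.
move=> Kc [N [mN N0 KN]] x; apply: contrapT => Kx.
have [r r0 rK] : exists2 r, 0 < r & forall y, ball x r y -> K y != 0.
  have := Kc x; move=> /cvgrPdist_lt/(_ `|K x|); rewrite normr_gt0 => /(_ (introN eqP Kx)).
  move=> /nbhs_ballP[r r0 h]; exists r => // y /h; apply: contraTneq => ->.
  by rewrite subr0 ltxx.
have : (mu (ball x r) <= mu N)%E.
  apply: le_measure; rewrite ?inE//; first exact: measurable_ball.
  by move=> y /rK Ky; apply: KN => /= K0; rewrite K0 eqxx in Ky.
rewrite N0 (lebesgue_measure_ball x (ltW r0)) -[0%E]/((0 : R)%:E) lee_fin.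
by rewrite leNgt mulrn_wgt0.
Qed.

Lemma ae_sym (f g : R -> R) : {ae mu, forall x, f x = g x} -> {ae mu, forall x, g x = f x}.
Proof. exact: ae_mono. Qed.

Lemma ae_trans (f g k : R -> R) : {ae mu, forall x, f x = g x} ->
  {ae mu, forall x, g x = k x} -> {ae mu, forall x, f x = k x}.
Proof. by move=> e1 e2; apply: ae_mono (ae_and e1 e2) => x [-> ->]. Qed.

Lemma prim_ae_eq (F G p q : R -> R) : prim F p -> prim G q -> {ae mu, forall x, F x = G x} -> F = G.
Proof.
move=> hF hG FG; apply/funext => x; apply/eqP; rewrite -subr_eq0; apply/eqP.
apply: (ae0_continuous (K := F - G)).
  exact: prim_continuous (primB hF hG).
by apply: ae_mono FG => y e; rewrite -[LHS]/(F y - G y) e subrr.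
Qed.

(* [F1] and [F2] are absolutely continuous representatives of the real and
   imaginary parts of [u]. *)
Definition rep u F1 F2 p1 p2 := [/\ cmeasurable u, Hs F1 p1, Hs F2 p2,
  {ae mu, forall x, re u x = F1 x} & {ae mu, forall x, im u x = F2 x}].

Lemma H1_rep u : H1 u ->
  exists F1 F2, rep u F1 F2 (re (weak_deriv u)) (im (weak_deriv u)).
Proof.
move=> [u2 ex]; have [g2 ug] := xgetPex (fun=> 0) ex.
rewrite -[xget _ _]/(weak_deriv u) in g2 ug.
have [ui1 ui2] := (L2P u).1 u2; have [gi1 gi2] := (L2P _).1 g2.
move/is_weak_derivP in ug.
have [F1 [Fp1 F1e]] := weak_deriv_prim (l2_loci ui1) (l2_loci gi1) (fun phi h => (ug phi h).1).
have [F2 [Fp2 F2e]] := weak_deriv_prim (l2_loci ui2) (l2_loci gi2) (fun phi h => (ug phi h).2).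
exists F1, F2; split=> //; first by case: u2.
- by split=> //; apply: l2_ae ui1 => //; exact: prim_mf Fp1.
- by split=> //; apply: l2_ae ui2 => //; exact: prim_mf Fp2.
Qed.

Lemma rep_L2 u F1 F2 p1 p2 : rep u F1 F2 p1 p2 -> l2 (re u) /\ l2 (im u).
Proof.
move=> [[m1 m2] [_ F1i _] [_ F2i _] e1 e2].
by split; [apply: l2_ae F1i => //; exact: ae_sym|apply: l2_ae F2i => //; exact: ae_sym].
Qed.

Lemma rep_weak_deriv u F1 F2 p1 p2 : rep u F1 F2 p1 p2 ->
  is_weak_deriv u (fun x => Complex (p1 x) (p2 x)).
Proof.
move=> r; have [[m1 m2] [h1 _ _] [h2 _ _] e1 e2] := r; have [l1 l2'] := rep_L2 r.
apply/is_weak_derivP => phi pt.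
have pp := test_prim pt.
have wk f F p : l2 f -> prim F p -> {ae mu, forall x, f x = F x} ->
    Int (f * derive1 phi) = - Int (p * phi).
  move=> fi Fp fF; have [i1 i2 <-] := prim_weak Fp pt.
  apply: Int_ae.
  - by apply: mfM; [exact: l2_mf|exact: (prim_loci pp).1].
  - by apply: itg_mf.
  - by apply: ae_mono fF => x fx; rewrite -[LHS]/(f x * _) fx.
by split; [exact: wk l1 h1 e1|exact: wk l2' h2 e2].
Qed.

Lemma rep_H1 u F1 F2 p1 p2 : rep u F1 F2 p1 p2 -> H1 u.
Proof.
move=> r; have [_ [_ _ q1] [_ _ q2] _ _] := r; have := rep_L2 r.
move=> /L2P u2; split=> //; exists (fun x => Complex (p1 x) (p2 x)); split.
  by apply/L2P; split.
exact: rep_weak_deriv r.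
Qed.

(** Continuous representatives agree everywhere, and an absolutely continuous function determines
    its derivative almost everywhere. This makes the choice in [weak_deriv] harmless. *)
Lemma rep_unique u F1 F2 p1 p2 G1 G2 q1 q2 : rep u F1 F2 p1 p2 -> rep u G1 G2 q1 q2 ->
  {ae mu, forall x, p1 x = q1 x} /\ {ae mu, forall x, p2 x = q2 x}.
Proof.
move=> [_ [hF1 _ _] [hF2 _ _] eF1 eF2] [_ [hG1 _ _] [hG2 _ _] eG1 eG2].
have key F G p q f : prim F p -> prim G q -> {ae mu, forall x, f x = F x} ->
    {ae mu, forall x, f x = G x} -> {ae mu, forall x, p x = q x}.
  move=> hF hG eF eG; apply: prim_ae (hF) _.
  by rewrite (prim_ae_eq hF hG (ae_trans (ae_sym eF) eG)).
by split; [exact: key hF1 hG1 eF1 eG1|exact: key hF2 hG2 eF2 eG2].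
Qed.

Lemma H1norm_rep u F1 F2 p1 p2 : rep u F1 F2 p1 p2 ->
  H1norm u = (Num.sqrt (ip F1 F1 + ip F2 F2 + (ip p1 p1 + ip p2 p2)))%:E.
Proof.
move=> r; have h := rep_H1 r; have [G1 [G2 r']] := H1_rep h.
have [ep1 ep2] := rep_unique r r'.
have [_ [_ F1i p1i] [_ F2i p2i] e1 e2] := r.
have [_ [_ G1i q1i] [_ G2i q2i] _ _] := r'.
have [l1 l2'] := rep_L2 r.
have ipE f g : l2 f -> l2 g -> {ae mu, forall x, f x = g x} -> ip f f = ip g g.
  move=> fi gi fg; apply: Int_ae; [by apply: mfM; exact: l2_mf..|].
  by apply: ae_mono fg => x e; rewrite -[LHS]/(f x * f x) e.
rewrite /H1norm !cLnorm2E; [|by apply/L2P; split..].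
rewrite (ipE _ _ l1 F1i e1) (ipE _ _ l2' F2i e2) -(ipE _ _ p1i q1i ep1) -(ipE _ _ p2i q2i ep2).
by rewrite -EFinD poweR_EFin powR12_sqrt// !addr_ge0// ip_ge0.
Qed.

(** Real functions suffice to test the equation: the real and imaginary parts of the resulting
    identity give the evolution of both components. *)
Lemma rep_real (w w' : R -> R) : Hs w w' -> rep (fun x => (w x)%:C%C) w 0 w' 0.
Proof.
move=> ww; have [wp wi _] := ww; split=> //.
- split; first exact: l2_mf.
  exact: mf_cst.
- by have := HsZ 0 ww; rewrite !scale0r.
- exact: aeW.
- exact: aeW.
Qed.

Lemma rep_sub u v F1 F2 p1 p2 G1 G2 q1 q2 :
  rep u F1 F2 p1 p2 -> rep v G1 G2 q1 q2 ->
  rep (fun x => u x - v x) (F1 - G1) (F2 - G2) (p1 - q1) (p2 - q2).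
Proof.
move=> [[m1 m2] f1 f2 e1 e2] [[n1 n2] g1 g2 d1 d2].
have E1 : re (fun x => u x - v x) = re u - re v.
  by apply/funext => x; rewrite !fctE /re; case: (u x) (v x) => ? ? [].
have E2 : im (fun x => u x - v x) = im u - im v.
  by apply/funext => x; rewrite !fctE /im; case: (u x) (v x) => ? ? [].
split; [|exact: HsB|exact: HsB|..].
- split; [change (mf (re (fun x => u x - v x)))|change (mf (im (fun x => u x - v x)))].
    by rewrite E1; exact: mfB.
  by rewrite E2; exact: mfB.
- by rewrite E1; apply: ae_mono (ae_and e1 d1) => x [h h']; rewrite !fctE h h'.
- by rewrite E2; apply: ae_mono (ae_and e2 d2) => x [h h']; rewrite !fctE h h'.
Qed.

Lemma toHm1_real u (w : R -> R) :
  toHm1 u (fun x => (w x)%:C%C) = Complex (ip (re u) w) (ip (im u) w).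
Proof.
by rewrite /toHm1 /cintegral; congr Complex; apply: eq_Rintegral => x _;
  rewrite conjc_real ?ReM_real ?ImM_real.
Qed.

Lemma dxx_real u F1 F2 p1 p2 (w w' : R -> R) : rep u F1 F2 p1 p2 -> Hs w w' ->
  dxx u (fun x => (w x)%:C%C) = Complex (- ip p1 w') (- ip p2 w').
Proof.
move=> r ww; have rw := rep_real ww.
have [G1 [G2 r']] := H1_rep (rep_H1 r); have [W1 [W2 rw']] := H1_rep (rep_H1 rw).
have [ep1 ep2] := rep_unique r r'; have [ew1 ew2] := rep_unique rw rw'.
have [_ [_ _ p1i] [_ _ p2i] _ _] := r; have [_ _ w'i] := ww.
have [_ [_ _ q1i] [_ _ q2i] _ _] := r'; have [_ [_ _ v1i] [_ _ v2i] _ _] := rw'.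
rewrite /dxx /cintegral; set z := weak_deriv u in q1i q2i ep1 ep2 *.
set v := weak_deriv _ in v1i v2i ew1 ew2 *.
have E1 : (fun x => complex.Re (z x * conjc (v x))) = re z * re v + im z * im v.
  by apply/funext => x; rewrite !fctE /re /im; case: (z x) (v x) => a b [c d] /=; ring.
have E2 : (fun x => complex.Im (z x * conjc (v x))) = im z * re v - re z * im v.
  by apply/funext => x; rewrite !fctE /re /im; case: (z x) (v x) => a b [c d] /=; ring.
rewrite E1 E2 -[LHS]/(Complex (- _) (- _)); congr (Complex (- _) (- _)).
  apply: Int_ae.
  - by apply: mfD; apply: mfM; exact: l2_mf.
  - by apply: mfM; exact: l2_mf.
  - apply: ae_mono (ae_and ep1 (ae_and ew1 ew2)) => x [a [b c]].
    by rewrite !fctE -a -b -c mulr0 addr0.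
apply: Int_ae.
- by apply: mfB; apply: mfM; exact: l2_mf.
- by apply: mfM; exact: l2_mf.
- apply: ae_mono (ae_and ep2 (ae_and ew1 ew2)) => x [a [b c]].
  by rewrite !fctE -a -b -c mulr0 subr0.
Qed.

End ComplexFunctions.

(** * From the complex equation to the real system *)

Section RealForm.
Context {R : realType}.
Notation mu := (@lebesgue_measure R).
Implicit Types (f g F p w : R -> R) (d e h s t x : R).

Lemma ae_opp (Q : R -> Prop) : {ae mu, forall x, Q x} -> {ae mu, forall x, Q (- x)}.
Proof.
move=> [N [mN N0 QN]]; exists ((-%R : R -> measurableTypeR R) @^-1` N); split.
- by rewrite -[X in measurable X]setTI; exact: (oppr_measurable measurableT mN).
- by have := lebesgue_measureN mN; rewrite N0.
- by move=> x; exact: QN.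
Qed.

(** Oddness is known for [f], continuity for [F]. The continuous function [F x + F (- x)] vanishes
    almost everywhere, hence at 0. *)
Lemma odd_continuous0 f F : (forall x, f (- x) = - f x) -> continuous F ->
  {ae mu, forall x, f x = F x} -> F 0 = 0.
Proof.
move=> fo Fc fF; pose K : R -> R := F + (F \o -%R).
have Kc : continuous K.
  move=> x; apply: cvgD; first exact: Fc.
  by apply: continuous_comp; [exact: continuousN|exact: Fc].
have := ae0_continuous Kc _ 0; rewrite /K !fctE /= oppr0 => h.
suff : F 0 + F 0 = 0 by lra.
apply: h; apply: ae_mono (ae_and fF (ae_opp fF)) => x [<- <-].
by rewrite fo subrr.
Qed.

Lemma ip_ae f F w : l2 f -> l2 F -> l2 w -> {ae mu, forall x, f x = F x} ->
  ip f w = ip F w.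
Proof.
move=> fi Fi wi e; apply: Int_ae; [by apply: mfM; exact: l2_mf..|].
by apply: ae_mono e => x ex; rewrite -[LHS]/(f x * w x) ex.
Qed.

(** The test function is scaled into the unit ball of H^1. Dividing by an arbitrary
    [M > nrm w + nrm w'] also covers [w = 0]; the bound then follows by letting [M] decrease. *)
Lemma Hm1norm_bound (u : R -> R[i]) (U : (R -> R[i]) -> R[i]) w w' d : l2 (re u) -> l2 (im u) -> Hm1 U ->
  Hs w w' -> (Hm1norm (fun v => (toHm1 u v - U v)%R) <= d%:E)%E ->
  `|ip (re u) w - complex.Re (U (fun x => (w x)%:C%C))| <= d * (nrm w + nrm w') /\
  `|ip (im u) w - complex.Im (U (fun x => (w x)%:C%C))| <= d * (nrm w + nrm w').
Proof.
move=> u1 u2 [Ul _] ww Ud; have [_ wi w'i] := ww.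
set z := U _.
have z1 : H1 (fun=> 0 : R[i]).
  have := rep_H1 (rep_real (HsZ 0 ww)); congr H1; apply/funext => x.
  by rewrite -[(0 *: w) x]/(0 * w x) mul0r.
(* Used to extract scalars, since antilinearity is stated for combinations [a v + w]. *)
have U0 : U (fun=> 0) = 0.
  have := Ul 1 _ _ z1 z1; rewrite (_ : (fun=> _) = fun=> 0); last first.
    by apply/funext => x; rewrite mulr0 addr0.
  rewrite conjc1 mul1r => /eqP; rewrite -subr_eq0 opprD addrA subrr sub0r oppr_eq0.
  by move=> /eqP.
have key M : nrm w + nrm w' < M -> `|ip (re u) w - complex.Re z| <= d * M /\
    `|ip (im u) w - complex.Im z| <= d * M.
  move=> wM; have M0 : 0 < M by apply: le_lt_trans wM; rewrite addr_ge0 ?nrm_ge0.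
  have vs := HsZ M^-1 ww; have rv := rep_real vs.
  have v1 : (H1norm (fun x => ((M^-1 *: w) x)%:C%C) <= 1)%E.
    rewrite (H1norm_rep rv) lee_fin -(@sqrtr1 R) ler_wsqrtr//.
    have i0 : ip (0 : R -> R) 0 = 0 by rewrite /ip mulr0 Int0.
    rewrite i0 !addr0 -!nrm_sq !nrmZ// gtr0_norm ?invr_gt0// !exprMn -mulrDr exprVn.
    rewrite mulrC ler_pdivrMr ?exprn_gt0// mul1r.
    have := nrm_ge0 w; have := nrm_ge0 w'; nra.
  have zE : U (fun x => ((M^-1 *: w) x)%:C%C) = (M^-1)%:C%C * z.
    have := Ul (M^-1)%:C%C _ _ (rep_H1 (rep_real ww)) z1.
    rewrite U0 addr0 conjc_real => <-; congr U; apply/funext => x.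
    by rewrite addr0 -[(_ *: w) x]/(_ * w x) rmorphM.
  have : (cmod (toHm1 u (fun x => ((M^-1 *: w) x)%:C%C) -
      U (fun x => ((M^-1 *: w) x)%:C%C)) <= d)%R.
    rewrite -lee_fin; apply: le_trans Ud; apply: ereal_sup_ubound.
    by exists (fun x => ((M^-1 *: w) x)%:C%C) => //; split=> //; exact: rep_H1 rv.
  rewrite zE toHm1_real !ipZr// => h.
  have MM a : `|M^-1 * a| <= d -> `|a| <= d * M.
    by rewrite normrM gtr0_norm ?invr_gt0// mulrC ler_pdivrMr.
  split; apply: MM; apply: le_trans h.
    apply: le_trans (Re_le_cmod _); case: (z) => a b /=.
    by rewrite mul0r subr0 mulrBr.
  apply: le_trans (Im_le_cmod _); case: (z) => a b /=.
  by rewrite mul0r addr0 mulrBr.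
have d0 : 0 <= d.
  have S0 := addr_ge0 (nrm_ge0 w) (nrm_ge0 w').
  have [|h _] := key (nrm w + nrm w' + 1); first by rewrite ltrDl.
  have := le_trans (normr_ge0 _) h; rewrite pmulr_lge0//; lra.
have lim a : (forall M, nrm w + nrm w' < M -> a <= d * M) -> a <= d * (nrm w + nrm w').
  move=> h; apply/ler_addgt0Pr => e e0.
  have d1 : 0 < d + 1 by lra.
  apply: le_trans (h (nrm w + nrm w' + e / (d + 1)) _) _.
    by rewrite ltrDl divr_gt0.
  rewrite mulrDr lerD2l mulrCA -[leRHS]mulr1 (ler_wpM2l (ltW e0))// ler_pdivrMr//; lra.
by split; apply: lim => M /key[].
Qed.

Variables (eps : R) (u : R -> R -> R[i]).
Hypotheses (uc : continuous_H1 u) (uo : odd_in_space u) (us : solves_NLS eps u).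
Variables (U1 U2 P1 P2 : R -> R -> R).
Hypothesis ur : forall t, rep (u t) (U1 t) (U2 t) (P1 t) (P2 t).

Lemma H1norm_cvg t : Num.sqrt (ip (U1 s - U1 t) (U1 s - U1 t) +
    ip (U2 s - U2 t) (U2 s - U2 t) + (ip (P1 s - P1 t) (P1 s - P1 t) +
    ip (P2 s - P2 t) (P2 s - P2 t))) @[s --> t] --> (0 : R).
Proof.
have := uc.2 t.
under eq_fun do rewrite (H1norm_rep (rep_sub (ur _) (ur t))).
by move=> /fine_cvg.
Qed.

Lemma rep_H0c : H0c U1 P1 /\ H0c U2 P2.
Proof.
have s1 t : Hs (U1 t) (P1 t) by case: (ur t).
have s2 t : Hs (U2 t) (P2 t) by case: (ur t).
have ge f := ip_ge0 f.
have z1 t : U1 t 0 = 0.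
  have [_ [+ _ _] _ e _] := ur t; move=> /prim_continuous c.
  by apply: (odd_continuous0 (f := re (u t))) => // x; rewrite /re uo; case: (u t x).
have z2 t : U2 t 0 = 0.
  have [_ _ [+ _ _] _ e] := ur t; move=> /prim_continuous c.
  by apply: (odd_continuous0 (f := im (u t))) => // x; rewrite /im uo; case: (u t x).
have lc (P : R -> R -> R) : (forall t, l2 (P t)) ->
    (forall t s, ip (P s - P t) (P s - P t) <= ip (U1 s - U1 t) (U1 s - U1 t) +
    ip (U2 s - U2 t) (U2 s - U2 t) + (ip (P1 s - P1 t) (P1 s - P1 t) +
    ip (P2 s - P2 t) (P2 s - P2 t))) -> l2c P.
  move=> Pi PN; split=> // t; apply: to0_le (H1norm_cvg t) => s.
  by rewrite nrm_ge0 /= ler_wsqrtr.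
have add_le a b c d : 0 <= a -> 0 <= b -> 0 <= c -> 0 <= d ->
    [/\ a <= a + b + (c + d), b <= a + b + (c + d), c <= a + b + (c + d) & d <= a + b + (c + d)].
  by move=> a0 b0 c0 d0; split; lra.
have le4 t s := add_le _ _ _ _ (ge (U1 s - U1 t)) (ge (U2 s - U2 t)) (ge (P1 s - P1 t)) (ge (P2 s - P2 t)).
split; split=> //.
- by apply: lc => [t|t s]; [case: (s1 t)|case: (le4 t s)].
- by apply: lc => [t|t s]; [case: (s1 t)|case: (le4 t s)].
- by apply: lc => [t|t s]; [case: (s2 t)|case: (le4 t s)].
- by apply: lc => [t|t s]; [case: (s2 t)|case: (le4 t s)].
Qed.

Lemma ip_nonlinearity t w : l2 w ->
  ip (re (nonlinearity eps (u t))) w = ip (N1 eps U1 U2 t) w /\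
  ip (im (nonlinearity eps (u t))) w = ip (N2 eps U1 U2 t) w.
Proof.
move=> wi; have [h1 h2] := rep_H0c.
have [[m1 m2] _ _ e1 e2] := ur t; rewrite -[X in measurable_fun _ X]/(re (u t)) in m1.
rewrite -[X in measurable_fun _ X]/(im (u t)) in m2.
pose r := re (u t) * re (u t) + im (u t) * im (u t).
have mr : mf r by apply: mfD; apply: mfM.
have mn : mf (r + eps *: (r * r)) by apply: mfD => //; apply: mfZ; exact: mfM.
have E x : nonlinearity eps (u t) x = u t x * ((r + eps *: (r * r)) x)%:C%C.
  rewrite /nonlinearity (exprM _ 2 2) cmod_sqr -/(r x) -rmorphM -mulrDl -rmorphD mulrC.
  by rewrite expr2.
have E1 : re (nonlinearity eps (u t)) = (r + eps *: (r * r)) * re (u t).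
  by apply/funext => x; rewrite /re E ReM_real mulrC.
have E2 : im (nonlinearity eps (u t)) = (r + eps *: (r * r)) * im (u t).
  by apply/funext => x; rewrite /im E ImM_real mulrC.
have [_ _ [N1i _] _] := H0c_N1 eps h1 h2; have [_ _ [N2i _] _] := H0c_N2 eps h1 h2.
rewrite E1 E2; split; apply: Int_ae; try by apply: mfM; [exact: mfM|exact: l2_mf].
- by apply: mfM; exact: l2_mf.
- apply: ae_mono (ae_and e1 e2) => x [a b].
  by rewrite /r /N1 /nl /rho !fctE a b.
- by apply: mfM; exact: l2_mf.
- apply: ae_mono (ae_and e1 e2) => x [a b].
  by rewrite /r /N2 /nl /rho !fctE a b.
Qed.

Lemma NLS_evol : evol U1 P2 (N2 eps U1 U2) /\
  evol U2 (fun t => - P1 t) (fun t => - N1 eps U1 U2 t).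
Proof.
have [h1 h2] := rep_H0c.
have [_ _ [N1i _] _] := H0c_N1 eps h1 h2; have [_ _ [N2i _] _] := H0c_N2 eps h1 h2.
suff key t d : 0 < d -> \forall h \near (0 : R), forall w w', Hs w w' ->
    `|ip (U1 (t + h) - U1 t) w - h * (ip (P2 t) w' + ip (N2 eps U1 U2 t) w)|
       <= d * `|h| * (nrm w + nrm w') /\
    `|ip (U2 (t + h) - U2 t) w - h * (ip (- P1 t) w' + ip (- N1 eps U1 U2 t) w)|
       <= d * `|h| * (nrm w + nrm w').
  by split=> t d d0; move: (key t d d0); apply: filterS => h H w w' /H[].
move=> d0; have [ut [[utm utc] ute]] := us t.
have : \forall h \near (0 : R)^', (Hm1norm (fun v => (toHm1 (fun x => (h^-1)%:C%C *
    (u (t + h) x - u t x)) v - ut v)%R) <= d%:E)%E.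
  apply: (utc [set y | (y <= d%:E)%E]).
  exists d => //= y /=; rewrite sub0r normrN lee_fin => yd.
  exact: le_trans (ler_norm _) (ltW yd).
move=> [e e0 he]; exists e => // h hball w w' ww; have [_ wi w'i] := ww.
(* The limit defining the time derivative excludes [h = 0], where both sides vanish. *)
have [->|h0] := eqVneq h 0.
  by rewrite addr0 !subrr /ip !mul0r Int0 subrr normr0 mulr0 mul0r.
have r := rep_sub (ur (t + h)) (ur t).
have [l1 l2'] := rep_L2 r; have [_ [_ a1 _] [_ a2 _] e1 e2] := r.
have [_ [_ _ p1i] [_ _ p2i] _ _] := ur t.
set du := (fun x => u (t + h) x - u t x) in r l1 l2' e1 e2.
have E1 : re (fun x => (h^-1)%:C%C * (u (t + h) x - u t x)) = h^-1 *: re du.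
  apply/funext => x; rewrite -[RHS]/(h^-1 * complex.Re (du x)) /re -/(du x).
  by case: (du x) => a b /=; rewrite mul0r subr0.
have E2 : im (fun x => (h^-1)%:C%C * (u (t + h) x - u t x)) = h^-1 *: im du.
  apply/funext => x; rewrite -[RHS]/(h^-1 * complex.Im (du x)) /im -/(du x).
  by case: (du x) => a b /=; rewrite mul0r addr0.
have [||b1 b2] := Hm1norm_bound _ _ utm ww (he h hball h0).
- by rewrite E1; exact: l2Z.
- by rewrite E2; exact: l2Z.
rewrite E1 ipZl// (ip_ae l1 a1 wi e1) in b1.
rewrite E2 ipZl// (ip_ae l2' a2 wi e2) in b2.
have [n1 n2] := ip_nonlinearity t wi.
have := ute _ (rep_H1 (rep_real ww)); rewrite toHm1_real (dxx_real (ur t) ww) n1 n2.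
(* With [ut w = a + i b], the equation reads [- b - ip P1 w' = ip N1 w] and
   [a - ip P2 w' = ip N2 w]. *)
case: (ut _) b1 b2 => a b /= b1 b2 [].
rewrite !ipNl// !mul0r mul1r sub0r add0r.
move=> q1 q2.
have scale X Y : `|h^-1 * X - Y| <= d * (nrm w + nrm w') ->
    `|X - h * Y| <= d * `|h| * (nrm w + nrm w').
  move=> H; rewrite (_ : X - h * Y = h * (h^-1 * X - Y)); last by field.
  by rewrite normrM mulrAC mulrC ler_wpM2r.
split; apply: scale.
  by have -> : ip (P2 t) w' + ip (N2 eps U1 U2 t) w = a by lra.
by have -> : - ip (P1 t) w' - ip (N1 eps U1 U2 t) w = b by lra.
Qed.

Lemma initial_data_le d : 0 <= d -> (H1norm (u 0) <= d%:E)%E ->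
  mass U1 U2 0 <= d ^+ 2 /\ grad P1 P2 0 <= d ^+ 2.
Proof.
move=> d0; rewrite (H1norm_rep (ur 0)) lee_fin => h.
have m0 : 0 <= mass U1 U2 0 by rewrite addr_ge0// ip_ge0.
have g0 : 0 <= grad P1 P2 0 by rewrite addr_ge0// ip_ge0.
have : mass U1 U2 0 + grad P1 P2 0 <= d ^+ 2.
  by rewrite -[leLHS](sqr_sqrtr (addr_ge0 m0 g0)) lerXn2r ?nnegrE ?sqrtr_ge0.
by split; lra.
Qed.

End RealForm.

(** * From pointwise decay to norms over a bounded interval *)

Section LocalNorms.
Context {R : realType}.
Notation mu := (@lebesgue_measure R).
Implicit Types (u : R -> R[i]) (S L x : R) (I : set R).

(** [I] is contained in [[- L, L]], whose length gives the factor [sqrt (2 L)] of the L^2 norm. *)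
Lemma cLnorm_local u I L S : cmeasurable u -> is_interval I -> 0 <= S -> 0 <= L ->
  (forall x, I x -> `|x| <= L) -> {ae mu, forall x, I x -> cmod (u x) <= S} ->
  (cLnorm 2%:E I u + cLnorm +oo I u <= (Num.sqrt (2 * L) * S + S)%:E)%E.
Proof.
move=> [m1 m2] Ii S0 L0 IL uS; have mI := is_interval_measurable Ii.
rewrite [leRHS]EFinD; apply: leeD; last first.
  rewrite /cLnorm unlock; case: ifP => // _; apply/ess_supP.
  apply: ae_mono uS => x uS /=; rewrite patchE; case: ifPn => [|_].
    by rewrite inE => /uS h; rewrite gee0_abs ?lee_fin ?cmod_ge0.
  by rewrite abse0 lee_fin.
pose r := (re u * re u + im u * im u) \_ I.
have mr : mf r.
  apply: (measurable_restrictT _ _).1 => //; apply: measurable_funTS.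
  by apply: mfD; apply: mfM.
pose k : R -> R := (fun=> S ^+ 2) \_ `[- L, L].
have ik : itg k by apply: loci_patch; exact: loci_cst.
have Ik : Int k = 2 * L * S ^+ 2.
  rewrite /k /Int -Rintegral_mkcond -[LHS]/(II (- L) L (fun=> S ^+ 2)) II_cst; last by lra.
  by ring.
have -> : (Num.sqrt (2 * L) * S)%:E = ((Int k)%:E `^ 2^-1)%E.
  rewrite Ik poweR_EFin powR12_sqrt ?mulr_ge0 ?sqr_ge0//.
  by rewrite [in RHS]sqrtrM ?mulr_ge0// sqrtr_sqr ger0_norm.
have rE x : (`|((fun x => (cmod (u x))%:E) \_ I) x| `^ 2 = (r x)%:E)%E.
  rewrite /r !patchE; case: ifPn => _; last by rewrite abse0 poweR0r.
  by rewrite gee0_abs ?lee_fin ?cmod_ge0// poweR_EFin powR_mulrn ?cmod_ge0// cmod_sqr.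
rewrite /cLnorm unlock; under eq_integral do rewrite rE.
have r0 x : 0 <= r x.
  rewrite /r patchE; case: ifP => // _; rewrite -[leRHS]/(re u x * re u x + im u x * im u x).
  by rewrite addr_ge0// -expr2 sqr_ge0.
have k0 x : 0 <= k x by rewrite /k patchE; case: ifP => // _; exact: sqr_ge0.
apply: gt0_ler_poweR.
- by rewrite invr_ge0.
- by rewrite in_itv /= leey andbT; apply: integral_ge0 => x _; rewrite lee_fin.
- by rewrite in_itv /= leey andbT lee_fin Ik !mulr_ge0 ?sqr_ge0.
rewrite -EFin_Int//; apply: ae_ge0_le_integral => //.
- by move=> x _; rewrite lee_fin.
- exact/measurable_EFinP.
- by move=> x _; rewrite lee_fin.
- by apply/measurable_EFinP; exact: itg_mf.
apply: ae_mono uS => x uS _; rewrite lee_fin /r /k !patchE.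
case: ifPn => [|_]; last by case: ifP => // _; exact: sqr_ge0.
rewrite inE => Ix; rewrite mem_setE in_itv /= -ler_norml IL//.
by rewrite -[leLHS]cmod_sqr lerXn2r ?nnegrE ?cmod_ge0// uS.
Qed.

Lemma w4_lower L x : `|x| <= L -> ((1 + L) ^+ 4)^-1 <= w4 x.
Proof.
move=> xL; have x0 : 0 < 1 + `|x| by rewrite ltr_pwDl.
have -> : w4 x = wt x ^+ 4 by rewrite /w4 /w2 !fctE; ring.
have L1 : 0 < 1 + L by apply: lt_le_trans x0 _; rewrite lerD2l.
rewrite /wt exprVn lef_pV2 ?posrE ?exprn_gt0//.
by apply: lerXn2r; rewrite ?nnegrE ?lerD2l// ltW.
Qed.

Lemma ip_w4_ge0 (f : R -> R) : 0 <= ip (w4 * f) f.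
Proof.
apply: Int_ge0 => x; change (0 <= wt x * wt x * (wt x * wt x) * f x * f x).
by rewrite (_ : _ * f x = (wt x ^+ 2 * f x) ^+ 2) ?sqr_ge0//; ring.
Qed.

(** [local_sup] for both components, whence the doubled constants 8 and 4, divided by the lower
    bound of [w4] on [[- L, L]]. *)
Lemma pointwise_bound (U1 U2 P1 P2 : R -> R -> R) t L x : H0c U1 P1 -> H0c U2 P2 ->
  grad P1 P2 t <= 1 -> `|x| <= L ->
  U1 t x ^+ 2 + U2 t x ^+ 2 <=
  (1 + L) ^+ 4 * (8 * wmass U1 U2 t + 4 * Num.sqrt (wmass U1 U2 t)).
Proof.
move=> [s1 z1 _ _] [s2 z2 _ _] g1 xL; have [_ _ p1] := s1 t; have [_ _ p2] := s2 t.
set m := wmass _ _ t.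
have key F f : Hs F f -> F 0 = 0 -> ip (w4 * F) F <= m -> ip f f <= 1 ->
    w4 x * F x ^+ 2 <= 4 * m + 2 * Num.sqrt m.
  move=> Ff F0 Fm f1; apply: le_trans (local_sup x Ff F0) _.
  have n1 : nrm f <= 1 by rewrite -(@sqrtr1 R) ler_wsqrtr.
  apply: lerD; first by rewrite ler_pM2l.
  rewrite ler_pM2l// -[leRHS]mulr1 ler_pM ?nrm_ge0 ?sqrtr_ge0//.
  by rewrite ler_wsqrtr.
have k1 : w4 x * U1 t x ^+ 2 <= 4 * m + 2 * Num.sqrt m.
  apply: key (s1 t) (z1 t) _ _; first by rewrite lerDl ip_w4_ge0.
  by apply: le_trans g1; rewrite lerDl ip_ge0.
have k2 : w4 x * U2 t x ^+ 2 <= 4 * m + 2 * Num.sqrt m.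
  apply: key (s2 t) (z2 t) _ _; first by rewrite lerDr ip_w4_ge0.
  by apply: le_trans g1; rewrite lerDr ip_ge0.
have L1 : 0 < 1 + L by have := normr_ge0 x; lra.
rewrite mulrC -ler_pdivrMr ?exprn_gt0// mulrC.
apply: le_trans (ler_wpM2r _ (w4_lower xL)) _; first by rewrite addr_ge0 ?sqr_ge0.
by rewrite mulrDr; lra.
Qed.

End LocalNorms.

Theorem corollary1p2 (R : realType) (eps : R) (eps_neq0 : eps != 0) :
  exists delta : R, 0 < delta /\
    forall u : R -> R -> R[i],
      continuous_H1 u -> odd_in_space u -> solves_NLS eps u ->
      (H1norm (u 0%R) <= delta%:E)%E ->
      forall I : set R, is_interval I -> bounded_set I ->
        (cLnorm 2%:E I (u t) + cLnorm +oo I (u t))%E @[t --> +oo] --> 0%E.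
Proof.
have e1 : 0 < 1 + `|eps| by rewrite ltr_pwDl.
(* The threshold of [small_data_bounds], which bounds u for all times and makes the virial form
   coercive. *)
set d := (8 * (1 + `|eps|))^-1; have d0 : 0 < d by rewrite invr_gt0 mulr_gt0.
exists d; split=> // u uc uo us ud I Ii [M [_ MI]].
have [U1 hU1] := choice (fun t => H1_rep (uc.1 t)); have [U2 ur] := choice hU1.
have [h1 h2] := rep_H0c uc uo ur.
have [ev1 ev2] := NLS_evol uc uo us ur.
have [m0 g0] := initial_data_le ur (ltW d0) ud.
have wm := wmass_cvg0 h1 h2 ev1 ev2 m0 g0.
pose P1 t := re (weak_deriv (u t)); pose P2 t := im (weak_deriv (u t)).
have g1 t : grad P1 P2 t <= 1.
  have [+ _] := small_data_bounds h1 h2 ev1 ev2 t m0 g0; move/le_trans; apply.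
  have : d <= 8^-1 by rewrite /d lef_pV2 ?posrE ?mulr_gt0// ler_peMr// lerDl.
  rewrite -/d => d8; rewrite expr2; nra.
pose L := `|M| + 1; have L0 : 0 <= L by rewrite addr_ge0.
have IL x : I x -> `|x| <= L.
  by apply: MI; rewrite /L (le_lt_trans (ler_norm M))// ltrDl.
pose m := wmass U1 U2.
(* A bound for the modulus of u on [[- L, L]], which tends to 0 with the weighted mass [m]. *)
pose S t := Num.sqrt ((1 + L) ^+ 4 * (8 * m t + 4 * Num.sqrt (m t))).
have Sc : S t @[t --> +oo] --> (0 : R).
  rewrite -[X in _ --> X](@sqrtr0 R); apply: continuous_cvg; first exact: sqrt_continuous.
  have -> : (0 : R) = (1 + L) ^+ 4 * (8 * 0 + 4 * Num.sqrt 0) by rewrite sqrtr0 !mulr0 addr0 mulr0.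
  apply: cvgM; first exact: cvg_cst.
  apply: cvgD; first by apply: cvgM wm; exact: cvg_cst.
  apply: cvgM; first exact: cvg_cst.
  by apply: continuous_cvg wm; exact: sqrt_continuous.
have up t : (cLnorm 2%:E I (u t) + cLnorm +oo I (u t) <=
    (Num.sqrt (2 * L) * S t + S t)%:E)%E.
  have [um _ _ e1' e2'] := ur t; apply: cLnorm_local => //; first exact: sqrtr_ge0.
  apply: ae_mono (ae_and e1' e2') => x [a b] /IL xL.
  rewrite -[leLHS]ger0_norm ?cmod_ge0// -sqrtr_sqr ler_wsqrtr//.
  rewrite cmod_sqr -[complex.Re _]/(re (u t) x) -[complex.Im _]/(im (u t) x) a b.
  exact: pointwise_bound h1 h2 (g1 t) xL.
apply: (@squeeze_cvge _ _ _ _ (fun=> 0%E) _ (fun t => (Num.sqrt (2 * L) * S t + S t)%:E)); last first.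
- have -> : 0%E = (Num.sqrt (2 * L) * 0 + 0 : R)%:E by rewrite mulr0 addr0.
  apply: cvg_EFin; first exact: nearW.
  by apply: cvgD => //; apply: cvgM Sc; exact: cvg_cst.
- exact: cvg_cst.
- by apply: nearW => t; rewrite up andbT adde_ge0// Lnorm_ge0.
Qed.
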